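(* Let $a,b\in\mathbf{C}$ with $a\neq0$, let $F(y)=ay^3+ay^2+by+2$, and let $k_F=\jmath_F\circ\iota$. Then $k_F$ is (birationally conjugate to) an automorphism of a compact complex surface: there exist a compact complex surface $\mathcal{Z}$ and a birational map $\pi:\mathcal{Z}\to\mathbf{P}^2$ such that the induced map $\pi^{-1}\circ k_F\circ\pi$ is a biholomorphic map of $\mathcal{Z}$ to itself. Further, the degrees $\deg(k_F^m)$ grow quadratically in $m$, and $k_F$ is integrable.
   Context: For a polynomial $F\in\mathbf{C}[y]$ define the birational involutions of $\mathbf{C}^2$ $$\jmath_F(x,y)=(-x+F(y),\,y),\qquad \iota(x,y)=\left(1-x-\frac{x-1}{y},\ -y-1-\frac{y}{x-1}\right),$$ and $k_F=\jmath_F\circ\iota$, viewed as a birational map of $\mathbf{P}^2$ via $(x,y)\leftrightarrow[1:x:y]$. The degree $\deg(f)$ of a rational map $f=[f_0:f_1:f_2]$ of $\mathbf{P}^2$ is the common degree of the homogeneous polynomials $f_0,f_1,f_2$ when these have no common factor; $k_F^m$ denotes the $m$-th iterate. ''The degrees grow quadratically'' means that there are constants $0<c\le C$ with $c\,m^2\le\deg(k_F^m)\le C\,m^2$ for all sufficiently large $m$. ''Integrable'' means that there is a nonconstant rational function $\phi$ on $\mathbf{P}^2$ with $\phi\circ k_F=\phi$. *)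

(* Defs.v *)
From HB Require Import structures.
From mathcomp Require Import all_boot all_order all_algebra.
From mathcomp Require Import generic_quotient fraction complex.
From mathcomp Require Import (canonicals, coercions) mpoly.
From mathcomp Require Import mathcomp_extra boolp classical_sets functions reals.
From mathcomp Require Import topology normedtype derive.
Import numFieldNormedType.Exports.
Import Order.TTheory GRing.Theory Num.Theory.

Set Implicit Arguments.
Unset Strict Implicit.
Unset Printing Implicit Defensive.

Local Open Scope quotient_scope.
Local Open Scope classical_set_scope.
Local Open Scope ring_scope.

(* [C] stands for the field of complex numbers.  Its topology is the one of its
   norm, and [differentiable] between normed C-modules is C-linear (Fréchet)
   differentiability, so that a map is holomorphic on an open set iff it is
   [differentiable] at each of its points. *)

(* The values of [cmap] outside of [cdom], and of [cinv] outside of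
   [cmap @` cdom], are irrelevant. *)
Record chart (C : numClosedFieldType) (E : normedModType C) (T : Type) :=
  Chart { cdom : set T; cmap : T -> E; cinv : E -> T }.

Record is_chart (C : numClosedFieldType) (E : normedModType C)
    (T : topologicalType) (c : chart E T) : Prop := IsChart {
  chart_dom_open : open (cdom c);
  chart_cod_open : open (cmap c @` cdom c);
  chart_mapK : forall x, cdom c x -> cinv c (cmap c x) = x;
  chart_map_cts : forall x, cdom c x -> {for x, continuous (cmap c)};
  chart_inv_cts : forall x, cdom c x -> {for cmap c x, continuous (cinv c)} }.

Record complexManifold (C : numClosedFieldType) (E : normedModType C) :=
  ComplexManifold {
    carrier :> topologicalType;
    atlas : set (chart E carrier);
    atlas_chart : forall c, atlas c -> is_chart c;
    atlas_cover : forall x, exists2 c, atlas c & cdom c x;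
    atlas_transition : forall c d x, atlas c -> atlas d -> cdom c x ->
      cdom d x -> differentiable (cmap d \o cinv c) (cmap c x) }.

Section Manifolds.
Variable C : numClosedFieldType.
Implicit Types E G : normedModType C.

Definition holomorphic_at E G (X : complexManifold E) (Y : complexManifold G)
    (f : X -> Y) (x : X) : Prop :=
  {for x, continuous f} /\
  forall c d, atlas c -> atlas d -> cdom c x -> cdom d (f x) ->
    differentiable (cmap d \o f \o cinv c) (cmap c x).

Definition holomorphic_fun_at E (X : complexManifold E) (f : X -> C) (x : X)
    : Prop :=
  forall c, atlas c -> cdom c x -> differentiable (f \o cinv c) (cmap c x).

Definition analytic_subset E (X : complexManifold E) (A : set X) : Prop :=
  forall x : X, exists (n : nat) (f : 'I_n -> X -> C),
    \forall y \near x, (forall i, holomorphic_fun_at (f i) y) /\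
                       (A y <-> forall i, f i y = 0).

Definition prod_chart E G S T (c : chart E S) (d : chart G T)
    : chart (E * G)%type (S * T)%type :=
  Chart (cdom c `*` cdom d) (fun p => (cmap c p.1, cmap d p.2))
        (fun q => (cinv c q.1, cinv d q.2)).

Definition prod_atlas E G (X : complexManifold E) (Y : complexManifold G)
    : set (chart (E * G)%type (X * Y)%type) :=
  [set e | exists c d, [/\ atlas c, atlas d & e = prod_chart c d]].

Lemma differentiable_fst E G (p : E * G) :
  differentiable (fst : E * G -> E) p.
Proof. by apply: linear_differentiable => q; exact: cvg_fst. Qed.

Lemma differentiable_snd E G (p : E * G) :
  differentiable (snd : E * G -> G) p.
Proof. by apply: linear_differentiable => q; exact: cvg_snd. Qed.

Lemma open_setX (S T : topologicalType) (A : set S) (B : set T) :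
  open A -> open B -> open (A `*` B).
Proof.
rewrite !openE => oA oB [x y] [/= Ax By].
by exists (A, B) => //; split; [exact: oA | exact: oB].
Qed.

Lemma prod_atlas_chart E G (X : complexManifold E) (Y : complexManifold G) e :
  prod_atlas e -> is_chart (e : chart _ (X * Y)%type).
Proof.
move=> [c [d [/atlas_chart hc /atlas_chart hd ->]]].
have imE : (fun p : X * Y => (cmap c p.1, cmap d p.2)) @` (cdom c `*` cdom d) =
    (cmap c @` cdom c) `*` (cmap d @` cdom d).
  apply/seteqP; split=> [_ [[x y] [/= cx dy] <-]|[_ _] [/= [x cx <-] [y dy <-]]].
    by split; [exists x | exists y].
  by exists (x, y).
split=> /=.
- exact: open_setX (chart_dom_open hc) (chart_dom_open hd).
- by rewrite imE; exact: open_setX (chart_cod_open hc) (chart_cod_open hd).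
- by move=> [x y] [/= cx dy]; rewrite (chart_mapK hc) // (chart_mapK hd).
- move=> [x y] [/= cx dy]; apply: cvg_pair => /=.
    exact: (@continuous_comp _ _ _ fst (cmap c) (x, y) (@cvg_fst _ _ _ _ _)
      (chart_map_cts hc cx)).
  exact: (@continuous_comp _ _ _ snd (cmap d) (x, y) (@cvg_snd _ _ _ _ _)
    (chart_map_cts hd dy)).
- move=> [x y] [/= cx dy]; apply: cvg_pair => /=.
    exact: (@continuous_comp _ _ _ fst (cinv c) (cmap c x, cmap d y)
      (@cvg_fst _ _ _ _ _) (chart_inv_cts hc cx)).
  exact: (@continuous_comp _ _ _ snd (cinv d) (cmap c x, cmap d y)
    (@cvg_snd _ _ _ _ _) (chart_inv_cts hd dy)).
Qed.

Lemma prod_atlas_cover E G (X : complexManifold E) (Y : complexManifold G)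
    (p : X * Y) : exists2 e, prod_atlas e & cdom e p.
Proof.
have [c ac cx] := atlas_cover p.1; have [d ad dy] := atlas_cover p.2.
by exists (prod_chart c d) => //; exists c, d.
Qed.

Lemma prod_atlas_transition E G (X : complexManifold E) (Y : complexManifold G)
    e e' (p : X * Y) : prod_atlas e -> prod_atlas e' -> cdom e p ->
  cdom e' p -> differentiable (cmap e' \o cinv e) (cmap e p).
Proof.
move=> [c [d [ac ad ->]]] [c' [d' [ac' ad' ->]]]; case: p => x y /=.
move=> [/= cx dy] [/= cx' dy'].
have dc := atlas_transition ac ac' cx cx'.
have dd := atlas_transition ad ad' dy dy'.
apply: (@differentiable_pair _ _ _ _ (fun q : E * G => cmap c' (cinv c q.1))
  (fun q : E * G => cmap d' (cinv d q.2))).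
- apply: (@differentiable_comp _ _ _ _ fst (cmap c' \o cinv c)) => //.
  exact: differentiable_fst.
- apply: (@differentiable_comp _ _ _ _ snd (cmap d' \o cinv d)) => //.
  exact: differentiable_snd.
Qed.

Definition prod_manifold E G (X : complexManifold E) (Y : complexManifold G)
    : complexManifold (E * G)%type :=
  ComplexManifold (@prod_atlas_chart E G X Y) (@prod_atlas_cover E G X Y)
    (@prod_atlas_transition E G X Y).

Definition complexSurface := complexManifold (C * C)%type.

Definition compact_surface (X : complexSurface) : Prop :=
  [/\ hausdorff_space X, compact [set: X] & connected [set: X]].

(* A bimeromorphic map, for compact X and Y: a biholomorphism [bim_map] from
   the complement of a nowhere dense analytic subset [bim_exc] of X onto the
   complement of a nowhere dense analytic subset [bim_cexc] of Y, such that the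
   closure of its graph is analytic in X * Y.  The values of [bim_map] on
   [bim_exc] and of its inverse [bim_inv] on [bim_cexc] are irrelevant.  If X
   and Y are projective, these are the birational maps. *)
Record bimeromorphic (X Y : complexSurface) := Bimeromorphic {
  bim_exc : set X;
  bim_cexc : set Y;
  bim_map : X -> Y;
  bim_inv : Y -> X;
  bim_exc_analytic : analytic_subset bim_exc;
  bim_cexc_analytic : analytic_subset bim_cexc;
  bim_exc_nowhere_dense : dense (~` bim_exc);
  bim_cexc_nowhere_dense : dense (~` bim_cexc);
  bim_mapP : forall x, ~ bim_exc x ->
    [/\ ~ bim_cexc (bim_map x), bim_inv (bim_map x) = x
      & holomorphic_at bim_map x];
  bim_invP : forall y, ~ bim_cexc y ->
    [/\ ~ bim_exc (bim_inv y), bim_map (bim_inv y) = y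
      & holomorphic_at bim_inv y];
  bim_graph_analytic : @analytic_subset _ (prod_manifold X Y)
    (closure [set p : X * Y | ~ bim_exc p.1 /\ p.2 = bim_map p.1]) }.

Definition biholomorphic (X Y : complexSurface) (f : X -> Y) : Prop :=
  exists g : Y -> X, [/\ cancel f g, cancel g f,
    forall x, holomorphic_at f x & forall y, holomorphic_at g y].

End Manifolds.

Section ProjectivePlane.
Variable C : numClosedFieldType.

Definition nzvec : Type := {v : 'rV[C]_3 | v != 0}.
HB.instance Definition _ := SubType.on nzvec.
HB.instance Definition _ := Choice.on nzvec.
HB.instance Definition _ :=
  Topological.copy nzvec (initial_topology (val : nzvec -> 'rV[C]_3)).

Definition collinear (v w : nzvec) : bool := (val v == val w)%MS.

Lemma collinear_refl : reflexive collinear.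
Proof. by move=> v; apply/eqmxP. Qed.

Lemma collinear_sym : symmetric collinear.
Proof. by move=> v w; rewrite /collinear andbC. Qed.

Lemma collinear_trans : transitive collinear.
Proof.
move=> w v u /eqmxP vw /eqmxP wu; apply/eqmxP; exact: eqmx_trans vw wu.
Qed.

Canonical collinear_equiv :=
  EquivRel collinear collinear_refl collinear_sym collinear_trans.

Definition P2_type : Type := quotient_topology {eq_quot collinear_equiv}.
HB.instance Definition _ := Quotient.on P2_type.
HB.instance Definition _ := Choice.on P2_type.
HB.instance Definition _ :=
  Topological.copy P2_type (quotient_topology {eq_quot collinear_equiv}).

Definition P2_class (v : nzvec) : P2_type := \pi_P2_type v.

(* Homogeneous coordinates of a point (one of the possible choices). *)
Definition hcoord (p : P2_type) : 'rV[C]_3 := val (repr p).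

Definition affine_row (i : 'I_3) (w : C * C) : 'rV[C]_3 :=
  \row_j match unlift i j with
         | None => 1
         | Some k => if k == 0 then w.1 else w.2
         end.

Lemma affine_row_neq0 i w : affine_row i w != 0.
Proof.
apply/eqP => /rowP /(_ i); rewrite !mxE unlift_none => /eqP.
by rewrite oner_eq0.
Qed.

Definition affine_vec i w : nzvec := Sub (affine_row i w) (affine_row_neq0 i w).

Definition affine_coord (i : 'I_3) (v : 'rV[C]_3) : C * C :=
  (v 0 (lift i 0) / v 0 i, v 0 (lift i 1) / v 0 i).

(* [P2_chart 0] is [1 : x : y] |-> (x, y). *)
Definition P2_chart (i : 'I_3) : chart (C * C)%type P2_type :=
  Chart [set p | hcoord p 0 i != 0] (fun p => affine_coord i (hcoord p))
        (fun w => P2_class (affine_vec i w)).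

Definition P2_atlas : set (chart (C * C)%type P2_type) := range P2_chart.

Lemma P2_classP v : exists2 k, k != 0 & hcoord (P2_class v) = k *: val v.
Proof.
rewrite /hcoord; set u := repr _.
have /eqmxP uv : collinear u v.
  by have /eqmodP : u = v %[mod P2_type]%qT by rewrite reprK.
have /sub_rVP[k uE] : (val u <= val v)%MS by rewrite uv.
exists k => //; apply: contraNneq (valP u) => k0.
by rewrite uE k0 scale0r.
Qed.

Lemma P2_chart_class i v :
  (hcoord (P2_class v) 0 i != 0) = (val v 0 i != 0) /\
  affine_coord i (hcoord (P2_class v)) = affine_coord i (val v).
Proof.
have [k k0 ->] := P2_classP v; split; first by rewrite mxE mulf_eq0 (negPf k0).
by rewrite /affine_coord !mxE; congr (_, _); rewrite -mulf_div divff // mul1r.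
Qed.

Lemma affine_coordK i w : affine_coord i (affine_row i w) = w.
Proof.
rewrite /affine_coord !mxE unlift_none !liftK /= !divr1.
by case: w.
Qed.

Lemma affine_rowK i (p : P2_type) : hcoord p 0 i != 0 ->
  P2_class (affine_vec i (affine_coord i (hcoord p))) = p.
Proof.
move=> pi0; rewrite -[RHS]reprK; apply/eqmodP => /=.
rewrite /collinear /=.
have -> : affine_row i (affine_coord i (hcoord p)) =
    (hcoord p 0 i)^-1 *: hcoord p.
  apply/rowP => j; rewrite !mxE; case: unliftP => [k ->|->]; last by rewrite mulVf.
  case: k => [[|[|//]] lk] /=; rewrite mulrC; congr (_ * hcoord p 0 (lift i _));
    exact/val_inj.
by apply/eqmxP; apply: eqmx_scale; rewrite invr_eq0.
Qed.

Lemma nzvec_coord_continuous j : continuous (fun v : nzvec => val v 0 j).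
Proof.
move=> v.
apply: (@continuous_comp _ _ _ (val : nzvec -> 'rV[C]_3) (fun u => u 0 j)).
  exact: (@initial_continuous _ _ (val : nzvec -> 'rV[C]_3)).
exact: coord_continuous.
Qed.

Lemma affine_coord_continuous i (v : nzvec) : val v 0 i != 0 ->
  {for v, continuous (fun u : nzvec => affine_coord i (val u))}.
Proof.
move=> vi0.
have h k : {for v, continuous (fun u : nzvec => val u 0 k / val u 0 i)}.
  apply: continuousM; first exact: nzvec_coord_continuous.
  by apply: continuousV => //; exact: nzvec_coord_continuous.
exact: (cvg_pair (h (lift i 0)) (h (lift i 1))).
Qed.

Lemma nzvec_open_coord i : open [set v : nzvec | val v 0 i != 0].
Proof.
have -> : [set v : nzvec | val v 0 i != 0] =
    (fun v : nzvec => val v 0 i) @^-1` (~` [set 0]).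
  by apply/seteqP; split => v /= /eqP.
apply: open_comp => [v _|]; first exact: nzvec_coord_continuous.
apply: closed_openC; apply: accessible_closed_set1; apply: hausdorff_accessible.
exact: norm_hausdorff.
Qed.

Lemma affine_row_coordE i j k :
  (fun w => affine_row i w j k) =
  fun w => match unlift i k with
           | None => 1 | Some l => if l == 0 then w.1 else w.2
           end.
Proof. by apply/funext => w; rewrite mxE. Qed.

Lemma affine_row_continuous i : continuous (affine_row i).
Proof.
move=> w U [P Pw PU]; rewrite /= nbhs_simpl.
have : \forall w' \near w, forall j k, P j k (affine_row i w' j k).
  apply: (@filter_forall _ _ (fun j w' => forall k, P j k (affine_row i w' j k))
    (nbhs w)) => j.
  apply: (@filter_forall _ _ (fun k w' => P j k (affine_row i w' j k))
    (nbhs w)) => k.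
  suff H : {for w, continuous (fun w' => affine_row i w' j k)}.
    exact: (H _ (Pw j k)).
  rewrite affine_row_coordE.
  have H (o : option 'I_2) : continuous (fun w : C * C => match o with
      | None => 1 | Some l => if l == 0 then w.1 else w.2 end : C).
    case: o => [l|] w'; last exact: cst_continuous.
    by case: (l == 0); [exact: cvg_fst | exact: cvg_snd].
  exact: H.
by apply: filterS => w'; exact: PU.
Qed.

Lemma affine_vec_continuous i : continuous (affine_vec i).
Proof. by apply: continuous_comp_initial; exact: affine_row_continuous. Qed.

Lemma P2_open_chart i (V : set (C * C)) : open V ->
  open ([set p | hcoord p 0 i != 0] `&`
        (fun p : P2_type => affine_coord i (hcoord p)) @^-1` V).
Proof.
move=> oV; rewrite /open /= /quotient_open.
have -> : \pi_P2_type @^-1` ([set p | hcoord p 0 i != 0] `&`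
      (fun p : P2_type => affine_coord i (hcoord p)) @^-1` V) =
    [set v : nzvec | val v 0 i != 0] `&`
      (fun v : nzvec => affine_coord i (val v)) @^-1` V.
  by apply/seteqP; split=> v /=; rewrite -/(P2_class v) (P2_chart_class _ _).1
    (P2_chart_class _ _).2.
rewrite openE => v [vi0 Vv]; rewrite /interior /=; apply: filterI.
  by apply: open_nbhs_nbhs; split=> //; exact: nzvec_open_coord.
apply: (affine_coord_continuous vi0).
exact: open_nbhs_nbhs.
Qed.

Lemma P2_atlas_chart c : P2_atlas c -> is_chart c.
Proof.
move=> [i _ <-]; split => /=.
- rewrite -[X in open X]setIT.
  exact: P2_open_chart openT.
- suff -> : [set affine_coord i (hcoord p) | p in [set p | hcoord p 0 i != 0]] =
      setT by exact: openT.
  apply/seteqP; split=> // w _; exists (P2_class (affine_vec i w)) => /=.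
    rewrite (P2_chart_class _ _).1 /= mxE unlift_none; exact: oner_neq0.
  by rewrite (P2_chart_class _ _).2 affine_coordK.
- by move=> p; exact: affine_rowK.
- move=> p pi0 U; rewrite nbhsE => -[V [oV Vp] VU].
  rewrite /= nbhs_simpl nbhsE.
  exists ([set q | hcoord q 0 i != 0] `&`
          (fun q => affine_coord i (hcoord q)) @^-1` V).
    by split=> //; exact: P2_open_chart.
  by move=> q [_ Vq]; exact: VU.
- move=> p pi0; apply: (@continuous_comp _ _ _ (affine_vec i) P2_class).
    exact: affine_vec_continuous.
  exact: pi_continuous.
Qed.

Lemma P2_atlas_cover (p : P2_type) : exists2 c, P2_atlas c & cdom c p.
Proof.
have /rV0Pn[i pi0] : hcoord p != 0 := valP (repr p).
by exists (P2_chart i) => //; exists i.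
Qed.

Lemma P2_atlas_transition c d (p : P2_type) : P2_atlas c -> P2_atlas d ->
  cdom c p -> cdom d p -> differentiable (cmap d \o cinv c) (cmap c p).
Proof.
move=> [i _ <-] [j _ <-] /= pi0 pj0.
have -> : (fun q => affine_coord j (hcoord q)) \o
    (fun w => P2_class (affine_vec i w)) =
    (fun w => affine_coord j (affine_row i w)).
  by apply/funext => w /=; rewrite (P2_chart_class _ _).2.
have row_diff k w : differentiable (fun w => affine_row i w 0 k) w.
  rewrite affine_row_coordE.
  case: (unlift i k) => [l|]; last exact: differentiable_cst.
  by case: (l == 0); [exact: differentiable_fst | exact: differentiable_snd].
have rowj0 : affine_row i (affine_coord i (hcoord p)) 0 j != 0.
  have := (P2_chart_class j (affine_vec i (affine_coord i (hcoord p)))).1.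
  by rewrite affine_rowK //= => <-.
apply: differentiable_pair; apply: differentiableM => //;
  exact: differentiableV.
Qed.

Definition P2 : complexSurface C :=
  ComplexManifold P2_atlas_chart P2_atlas_cover P2_atlas_transition.

End ProjectivePlane.

Section RationalMaps.
Variable K : fieldType.

(* The rational functions on the projective plane: the field K(x, y). *)
Definition ratfun := {fraction (mpoly.mpoly 2 K)}.

Definition rat_cst (c : K) : ratfun := FracField.tofrac (mpoly.mpolyC 2 c).

Definition aff_var (i : 'I_2) : mpoly.mpoly 2 K :=
  mpoly.mpolyX K (mpoly.mnm1 i).

Definition rat_x : ratfun := FracField.tofrac (aff_var 0).
Definition rat_y : ratfun := FracField.tofrac (aff_var 1).

(* [(u, v)] is the rational map (x, y) |-> (u(x, y), v(x, y)), that is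
   [1 : x : y] |-> [1 : u(x, y) : v(x, y)]. *)
Definition ratmap := (ratfun * ratfun)%type.

Definition subst_mpoly (f : ratmap) (p : mpoly.mpoly 2 K) : ratfun :=
  mpoly.mmap rat_cst (fun i => if i == 0 then f.1 else f.2) p.

(* The composition [phi \o f].  It is meaningful when the denominator of [phi]
   does not vanish identically on the image of [f], in particular for every
   [phi] when [f] is birational. *)
Definition ratfun_comp (phi : ratfun) (f : ratmap) : ratfun :=
  subst_mpoly f (\n_(repr phi)) / subst_mpoly f (\d_(repr phi)).

Definition ratmap_comp (g f : ratmap) : ratmap :=
  (ratfun_comp g.1 f, ratfun_comp g.2 f).

Definition ratmap_id : ratmap := (rat_x, rat_y).

Definition ratmap_iter (m : nat) (f : ratmap) : ratmap :=
  iter m (ratmap_comp f) ratmap_id.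

Definition dehomogenize (p : mpoly.mpoly 3 K) : mpoly.mpoly 2 K :=
  mpoly.comp_mpoly [tuple 1; aff_var 0; aff_var 1] p.

(* [f = [g 0 : g 1 : g 2]] in homogeneous coordinates, where the g i are
   homogeneous of the same degree d. *)
Definition homogeneous_form (f : ratmap) (d : nat)
    (g : 'I_3 -> mpoly.mpoly 3 K) : Prop :=
  [/\ forall i, g i \is mpoly.ishomog1 d mpoly.mdeg,
      dehomogenize (g 0) != 0,
      f.1 = FracField.tofrac (dehomogenize (g 1)) /
            FracField.tofrac (dehomogenize (g 0))
    & f.2 = FracField.tofrac (dehomogenize (g 2)) /
            FracField.tofrac (dehomogenize (g 0))].

Definition no_common_factor (g : 'I_3 -> mpoly.mpoly 3 K) : Prop :=
  forall h, (forall i, exists q, g i = h * q) ->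
    exists c, h = mpoly.mpolyC 3 c.

Definition has_degree (f : ratmap) (d : nat) : Prop :=
  exists2 g, homogeneous_form f d g & no_common_factor g.

Definition integrable (f : ratmap) : Prop :=
  exists2 phi : ratfun, (forall c, phi != rat_cst c) & ratfun_comp phi f = phi.

Definition jmap (F : {poly K}) : ratmap :=
  (- rat_x + (map_poly rat_cst F).[rat_y], rat_y).

Definition iota_map : ratmap :=
  (1 - rat_x - (rat_x - 1) / rat_y, - rat_y - 1 - rat_y / (rat_x - 1)).

Definition kmap (F : {poly K}) : ratmap := ratmap_comp (jmap F) iota_map.

End RationalMaps.

Section Dynamics.
Variable C : numClosedFieldType.

(* [f] is regular at the point [p], with value [q]. *)
Definition ratmap_value (f : ratmap C) (p q : P2 C) : Prop :=
  exists d g, homogeneous_form f d g /\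
    let w := \row_i mpoly.meval (fun j => hcoord p 0 j) (g i) in
    w != 0 /\ (hcoord q == w)%MS.

(* [Phi] is the map induced by [pi^-1 \o f \o pi]: the two agree wherever the
   latter is defined.  *)
Definition induced_map (Z : complexSurface C) (pi : bimeromorphic Z (P2 C))
    (f : ratmap C) (Phi : Z -> Z) : Prop :=
  forall z q, ~ bim_exc pi z -> ~ bim_cexc pi q ->
    ratmap_value f (bim_map pi z) q -> Phi z = bim_inv pi q.

Definition conjugate_to_automorphism (f : ratmap C) : Prop :=
  exists (Z : complexSurface C) (pi : bimeromorphic Z (P2 C)) (Phi : Z -> Z),
    [/\ compact_surface Z, biholomorphic Phi & induced_map pi f Phi].

End Dynamics.

Definition quadratic_degree_growth (R : realType) (f : ratmap R[i]) : Prop :=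
  exists deg : nat -> nat, (forall m, has_degree (ratmap_iter m f) (deg m)) /\
    exists c c' : R, [/\ 0 < c, c <= c' &
      \forall m \near \oo, c * m%:R ^+ 2 <= (deg m)%:R <= c' * m%:R ^+ 2].

(* Main.v *)
(* In the coordinates r = (x - 1) / y and y, the maps iota and j_F become
     iota (r, y) = (r, - y - 1 - 1 / r),    j (r, y) = (- r + a y (y + 1) + b, y).
   They preserve t = r^2 - b r - a (r y^2 + r y + y): on a curve t = const, iota
   exchanges the two points with the same r, and j the two points with the same y.
   Hence t is a nonconstant invariant of k_F.

   The surface is the elliptic fibration over the t-line obtained by compactifying
   the (r, y)-plane with a fibre of type E_7~ over t = oo and two sections.  It is
   glued from eight monomial-like charts and their images by j, and both involutions
   are holomorphic in these charts.

   Degrees: let (r_m, y_m) be the m-th iterate, restricted to a generic line x = const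
   or y = const, and h the degree of a rational function of one variable.  By Vieta,
   r_m + r_{m+1} and r_m r_{m+1} are polynomials of degree 2 in y_{m+1}, and
   symmetrically for y_m, y_{m+1} over r_m, so that, by the Gauss lemma,
     h(r_m) + h(r_{m+1}) <= 2 h(y_{m+1}) + 4,  h(y_m) + h(y_{m+1}) <= 2 h(r_m) + 4.
   The second differences are bounded, whence the quadratic upper bound.  On
   y = const there is no cancellation, and h(y_m) = m^2 exactly. *)

Require Import Defs.
From HB Require Import structures.
From mathcomp Require Import all_boot all_order all_algebra ring zify.
From mathcomp Require Import generic_quotient fraction complex realfun.
From mathcomp Require Import (canonicals, coercions) mpoly.
From mathcomp Require Import mathcomp_extra boolp classical_sets functions reals.
From mathcomp Require Import topology normedtype landau derive.
Import numFieldNormedType.Exports.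
Import Order.TTheory GRing.Theory Num.Theory.

Set Implicit Arguments.
Unset Strict Implicit.
Unset Printing Implicit Defensive.

Local Open Scope ring_scope.

(** * Rational maps as field embeddings, and the invariant *)

(** The degree of an iterate belongs to a polynomial triple without common factor, whereas heights
    live on a line. Gauss's lemma joins the two: with the constant of the line taken as an
    indeterminate s, a coprime triple stays coprime over K(s). A line controls only one partial
    degree, so the upper bound needs both pencils. For the lower bound y = const suffices: t is
    there a polynomial of degree 2 in x, and the orders of r and y at x = oo can be followed along
    the orbit. The surface is not built by successive blow-ups. Its points are listed as normal
    forms and carry the final topology of the charts, and one distinguished chart through each point
    reduces the comparison of any two charts to comparisons with that chart. As there is no ambient
    space to inherit separation from, points are separated by the values in P^1 of rational
    functions such as y, r and r / y^2. Between paired charts j is the identity, so it costs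
    nothing; iota preserves each of the two arms of the fibre, and on the arm whose charts are
    images by j it has to be computed as j iota j. *)

Section FracExt.
Variable A : idomainType.
Local Notation tofrac := (@FracField.tofrac A).

Lemma frac_mul_den (f : {fraction A}) :
  f * tofrac (\d_(repr f)) = tofrac (\n_(repr f)).
Proof.
rewrite -{1}[f]reprK !piE; apply/eqmodP => /=.
rewrite FracField.equivfE /FracField.mulf.
have d0 := denom_ratioP (repr f).
rewrite !(numden_Ratio, oner_neq0, mulf_neq0, mulr1, mul1r) //.
by rewrite mulrC.
Qed.

Lemma tofrac_den_neq0 (f : {fraction A}) : tofrac (\d_(repr f)) != 0.
Proof. by rewrite tofrac_eq0 denom_ratioP. Qed.

Lemma frac_numden (f : {fraction A}) :
  f = tofrac (\n_(repr f)) / tofrac (\d_(repr f)).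
Proof. by rewrite -frac_mul_den mulfK // tofrac_den_neq0. Qed.

Lemma fracP (f : {fraction A}) : exists p q, q != 0 /\ f = tofrac p / tofrac q.
Proof. by exists \n_(repr f), \d_(repr f); rewrite denom_ratioP -frac_numden. Qed.

Variables (L : fieldType) (h : {rmorphism A -> L}).
Hypothesis h_inj : forall p, h p = 0 -> p = 0.

(** The formula is the one of [ratfun_comp]: for a dominant rational map, composition with it is
    convertible to [fextR], hence is a field morphism. *)
Definition fext (f : {fraction A}) : L := h (\n_(repr f)) / h (\d_(repr f)).

Lemma h_neq0 p : p != 0 -> h p != 0.
Proof. by apply: contra_neq => /h_inj. Qed.

Lemma fext_div p q : q != 0 -> fext (tofrac p / tofrac q) = h p / h q.
Proof.
move=> q0; set f := _ / _; have fd := frac_mul_den f; rewrite /fext.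
set n := \n_ _ in fd *; set d := \d_ _ in fd *.
have d0 : d != 0 by exact: denom_ratioP.
have q0' : tofrac q != 0 by rewrite tofrac_eq0.
have E : p * d = n * q.
  apply/eqP; rewrite -tofrac_eq !tofracM -fd /f.
  by rewrite mulrAC divfK.
apply/eqP; rewrite eqr_div ?h_neq0 // -!rmorphM -E.
by rewrite mulrC.
Qed.

Lemma fext_tofrac p : fext (tofrac p) = h p.
Proof. by rewrite -[tofrac p]divr1 -tofrac1 fext_div ?oner_neq0 // rmorph1 divr1. Qed.

Lemma fext_is_zmod_morphism : zmod_morphism fext.
Proof.
move=> f g; have [p [q [q0 ->]]] := fracP f; have [p' [q' [q0' ->]]] := fracP g.
have t0 : tofrac q != 0 by rewrite tofrac_eq0.
have t0' : tofrac q' != 0 by rewrite tofrac_eq0.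
rewrite -mulNr addf_div // -rmorphN -!rmorphM -rmorphD.
rewrite !fext_div ?mulf_neq0 // rmorphD !rmorphM rmorphN /=.
by rewrite -[in RHS]mulNr addf_div ?h_neq0.
Qed.

Lemma fext_is_monoid_morphism : monoid_morphism fext.
Proof.
split; first by rewrite -tofrac1 fext_tofrac rmorph1.
move=> f g; have [p [q [q0 ->]]] := fracP f; have [p' [q' [q0' ->]]] := fracP g.
rewrite mulf_div -!tofracM !fext_div ?mulf_neq0 // !rmorphM /=.
by rewrite mulf_div.
Qed.

HB.instance Definition _ := GRing.isZmodMorphism.Build _ _ fext fext_is_zmod_morphism.
HB.instance Definition _ := GRing.isMonoidMorphism.Build _ _ fext fext_is_monoid_morphism.

Definition fextR : {rmorphism {fraction A} -> L} := fext.

End FracExt.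

Section Identities.
Variables (L : fieldType).
Implicit Types x y r : L.

Lemma iota_map1_sub1 x y : y != 0 ->
  1 - x - (x - 1) / y - 1 = - ((x - 1) * y + (x - 1) + y) / y.
Proof. by move=> y0; field. Qed.

Lemma iota_map2_frac x y : x - 1 != 0 ->
  - y - 1 - y / (x - 1) = - ((x - 1) * y + (x - 1) + y) / (x - 1).
Proof. by move=> x1; field. Qed.

(** With u = x - 1 and s = u y + u + y, iota is (u, y) |-> (- s / y, - s / u). The common
    denominator is u y; the last two equations express that iota is its own inverse, in the form
    that [dominant_inverse] asks for. *)
Lemma iota_map_involutive x y : x - 1 != 0 -> y != 0 -> let u := x - 1 in let s := u * y + u + y in
  let u' := - s / y in let y' := - s / u in
  [/\ (u' + 1) * (u * y) = u * y - u * s,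
      y' * (u * y) = - y * s,
      u' * y' - u' * (u' * y' + u' + y') = x * (u' * y') &
      - y' * (u' * y' + u' + y') = y * (u' * y')].
Proof. by move=> u0 y0 /=; split; field; rewrite ?u0 ?y0. Qed.

Lemma iota_map_ry x y : y != 0 -> x - 1 != 0 -> let r := (x - 1) / y in
  - y - 1 - y / (x - 1) = - y - 1 - r^-1 /\
  1 - x - (x - 1) / y = 1 + r * (- y - 1 - y / (x - 1)).
Proof. by move=> y0 x1 /=; split; field; rewrite ?y0 ?x1. Qed.

(** As F(0) = 2, the map j carries 1 + r y to an expression of the same shape, and becomes the
    reflection of r in the half of a y (y + 1) + b. *)
Lemma jmap_ry A B r y :
  - (1 + r * y) + (A * y ^+ 3 + A * y ^+ 2 + B * y + 2) =
  1 + (- r + (A * y * (y + 1) + B)) * y.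
Proof. by ring. Qed.

Lemma invariant_id A B t x y : y != 0 -> let r := (x - 1) / y in
  r ^+ 2 - B * r - A * (r * y ^+ 2 + r * y + y) = t ->
  (x - 1) ^+ 2 - B * (x - 1) * y -
    A * ((x - 1) * y ^+ 3 + (x - 1) * y ^+ 2 + y ^+ 3) - t * y ^+ 2 = 0.
Proof. by move=> y0 r <-; rewrite /r; field. Qed.

Lemma rmorph_jmap (L' : fieldType) (phi : {rmorphism L -> L'}) A B x y :
  phi (- x + (A * y ^+ 3 + A * y ^+ 2 + B * y + 2)) =
  - phi x + (phi A * phi y ^+ 3 + phi A * phi y ^+ 2 + phi B * phi y + 2).
Proof. by rewrite !(rmorphD, rmorphN, rmorphM, rmorphXn, rmorph_nat). Qed.

Definition yF r y : L := - y - 1 - r^-1.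
Definition rF A B r y : L := - r + (A * y * (y + 1) + B).
Definition tF A B r y : L := r ^+ 2 - B * r - A * (r * y ^+ 2 + r * y + y).

Lemma tF_step A B r y : r != 0 ->
  tF A B (rF A B r (yF r y)) (yF r y) = tF A B r y.
Proof. by move=> r0; rewrite /tF /rF /yF; field. Qed.

Fixpoint orbitF A B r y (m : nat) : L * L :=
  if m is m'.+1 then
    let: (r1, y1) := orbitF A B r y m' in
    let y2 := yF r1 y1 in (rF A B r1 y2, y2)
  else (r, y).

End Identities.

Section MorphIdentities.
Variables (L L' : fieldType) (phi : {rmorphism L -> L'}).

Lemma rmorph_rat_r x y : phi ((x - 1) / y) = (phi x - 1) / phi y.
Proof. by rewrite fmorph_div rmorphB rmorph1. Qed.

Lemma rmorph_kmap1 r y : phi (1 + r * y) = 1 + phi r * phi y.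
Proof. by rewrite rmorphD rmorphM rmorph1. Qed.

Lemma rmorph_yF r y : phi (yF r y) = yF (phi r) (phi y).
Proof. by rewrite /yF !(rmorphB, rmorphN, rmorph1) fmorphV. Qed.

Lemma rmorph_rF A B r y : phi (rF A B r y) = rF (phi A) (phi B) (phi r) (phi y).
Proof. by rewrite /rF !(rmorphD, rmorphM, rmorphN, rmorph1). Qed.

Lemma rmorph_tF A B r y : phi (tF A B r y) = tF (phi A) (phi B) (phi r) (phi y).
Proof. by rewrite /tF !(rmorphD, rmorphM, rmorphN, rmorphXn, rmorph1). Qed.

Lemma rmorph_orbitF A B r y m :
  phi (orbitF A B r y m).1 = (orbitF (phi A) (phi B) (phi r) (phi y) m).1 /\
  phi (orbitF A B r y m).2 = (orbitF (phi A) (phi B) (phi r) (phi y) m).2.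
Proof.
elim: m => //= m [].
case: (orbitF A B r y m) => r1 y1; case: (orbitF _ _ _ _ m) => r2 y2 /= <- <-.
by rewrite rmorph_rF rmorph_yF.
Qed.

End MorphIdentities.

Lemma rmorph_invariant (L L' : comNzRingType) (phi : {rmorphism L -> L'}) A B c x y :
  phi x = 2 -> phi y = 0 ->
  phi ((x - 1) ^+ 2 - B * (x - 1) * y -
    A * ((x - 1) * y ^+ 3 + (x - 1) * y ^+ 2 + y ^+ 3) - c * y ^+ 2) = 1.
Proof.
move=> hx hy; rewrite !(rmorphB, rmorphD, rmorphM, rmorphXn, rmorph1) hx hy.
by ring.
Qed.

Section Subst.
Variable K : fieldType.
Local Notation M := (mpoly.mpoly 2 K).
Local Notation F := (ratfun K).
Local Notation tofrac := (@FracField.tofrac M).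

Lemma rat_cst_is_zmod_morphism : zmod_morphism (@rat_cst K).
Proof. by move=> x y; rewrite /rat_cst !rmorphB. Qed.

Lemma rat_cst_is_monoid_morphism : monoid_morphism (@rat_cst K).
Proof. by split=> [|x y]; rewrite /rat_cst ?rmorph1 ?rmorphM. Qed.

HB.instance Definition _ := GRing.isZmodMorphism.Build K F (@rat_cst K) rat_cst_is_zmod_morphism.
HB.instance Definition _ := GRing.isMonoidMorphism.Build K F (@rat_cst K) rat_cst_is_monoid_morphism.

Lemma subst_is_zmod_morphism (f : ratmap K) : zmod_morphism (subst_mpoly f).
Proof. by move=> p q; rewrite /subst_mpoly rmorphB. Qed.

Lemma subst_is_monoid_morphism (f : ratmap K) : monoid_morphism (subst_mpoly f).
Proof. by split=> [|p q]; rewrite /subst_mpoly ?rmorph1 ?rmorphM. Qed.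

HB.instance Definition _ (f : ratmap K) := GRing.isZmodMorphism.Build M F
  (subst_mpoly f) (subst_is_zmod_morphism f).
HB.instance Definition _ (f : ratmap K) := GRing.isMonoidMorphism.Build M F
  (subst_mpoly f) (subst_is_monoid_morphism f).

Lemma substD (f : ratmap K) p q : subst_mpoly f (p + q) = subst_mpoly f p + subst_mpoly f q.
Proof. exact: (rmorphD (subst_mpoly f)). Qed.

Lemma substB (f : ratmap K) p q : subst_mpoly f (p - q) = subst_mpoly f p - subst_mpoly f q.
Proof. exact: (rmorphB (subst_mpoly f)). Qed.

Lemma substN (f : ratmap K) p : subst_mpoly f (- p) = - subst_mpoly f p.
Proof. exact: (rmorphN (subst_mpoly f)). Qed.

Lemma substM (f : ratmap K) p q : subst_mpoly f (p * q) = subst_mpoly f p * subst_mpoly f q.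
Proof. exact: (rmorphM (subst_mpoly f)). Qed.

Lemma substXn (f : ratmap K) p n : subst_mpoly f (p ^+ n) = subst_mpoly f p ^+ n.
Proof. exact: (rmorphXn (subst_mpoly f)). Qed.

Lemma subst1 (f : ratmap K) : subst_mpoly f 1 = 1.
Proof. exact: (rmorph1 (subst_mpoly f)). Qed.

Lemma subst0 (f : ratmap K) : subst_mpoly f 0 = 0.
Proof. exact: (rmorph0 (subst_mpoly f)). Qed.

Lemma subst_nat (f : ratmap K) n : subst_mpoly f n%:R = n%:R.
Proof. exact: (rmorph_nat (subst_mpoly f)). Qed.

Lemma subst_cst (f : ratmap K) c : subst_mpoly f (mpoly.mpolyC 2 c) = rat_cst c.
Proof. exact: mpoly.mmapC. Qed.

Lemma subst_x (f : ratmap K) : subst_mpoly f (aff_var K 0) = f.1.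
Proof. by rewrite /subst_mpoly /aff_var mpoly.mmapX mpoly.mmap1U. Qed.

Lemma subst_y (f : ratmap K) : subst_mpoly f (aff_var K 1) = f.2.
Proof. by rewrite /subst_mpoly /aff_var mpoly.mmapX mpoly.mmap1U. Qed.

(** Injectivity of the substitution means that the image is Zariski dense; no denominator then
    vanishes identically, and [ratfun_comp] respects composition. *)
Definition dominant (f : ratmap K) := forall p, subst_mpoly f p = 0 -> p = 0.

Lemma mpoly2_ind (P : M -> Prop) : (forall c, P (mpoly.mpolyC 2 c)) ->
  P (aff_var K 0) -> P (aff_var K 1) -> (forall p q, P p -> P q -> P (p + q)) ->
  (forall p q, P p -> P q -> P (p * q)) -> forall p, P p.
Proof.
move=> Pc P0 P1 PD PM p; rewrite (mpoly.mpolyE p).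
apply: (big_ind P); [by have := Pc 0; rewrite mpoly.mpolyC0|exact: PD|move=> m _].
rewrite -mpoly.mul_mpolyC; apply: (PM _ _) => //; rewrite mpoly.mpolyXE_id.
have P1' : P 1 by have := Pc 1; rewrite mpoly.mpolyC1.
apply: (big_ind P); [exact: P1'|exact: PM|move=> i _]; elim: (m i) => [|k ih]; first by rewrite expr0.
rewrite exprS; apply: (PM _ _) => //.
by case: i {ih} => [[|[|//]] li]; [have -> : Ordinal li = 0|have -> : Ordinal li = 1] => //; exact/val_inj.
Qed.

Lemma subst_comp (f g : ratmap K) (dg : dominant g) p :
  subst_mpoly (ratmap_comp f g) p = fextR dg (subst_mpoly f p).
Proof.
elim/mpoly2_ind: p => [c|||p q hp hq|p q hp hq].
- rewrite !subst_cst.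
  exact: (esym (etrans (fext_tofrac dg _) (subst_cst g c))).
- by rewrite !subst_x.
- by rewrite !subst_y.
- by rewrite !substD hp hq rmorphD.
- by rewrite !substM hp hq rmorphM.
Qed.

Lemma dominant_comp (f g : ratmap K) :
  dominant f -> dominant g -> dominant (ratmap_comp f g).
Proof.
move=> df dg p; rewrite (subst_comp f dg) => /eqP; rewrite fmorph_eq0 => /eqP.
exact: df.
Qed.

(* For every p, some D^N p(f) is a polynomial, and substituting f in it gives back
   p up to a power of D(f). *)
Lemma dominant_inverse (f : ratmap K) (D q0 q1 : M) : subst_mpoly f D != 0 ->
  f.1 * tofrac D = tofrac q0 -> f.2 * tofrac D = tofrac q1 ->
  subst_mpoly f q0 = rat_x K * subst_mpoly f D ->
  subst_mpoly f q1 = rat_y K * subst_mpoly f D -> dominant f.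
Proof.
move=> D0 f1 f2 s0 s1; set s := subst_mpoly f in D0 s0 s1 *.
have sD p q : s (p + q) = s p + s q := substD f p q.
have sM p q : s (p * q) = s p * s q := substM f p q.
have sX p n : s (p ^+ n) = s p ^+ n := substXn f p n.
suff H p : exists N q, s p * tofrac D ^+ N = tofrac q /\
    s q = tofrac p * s D ^+ N.
  move=> p p0; have [N [q [e1 e2]]] := H p.
  move: e1; rewrite [s p]p0 mul0r => /esym/eqP; rewrite tofrac_eq0 => /eqP q00.
  move: e2; rewrite q00 [s 0]subst0 => /esym/eqP; rewrite mulf_eq0 expf_eq0.
  by rewrite (negPf D0) andbF orbF tofrac_eq0 => /eqP.
elim/mpoly2_ind: p => [c|||p p' [N [q [e1 e2]]] [N' [q' [e1' e2']]]
  |p p' [N [q [e1 e2]]] [N' [q' [e1' e2']]]].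
- exists 0%N, (mpoly.mpolyC 2 c).
  by rewrite !expr0 !mulr1 /s !subst_cst.
- by exists 1%N, q0; rewrite !expr1 /s subst_x.
- by exists 1%N, q1; rewrite !expr1 /s subst_y.
- exists (N + N')%N, (q * D ^+ N' + q' * D ^+ N).
  rewrite !(sD, sM, sX) !(tofracD, tofracM, tofracXn) -e1 -e1' e2 e2' !exprD.
  by split; rewrite mulrDl; congr (_ + _); rewrite ?mulrA // [LHS]mulrAC ?mulrA.
- exists (N + N')%N, (q * q').
  by rewrite !sM !tofracM -e1 -e1' e2 e2' !exprD; split; exact: mulrACA.
Qed.

Lemma rat_x_neq_cst c : rat_x K - rat_cst c != 0.
Proof.
rewrite /rat_x /rat_cst -rmorphB tofrac_eq0 subr_eq0; apply/eqP => /(congr1 (mpoly.mcoeff (mpoly.mnm1 0))).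
rewrite mpoly.mcoeffX mpoly.mcoeffC eqxx mpoly.mnm1_eq0 mulr0 => /eqP.
by rewrite oner_eq0.
Qed.

Lemma rat_y_neq0 : rat_y K != 0.
Proof.
rewrite /rat_y tofrac_eq0; apply/eqP => /(congr1 (mpoly.mcoeff (mpoly.mnm1 1))).
by rewrite mpoly.mcoeffX eqxx mpoly.mcoeff0 => /eqP; rewrite oner_eq0.
Qed.

Local Notation X := (aff_var K 0).
Local Notation Y := (aff_var K 1).

Lemma iota_sum_neq0 : tofrac ((X - 1) * Y + (X - 1) + Y) != 0.
Proof.
rewrite tofrac_eq0; apply/eqP => h.
have := congr1 (mpoly.meval (fun i : 'I_2 => if i == 0 then 0 else 0)) h.
rewrite !(rmorphD, rmorphN, rmorphM, rmorph1) /= !mpoly.mevalXU /= rmorph0.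
by rewrite mulr0 add0r addr0 sub0r => /eqP; rewrite oppr_eq0 oner_eq0.
Qed.

Lemma dominant_iota : dominant (iota_map K).
Proof.
have x1 : rat_x K - 1 != 0 by have := rat_x_neq_cst 1; rewrite rmorph1.
have y0 := rat_y_neq0.
pose s : M := (X - 1) * Y + (X - 1) + Y.
have s0 := iota_sum_neq0.
have tx : tofrac X = rat_x K by []. have ty : tofrac Y = rat_y K by [].
have sE : tofrac s = (rat_x K - 1) * rat_y K + (rat_x K - 1) + rat_y K.
  by rewrite /s !(tofracD, tofracM, tofracN, tofrac1) tx ty.
rewrite -/s sE in s0.
have i1E : (iota_map K).1 - 1 = _ := iota_map1_sub1 _ y0.
have i2E : (iota_map K).2 = _ := iota_map2_frac _ x1.
have [d1 d2 d3 d4] := iota_map_involutive x1 y0.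
have sub1 : subst_mpoly (iota_map K) (X - 1) = (iota_map K).1 - 1.
  by rewrite substB subst1 subst_x.
have ts : subst_mpoly (iota_map K) s = ((iota_map K).1 - 1) * (iota_map K).2 +
    ((iota_map K).1 - 1) + (iota_map K).2.
  by rewrite /s (substD _ (_ + _)) (substD _ (_ * _)) substM sub1 subst_y.
have tX : tofrac (X - 1) = rat_x K - 1 by rewrite tofracB tofrac1.
apply: (@dominant_inverse _ ((X - 1) * Y) ((X - 1) * Y - (X - 1) * s) (- Y * s)).
- rewrite substM sub1 subst_y i1E i2E.
  have ns0 := s0; rewrite -oppr_eq0 in ns0.
  exact: (mulf_neq0 (mulf_neq0 ns0 (invr_neq0 y0)) (mulf_neq0 ns0 (invr_neq0 x1))).
- by rewrite tofracB !tofracM tX sE -d1 -i1E subrK.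
- by rewrite !tofracM tofracN tX sE -d2 -i2E.
- by rewrite substB !substM sub1 subst_y ts i1E i2E d3.
- by rewrite !substM substN sub1 subst_y ts i1E i2E d4.
Qed.

End Subst.

Section Cubic.
Variables (K : fieldType) (a b : K).
Local Notation M := (mpoly.mpoly 2 K).
Local Notation F := (ratfun K).
Local Notation tofrac := (@FracField.tofrac M).
Local Notation cst := (@rat_cst K).
Local Notation X := (aff_var K 0).
Local Notation Y := (aff_var K 1).
Local Notation mC := (mpoly.mpolyC 2).

Definition cubic : {poly K} := a *: 'X^3 + a *: 'X^2 + b *: 'X + 2%:P.

Lemma cubic_horner (L : comNzRingType) (h : {rmorphism K -> L}) y :
  (map_poly h cubic).[y] = h a * y ^+ 3 + h a * y ^+ 2 + h b * y + 2.
Proof.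
rewrite /cubic !rmorphD /= !map_polyZ /= !map_polyXn map_polyX map_polyC /=.
by rewrite !hornerE !rmorph1.
Qed.

Lemma jmap_cubic1 : (jmap cubic).1 =
  - rat_x K + (cst a * rat_y K ^+ 3 + cst a * rat_y K ^+ 2 + cst b * rat_y K + 2).
Proof. by rewrite /jmap /= cubic_horner. Qed.

Lemma dominant_jmap : dominant (jmap cubic).
Proof.
pose Fy : M := mC a * Y ^+ 3 + mC a * Y ^+ 2 + mC b * Y + 2.
have FyE : tofrac Fy =
    cst a * rat_y K ^+ 3 + cst a * rat_y K ^+ 2 + cst b * rat_y K + 2.
  by rewrite /Fy !(tofracD, tofracM, tofracXn, tofracMn, tofrac1).
(* The denominator is 1: j is polynomial and its own inverse. *)
apply: (@dominant_inverse _ _ 1 (- X + Fy) Y).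
- by rewrite subst1 oner_neq0.
- by rewrite tofrac1 mulr1 jmap_cubic1 tofracD tofracN FyE.
- by rewrite tofrac1 mulr1.
- rewrite subst1 mulr1 /Fy !(substD, substM, substXn, substN, subst_nat).
  by rewrite !subst_cst subst_x subst_y jmap_cubic1 /= opprD opprK subrK.
- by rewrite subst1 mulr1 subst_y.
Qed.

Lemma dominant_kmap : dominant (kmap cubic).
Proof. exact: (dominant_comp dominant_jmap (@dominant_iota K)). Qed.

Lemma fext_subst_cst (f : ratmap K) (df : dominant f) c : fextR df (cst c) = cst c.
Proof. exact: (etrans (fext_tofrac df _) (subst_cst f c)). Qed.

Lemma fext_subst_x (f : ratmap K) (df : dominant f) : fextR df (rat_x K) = f.1.
Proof. exact: (etrans (fext_tofrac df _) (subst_x f)). Qed.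

Lemma fext_subst_y (f : ratmap K) (df : dominant f) : fextR df (rat_y K) = f.2.
Proof. exact: (etrans (fext_tofrac df _) (subst_y f)). Qed.

Definition rat_r : F := (rat_x K - 1) / rat_y K.

Lemma rat_r_neq0 : rat_r != 0.
Proof.
rewrite mulf_neq0 ?invr_eq0 ?rat_y_neq0 //.
by have := rat_x_neq_cst (1 : K); rewrite rmorph1.
Qed.

Lemma iota_r : (iota_map K).2 = yF rat_r (rat_y K) /\
  (iota_map K).1 = 1 + rat_r * (iota_map K).2.
Proof.
have y0 := rat_y_neq0 K; have x1 : rat_x K - 1 != 0.
  by have := rat_x_neq_cst (1 : K); rewrite rmorph1.
exact: (iota_map_ry y0 x1).
Qed.

Lemma kmapE : (kmap cubic).2 = yF rat_r (rat_y K) /\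
  (kmap cubic).1 = 1 + rF (cst a) (cst b) rat_r (yF rat_r (rat_y K)) * yF rat_r (rat_y K).
Proof.
have [i2E i1E] := iota_r; have di := @dominant_iota K.
split.
  by rewrite [LHS](fext_subst_y di) i2E.
rewrite [LHS]/(fextR di (jmap cubic).1) jmap_cubic1.
apply: (etrans (rmorph_jmap (fextR di) (cst a) (cst b) (rat_x K) (rat_y K))).
rewrite !(fext_subst_cst di) (fext_subst_x di) (fext_subst_y di) i1E i2E.
exact: jmap_ry.
Qed.

Lemma iter_dominant m : dominant (ratmap_iter m (kmap cubic)).
Proof.
elim: m => [|m ih]; last exact: (dominant_comp dominant_kmap ih).
have H p : subst_mpoly (ratmap_id K) p = tofrac p.
  by move: p; apply: mpoly2_ind => [c|||p q hp hq|p q hp hq];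
    rewrite ?subst_cst ?subst_x ?subst_y ?substD ?substM ?tofracD ?tofracM ?hp ?hq.
by move=> p; rewrite H => /eqP; rewrite tofrac_eq0 => /eqP.
Qed.

(** The iterate m + 1 is [kmap] after the iterate m, so one step is the image of [kmapE] under the
    field morphism attached to the iterate m. If r or y vanished, the injective substitution would
    kill x - 1 or y. *)
Lemma ratmap_iterE m : let: (r, y) := orbitF (cst a) (cst b) rat_r (rat_y K) m in
  [/\ (ratmap_iter m (kmap cubic)).1 = 1 + r * y,
      (ratmap_iter m (kmap cubic)).2 = y, r != 0 & y != 0].
Proof.
elim: m => [|m] /=.
  split; [|by []|exact: rat_r_neq0|exact: rat_y_neq0].
  by rewrite /rat_r divfK ?rat_y_neq0 // addrC subrK.
case: (orbitF _ _ _ _ m) => r y [e1 e2 r0 y0].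
set g := ratmap_iter m _ in e1 e2.
have dg : dominant g := @iter_dominant m.
have [k2 k1] := kmapE.
have rg : fextR dg rat_r = r.
  apply: (etrans (rmorph_rat_r (fextR dg) (rat_x K) (rat_y K))).
  rewrite (fext_subst_x dg) (fext_subst_y dg) e1 e2.
  by rewrite addrC addKr mulfK.
have yg : fextR dg (yF rat_r (rat_y K)) = yF r y.
  apply: (etrans (rmorph_yF (fextR dg) _ _)).
  by rewrite (fext_subst_y dg) e2 rg.
have E2 : (ratmap_iter m.+1 (kmap cubic)).2 = yF r y by rewrite -yg -k2.
have E1 : (ratmap_iter m.+1 (kmap cubic)).1 = 1 + rF (cst a) (cst b) r (yF r y) * yF r y.
  rewrite -[LHS]/(fextR dg (kmap cubic).1) k1.
  apply: (etrans (rmorph_kmap1 (fextR dg) _ _)).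
  by rewrite yg; congr (1 + _ * _); apply: (etrans (rmorph_rF (fextR dg) _ _ _ _));
    rewrite !(fext_subst_cst dg) yg rg.
have dk := @iter_dominant m.+1.
split; [exact: E1|exact: E2| |].
  apply/eqP => r'0.
  have := dk (X - 1); rewrite substB subst1 subst_x E1 r'0 mul0r addr0 subrr.
  move=> /(_ erefl) /(congr1 tofrac); rewrite tofracB tofrac1 tofrac0 => /eqP.
  by have /negPf := rat_x_neq_cst (1 : K); rewrite rmorph1 => ->.
apply/eqP => y'0; have := dk Y; rewrite subst_y E2 y'0 => /(_ erefl).
by move/(congr1 tofrac); rewrite tofrac0 => /eqP; rewrite (negPf (rat_y_neq0 K)).
Qed.

Lemma kmap_integrable : integrable (kmap cubic).
Proof.
exists (tF (cst a) (cst b) rat_r (rat_y K)).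
  move=> c; apply/eqP => h.
  have y0 := rat_y_neq0 K.
  (* P is y^2 (t - c), which would vanish if t were the constant c; its value at (x, y) = (2, 0) is
     1. *)
  pose P : M := (X - 1) ^+ 2 - mC b * (X - 1) * Y -
    mC a * ((X - 1) * Y ^+ 3 + (X - 1) * Y ^+ 2 + Y ^+ 3) - mC c * Y ^+ 2.
  have : tofrac P = 0.
    rewrite /P !(tofracD, tofracM, tofracXn, tofracN, tofrac1).
    exact: (invariant_id y0 h).
  move/eqP; rewrite tofrac_eq0 => /eqP.
  move/(congr1 (mpoly.meval (fun i : 'I_2 => if i == 0 then 2 else 0))).
  have -> := @rmorph_invariant M K (mpoly.meval (fun i : 'I_2 => if i == 0 then 2 else 0))
    (mC a) (mC b) (mC c) X Y (mpoly.mevalXU _ _) (mpoly.mevalXU _ _).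
  by rewrite rmorph0 => /eqP; rewrite oner_eq0.
have dk := dominant_kmap; have [k2 k1] := kmapE.
have y0 : (kmap cubic).2 != 0.
  apply/eqP => y'0; have := dk Y; rewrite subst_y y'0 => /(_ erefl).
  by move/(congr1 tofrac); rewrite tofrac0 => /eqP; rewrite (negPf (rat_y_neq0 K)).
have rk : fextR dk rat_r = rF (cst a) (cst b) rat_r (yF rat_r (rat_y K)).
  apply: (etrans (rmorph_rat_r (fextR dk) (rat_x K) (rat_y K))).
  rewrite (fext_subst_x dk) (fext_subst_y dk).
  by rewrite k1 -/rat_r -k2 addrC addKr mulfK.
have yk : fextR dk (rat_y K) = yF rat_r (rat_y K) by rewrite (fext_subst_y dk).
apply: (etrans (rmorph_tF (fextR dk) (cst a) (cst b) rat_r (rat_y K))).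
rewrite !(fext_subst_cst dk) rk yk.
exact: (tF_step _ _ _ rat_r_neq0).
Qed.

End Cubic.

(** * Heights and Vieta relations *)

Section PolyVieta.
Variable K : fieldType.
Implicit Types A B C D U V W P Q : {poly K}.

Lemma dvdp_mul_coprime D U P Q : coprimep P Q ->
  D %| U * P -> D %| U * Q -> D %| U.
Proof.
move=> /Bezout_eq1_coprimepP[[u v] /= uv] dP dQ.
have -> : U = u * (U * P) + v * (U * Q) by rewrite -{1}[U]mulr1 -uv; ring.
exact: dvdp_add (dvdp_mull _ dP) (dvdp_mull _ dQ).
Qed.

(* [U] is divisible by [B * B'], because [B * B'], [A * B' + A' * B] and [A * A']
   generate the unit ideal. *)
Lemma vieta A B A' B' U V W : coprimep A B -> coprimep A' B' ->
  B != 0 -> B' != 0 ->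
  U * (A * B' + A' * B) = V * (B * B') -> U * (A * A') = W * (B * B') ->
  exists c, [/\ U = c * (B * B'), V = c * (A * B' + A' * B) & W = c * (A * A')].
Proof.
move=> cAB cAB' B0 B'0 eS eP; set D := B * B'; set S := A * B' + A' * B.
have D0 : D != 0 by rewrite mulf_neq0.
have dS : D %| U * S by rewrite /S eS dvdp_mull.
have dP : D %| U * (A * A') by rewrite eP dvdp_mull.
have dD : D %| U * D by rewrite dvdp_mull.
have cB2 : coprimep A' (B' ^+ 2) by rewrite coprimep_expr.
have cB2' : coprimep A (B ^+ 2) by rewrite coprimep_expr.
have cA2' : coprimep B (A ^+ 2) by rewrite coprimep_expr // coprimep_sym.
(* D divides both U A A' and U A B'^2, and A' is prime to B'^2. *)
have dA : D %| U * A.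
  apply: (dvdp_mul_coprime cB2); first by rewrite -mulrA.
  have -> : U * A * B' ^+ 2 = B' * (U * S) - A' * (U * D) by rewrite /S /D; ring.
  apply: dvdp_sub; exact: dvdp_mull.
have dB : D %| U * B.
  apply: (@dvdp_mul_coprime _ _ B' (A' ^+ 2)); first by rewrite coprimep_expr // coprimep_sym.
    by rewrite -mulrA.
  have -> : U * B * A' ^+ 2 = A' * (U * S) - B' * (U * (A * A')) by rewrite /S; ring.
  apply: dvdp_sub; exact: dvdp_mull.
have /dvdpP[c Uc] := dvdp_mul_coprime cAB dA dB.
exists c; split; rewrite -?/D -?/S ?Uc //; apply: (mulIf D0).
  by rewrite -eS Uc mulrAC.
by rewrite -eP Uc mulrAC.
Qed.

(** Sizes exceed degrees by one: for coprime [A] and [B] this is the height max(deg A, deg B) of the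
    rational function A / B. *)
Definition ht A B := (maxn (size A) (size B)).-1.

Lemma htP A B : B != 0 -> maxn (size A) (size B) = (ht A B).+1.
Proof. by rewrite -size_poly_gt0 => B0; rewrite prednK // leq_max B0 orbT. Qed.

Lemma ht_size A B : B != 0 -> (size A <= (ht A B).+1)%N /\ (size B <= (ht A B).+1)%N.
Proof. by move=> /(htP A) <-; rewrite leq_maxl leq_maxr. Qed.

Lemma ht_size_eq A B : B != 0 -> size A = (ht A B).+1 \/ size B = (ht A B).+1.
Proof. by move=> /(htP A) <-; case: (leqP (size A) (size B)) => _; [right|left]. Qed.

Lemma size_mul_le_pred n n' A B : (size A <= n.+1)%N -> (size B <= n'.+1)%N ->
  ((size A <= n) || (size B <= n'))%N -> (size (A * B)%R <= n + n')%N.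
Proof.
case: (eqVneq A 0) => [->|A0]; first by rewrite mul0r size_poly0.
case: (eqVneq B 0) => [->|B0]; first by rewrite mulr0 size_poly0.
rewrite size_mul // => sA sB.
move: A0 B0; rewrite -!size_poly_gt0 => A0 B0 h.
move: (size A) (size B) A0 B0 h sA sB => u v; lia.
Qed.
Lemma size_mul_eq n n' A B : size A = n.+1 -> size B = n'.+1 ->
  size (A * B) = (n + n').+1.
Proof.
move=> sA sB; rewrite size_mul ?sA ?sB ?addSn ?addnS //.
  by rewrite -size_poly_gt0 sA.
by rewrite -size_poly_gt0 sB.
Qed.

(* The Gauss lemma for the place at infinity. *)
Lemma ht_add A B A' B' : B != 0 -> B' != 0 ->
  let n := (ht A B + ht A' B').+1 in
  [\/ size (B * B') = n, size (A * B' + A' * B) = n | size (A * A') = n].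
Proof.
move=> B0 B'0 n; have [lA lB] := ht_size A B0; have [lA' lB'] := ht_size A' B'0.
have [eA|eA] := eqVneq (size A) (ht A B).+1; have [eA'|eA'] := eqVneq (size A') (ht A' B').+1.
- by constructor 3; exact: size_mul_eq.
- have eB' : size B' = (ht A' B').+1 by case: (ht_size_eq A' B'0) => // e; rewrite e eqxx in eA'.
  case: (eqVneq (size B) (ht A B).+1) => eB; first by constructor 1; exact: size_mul_eq.
  constructor 2; rewrite size_polyDl (size_mul_eq eA eB') // ltnS.
  have lt : (size B <= ht A B)%N by rewrite -ltnS ltn_neqAle eB lB.
  by rewrite mulrC; apply: size_mul_le_pred => //; rewrite lt.
- have eB : size B = (ht A B).+1 by case: (ht_size_eq A B0) => // e; rewrite e eqxx in eA.
  case: (eqVneq (size B') (ht A' B').+1) => eB'; first by constructor 1; exact: size_mul_eq.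
  constructor 2; rewrite addrC [A' * B]mulrC size_polyDl (size_mul_eq eB eA') // ltnS.
  have lt : (size B' <= ht A' B')%N by rewrite -ltnS ltn_neqAle eB' lB'.
  by apply: size_mul_le_pred => //; rewrite lt orbT.
have eB : size B = (ht A B).+1 by case: (ht_size_eq A B0) => // e; rewrite e eqxx in eA.
have eB' : size B' = (ht A' B').+1 by case: (ht_size_eq A' B'0) => // e; rewrite e eqxx in eA'.
by constructor 1; exact: size_mul_eq.
Qed.

(** The cofactor c of [vieta] can only enlarge U, V and W, and by [ht_add] one of the three products
    that it multiplies already has degree equal to the sum of the heights. *)
Lemma vieta_le A B A' B' U V W n : coprimep A B -> coprimep A' B' ->
  B != 0 -> B' != 0 -> U != 0 ->
  U * (A * B' + A' * B) = V * (B * B') -> U * (A * A') = W * (B * B') ->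
  (size U <= n.+1)%N -> (size V <= n.+1)%N -> (size W <= n.+1)%N ->
  (ht A B + ht A' B' <= n)%N.
Proof.
move=> cAB cAB' B0 B'0 U0 eS eP sU sV sW.
have [c [Uc Vc Wc]] := vieta cAB cAB' B0 B'0 eS eP.
have c0 : c != 0 by apply: contraNneq U0 => c0; rewrite Uc c0 mul0r.
have le (E : {poly K}) : E != 0 -> (size E <= size (c * E)%R)%N.
  by move=> E0; rewrite size_mul // -(prednK (_ : 0 < size c)%N) ?size_poly_gt0 // addSn leq_addl.
have key (E : {poly K}) : size E = (ht A B + ht A' B').+1 -> (size (c * E)%R <= n.+1)%N ->
    (ht A B + ht A' B' <= n)%N.
  move=> sE h; rewrite -ltnS -sE; apply: leq_trans (le _ _) h.
  by rewrite -size_poly_gt0 sE.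
by case: (ht_add A A' B0 B'0) => /key; apply; rewrite -?Uc -?Vc -?Wc.
Qed.

(** Since U, V and W have no common divisor, the cofactor of [vieta] is a nonzero constant and no
    degree is lost. *)
Lemma vieta_eq A B A' B' U V W n : coprimep A B -> coprimep A' B' ->
  B != 0 -> B' != 0 -> U != 0 ->
  U * (A * B' + A' * B) = V * (B * B') -> U * (A * A') = W * (B * B') ->
  (forall c, c %| U -> c %| V -> c %| W -> size c = 1%N) ->
  maxn (size U) (maxn (size V) (size W)) = n.+1 ->
  (ht A B + ht A' B' = n)%N.
Proof.
move=> cAB cAB' B0 B'0 U0 eS eP g1 sUVW.
have le : (ht A B + ht A' B' <= n)%N.
  by apply: (vieta_le cAB cAB' B0 B'0 U0 eS eP);
    rewrite -sUVW !leq_max leqnn ?orbT.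
have [c [Uc Vc Wc]] := vieta cAB cAB' B0 B'0 eS eP.
have sc : size c = 1%N by apply: g1; rewrite ?Uc ?Vc ?Wc dvdp_mulr.
apply/eqP; rewrite eqn_leq le /=.
have [lA lB] := ht_size A B0; have [lA' lB'] := ht_size A' B'0.
have key (E F : {poly K}) : (size E <= (ht A B).+1)%N -> (size F <= (ht A' B').+1)%N ->
    (size (E * F)%R <= (ht A B + ht A' B').+1)%N.
  move=> h1 h2; apply: (leq_trans (size_polyMleq _ _)).
  move: (size E) (size F) (ht A B) (ht A' B') h1 h2 => *; lia.
have key1 (E : {poly K}) : (size E <= (ht A B + ht A' B').+1)%N ->
    (size (c * E)%R <= (ht A B + ht A' B').+1)%N.
  by move=> h; apply: (leq_trans (size_polyMleq _ _)); rewrite sc add1n.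
rewrite -ltnS -sUVW !geq_max Uc Vc Wc !key1 ?key //.
by apply: (leq_trans (size_polyD _ _)); rewrite geq_max key // mulrC key.
Qed.

End PolyVieta.

Section CrossIdentities.
Variable L : fieldType.
Implicit Types A B C D P Q a b r y : L.

Lemma vieta_r_sum a b r y : r + rF a b r y = a * y * (y + 1) + b.
Proof. by rewrite /rF; ring. Qed.

Lemma vieta_r_mul a b r y : r * rF a b r y = - (a * y) - tF a b r y.
Proof. by rewrite /rF /tF; ring. Qed.

Lemma vieta_y_sum r y : y + yF r y = - 1 - r^-1.
Proof. by rewrite /yF; ring. Qed.

Lemma vieta_y_mul a b r y : a != 0 -> r != 0 ->
  y * yF r y = (tF a b r y - r ^+ 2 + b * r) / (a * r).
Proof. by move=> a0 r0; rewrite /yF /tF; field; rewrite a0 r0. Qed.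

Lemma tF_yF a b r y : r != 0 -> tF a b r (yF r y) = tF a b r y.
Proof. by move=> r0; rewrite /yF /tF; field. Qed.

(** Vieta cleared of denominators: A / B and A' / B' are the two values of r over y = C / D, and P /
    Q is t. *)
Lemma cross_r A B A' B' C D P Q a b : B != 0 -> B' != 0 -> D != 0 -> Q != 0 ->
  A / B + A' / B' = a * (C / D) * (C / D + 1) + b ->
  A / B * (A' / B') = - (a * (C / D)) - P / Q ->
  (Q * D ^+ 2) * (A * B' + A' * B) =
    (Q * (a * C ^+ 2 + a * C * D + b * D ^+ 2)) * (B * B') /\
  (Q * D ^+ 2) * (A * A') = (- (Q * a * C * D) - P * D ^+ 2) * (B * B').
Proof.
move=> B0 B'0 D0 Q0 eS eP; split.
  have -> : A * B' + A' * B = (A / B + A' / B') * (B * B') by field; rewrite B0 B'0.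
  by rewrite eS; field.
have -> : A * A' = A / B * (A' / B') * (B * B') by field; rewrite B0 B'0.
by rewrite eP; field; rewrite D0 Q0.
Qed.

Lemma cross_y A B C D C' D' P Q a b : a != 0 -> A != 0 -> B != 0 -> D != 0 ->
  D' != 0 -> Q != 0 ->
  C / D + C' / D' = - 1 - (A / B)^-1 ->
  C / D * (C' / D') = (P / Q - (A / B) ^+ 2 + b * (A / B)) / (a * (A / B)) ->
  (Q * a * A * B) * (C * D' + C' * D) = (- (Q * a * (A + B) * B)) * (D * D') /\
  (Q * a * A * B) * (C * C') =
    (P * B ^+ 2 - Q * A ^+ 2 + Q * b * A * B) * (D * D').
Proof.
move=> a0 A0 B0 D0 D'0 Q0 eS eP; split.
  have -> : C * D' + C' * D = (C / D + C' / D') * (D * D') by field; rewrite D0 D'0.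
  by rewrite eS; field; rewrite A0 B0.
have -> : C * C' = C / D * (C' / D') * (D * D') by field; rewrite D0 D'0.
by rewrite eP; field; rewrite a0 A0 B0 Q0.
Qed.

Lemma orbitFS a b r y m : orbitF a b r y m.+1 =
  (rF a b (orbitF a b r y m).1 (yF (orbitF a b r y m).1 (orbitF a b r y m).2),
   yF (orbitF a b r y m).1 (orbitF a b r y m).2).
Proof. by rewrite /=; case: (orbitF _ _ _ _ m). Qed.

Lemma tF_orbit a b r y m : (forall k, (orbitF a b r y k).1 != 0) ->
  tF a b (orbitF a b r y m).1 (orbitF a b r y m).2 = tF a b r y.
Proof. by move=> r0; elim: m => // m ih; rewrite orbitFS /= tF_step. Qed.

End CrossIdentities.

Section SizeBounds.
Variable R : idomainType.
Implicit Types p q : {poly R}.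

Lemma size_le_mul p q m n k : (size p <= m.+1)%N -> (size q <= n.+1)%N -> (m + n <= k)%N ->
  (size (p * q)%R <= k.+1)%N.
Proof.
move=> h1 h2 h3; apply: (leq_trans (size_polyMleq _ _)).
by move: (size p) (size q) h1 h2 => *; lia.
Qed.

Lemma size_le_add p q k : (size p <= k)%N -> (size q <= k)%N -> (size (p + q)%R <= k)%N.
Proof. by move=> h1 h2; apply: (leq_trans (size_polyD _ _)); rewrite geq_max h1. Qed.

Lemma size_le_opp p k : (size p <= k)%N -> (size (- p)%R <= k)%N.
Proof. by rewrite size_polyN. Qed.

Lemma size_le_const (c : R) k : (size (c%:P) <= k.+1)%N.
Proof. exact: leq_trans (size_polyC_leq1 _) _. Qed.

Lemma size_le_sqr p n k : (size p <= n.+1)%N -> (n + n <= k)%N -> (size (p ^+ 2)%R <= k.+1)%N.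
Proof. by move=> h; rewrite expr2; apply: size_le_mul. Qed.

End SizeBounds.

Section Orbits.
Variable K : fieldType.
Local Notation L := {fraction {poly K}}.
Local Notation tf := (@FracField.tofrac {poly K}).
Implicit Types A B C D P Q : {poly K}.

Definition rep (f : L) A B : Prop := [/\ coprimep A B, B != 0 & f = tf A / tf B].

Lemma rep_exists f : exists A B, rep f A B.
Proof.
have [p [q [q0 ->]]] := fracP f.
have g0 : gcdp p q != 0 by rewrite gcdp_eq0 negb_and q0 orbT.
have dp := dvdp_gcdl p q; have dq := dvdp_gcdr p q.
have q1 : q %/ gcdp p q != 0 by rewrite dvdp_div_eq0.
exists (p %/ gcdp p q), (q %/ gcdp p q); split=> //.
  by rewrite coprimep_div_gcd // q0 orbT.
apply/eqP; rewrite eqr_div ?tofrac_eq0 // -!tofracM tofrac_eq; apply/eqP.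
transitivity (p %/ gcdp p q * gcdp p q * (q %/ gcdp p q)); first by rewrite divpK.
by rewrite -mulrA [_ * (q %/ _)]mulrC divpK.
Qed.

Lemma rep_neq0 f A B : rep f A B -> f != 0 -> A != 0.
Proof. by case=> _ _ ->; apply: contraNneq => ->; rewrite tofrac0 mul0r. Qed.

Variables (al be : K) (al0 : al != 0).
Local Notation a := (tf al%:P).
Local Notation b := (tf be%:P).

Lemma rep_cross_r r y A B A' B' C D P Q : rep r A B ->
  rep (rF a b r y) A' B' -> rep y C D -> Q != 0 -> tF a b r y = tf P / tf Q ->
  (Q * D ^+ 2) * (A * B' + A' * B) =
    (Q * (al%:P * C ^+ 2 + al%:P * C * D + be%:P * D ^+ 2)) * (B * B') /\
  (Q * D ^+ 2) * (A * A') = (- (Q * al%:P * C * D) - P * D ^+ 2) * (B * B').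
Proof.
move=> [_ B0 rE] [_ B'0 r'E] [_ D0 yE] Q0 tE.
have := vieta_r_sum a b r y; have := vieta_r_mul a b r y.
rewrite tE r'E rE yE => eP eS.
have t0 (E : {poly K}) : E != 0 -> tf E != 0 by rewrite tofrac_eq0.
have [h1 h2] := cross_r (t0 _ B0) (t0 _ B'0) (t0 _ D0) (t0 _ Q0) eS eP.
split; apply/eqP; rewrite -tofrac_eq;
  rewrite !(tofracM, tofracD, tofracN, tofracXn); exact/eqP.
Qed.

Lemma rep_cross_y r y A B C' D' C D P Q : r != 0 -> rep r A B ->
  rep (yF r y) C' D' -> rep y C D -> Q != 0 -> tF a b r y = tf P / tf Q ->
  (Q * al%:P * A * B) * (C * D' + C' * D) =
    (- (Q * al%:P * (A + B) * B)) * (D * D') /\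
  (Q * al%:P * A * B) * (C * C') =
    (P * B ^+ 2 - Q * A ^+ 2 + Q * be%:P * A * B) * (D * D').
Proof.
move=> r0 rr ry' ry Q0 tE; have A0 := rep_neq0 rr r0.
case: rr ry' ry => [_ B0 rE] [_ D'0 y'E] [_ D0 yE].
have a0 : a != 0 by rewrite tofrac_eq0 polyC_eq0.
have := vieta_y_sum r y; have := vieta_y_mul b y a0 r0.
rewrite tE y'E rE yE => eP eS.
have t0 (E : {poly K}) : E != 0 -> tf E != 0 by rewrite tofrac_eq0.
have [h1 h2] := cross_y a0 (t0 _ A0) (t0 _ B0) (t0 _ D0) (t0 _ D'0) (t0 _ Q0) eS eP.
split; apply/eqP; rewrite -tofrac_eq;
  rewrite !(tofracM, tofracD, tofracN, tofracXn); exact/eqP.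
Qed.

(** The 4 bounds the degrees of the numerator and of the denominator of t on the base line, whence
    the sizes 5. It is dictated by x = const, where t has denominator y^2 and a numerator of degree
    at most 4. *)
Lemma ht_step_r r y A B A' B' C D P Q : rep r A B ->
  rep (rF a b r y) A' B' -> rep y C D -> Q != 0 -> tF a b r y = tf P / tf Q ->
  (size P <= 5)%N -> (size Q <= 5)%N ->
  (ht A B + ht A' B' <= ht C D + ht C D + 4)%N.
Proof.
move=> rr rr' ry Q0 tE sP sQ; have [h1 h2] := rep_cross_r rr rr' ry Q0 tE.
case: rr rr' ry => [cAB B0 _] [cAB' B'0 _] [_ D0 _].
have [sC sD] := ht_size C D0; set n := ht C D in sC sD *.
have sD2 : (size (D ^+ 2)%R <= (n + n).+1)%N by exact: size_le_sqr sD _.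
have sC2 : (size (C ^+ 2)%R <= (n + n).+1)%N by exact: size_le_sqr sC _.
have sCD c : (size (c%:P * C * D)%R <= (n + n).+1)%N.
  by apply: (size_le_mul (size_le_mul (size_le_const c 0) sC (leqnn _)) sD).
apply: (vieta_le cAB cAB' B0 B'0 _ h1 h2); first by rewrite mulf_neq0 ?expf_neq0.
- by apply: (size_le_mul sQ sD2); lia.
- apply: (size_le_mul sQ (n := n + n)); last by lia.
  apply: size_le_add; first apply: size_le_add => //.
    by apply: (size_le_mul (size_le_const al 0) sC2); lia.
  by apply: (size_le_mul (size_le_const be 0) sD2); lia.
- apply: size_le_add; apply: size_le_opp; last by apply: (size_le_mul sP sD2); lia.
  by rewrite -!mulrA [al%:P * _]mulrA; apply: (size_le_mul sQ (sCD al)); lia.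
Qed.

Lemma ht_step_y r y A B C' D' C D P Q : r != 0 -> rep r A B ->
  rep (yF r y) C' D' -> rep y C D -> Q != 0 -> tF a b r y = tf P / tf Q ->
  (size P <= 5)%N -> (size Q <= 5)%N ->
  (ht C D + ht C' D' <= ht A B + ht A B + 4)%N.
Proof.
move=> r0 rr ry' ry Q0 tE sP sQ; have [h1 h2] := rep_cross_y r0 rr ry' ry Q0 tE.
have A0 := rep_neq0 rr r0.
case: rr ry' ry => [_ B0 _] [cCD' D'0 _] [cCD D0 _].
have [sA sB] := ht_size A B0; set n := ht A B in sA sB *.
have sB2 : (size (B ^+ 2)%R <= (n + n).+1)%N by exact: size_le_sqr sB _.
have sA2 : (size (A ^+ 2)%R <= (n + n).+1)%N by exact: size_le_sqr sA _.
have sQc c : (size (Q * c%:P)%R <= 5)%N by exact: size_le_mul sQ (size_le_const c 0) _.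
have sE c (E : {poly K}) : (size E <= n.+1)%N -> (size (Q * c%:P * E * B)%R <= (n + n + 4).+1)%N.
  by move=> h; apply: (size_le_mul (size_le_mul (sQc c) h (leqnn _)) sB); lia.
apply: (vieta_le cCD cCD' D0 D'0 _ h1 h2).
- by rewrite !mulf_neq0 // polyC_eq0.
- exact: sE.
- by apply: size_le_opp; apply: sE; apply: size_le_add.
- apply: size_le_add; last exact: sE.
  by apply: size_le_add; [apply: (size_le_mul sP sB2)|apply: size_le_opp; apply: (size_le_mul sQ sA2)]; lia.
Qed.

Lemma orbit_ht r0 y0 A B C D P Q :
  let o := orbitF a b r0 y0 in (forall m, (o m).1 != 0) ->
  rep r0 A B -> rep y0 C D -> (ht A B <= 1)%N -> (ht C D <= 1)%N ->
  tF a b r0 y0 = tf P / tf Q -> Q != 0 -> (size P <= 5)%N -> (size Q <= 5)%N ->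
  forall m, exists A B C D, [/\ rep (o m).1 A B, rep (o m).2 C D &
    (ht A B + ht C D <= 2 + 4 * (2 * m + 1) ^ 2)%N].
Proof.
move=> o on0 rr ry hAB hCD tE Q0 sP sQ m.
(* Each half step raises the difference of consecutive heights by at most 4, so the bound 4 (2 m +
   1) on h(r_m) - h(y_m) grows by 8 per step. Two consecutive differences add up to 16 m + 12, the
   increment of 4 m (2 m + 1). *)
suff [A' [B' [C' [D' [h1 h2 h3 h4]]]]] : exists A B C D, [/\ rep (o m).1 A B, rep (o m).2 C D,
    (ht A B <= ht C D + (2 * m + 1) * 4)%N & (ht C D <= 1 + 4 * m * (2 * m + 1))%N].
  exists A', B', C', D'; split=> //.
  by move: (ht A' B') (ht C' D') h3 h4 => *; nia.
elim: m => [|m [A1 [B1 [C1 [D1 [h1 h2 h3 h4]]]]]].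
  by exists A, B, C, D; split=> //; lia.
rewrite /o orbitFS -/o /=.
have [C2 [D2 ry2]] := rep_exists (yF (o m).1 (o m).2).
have [A2 [B2 rr2]] := rep_exists (rF a b (o m).1 (yF (o m).1 (o m).2)).
have t1 : tF a b (o m).1 (o m).2 = tf P / tf Q by rewrite tF_orbit.
have t2 : tF a b (o m).1 (yF (o m).1 (o m).2) = tf P / tf Q.
  by rewrite tF_yF.
have ey := ht_step_y (on0 m) h1 ry2 h2 Q0 t1 sP sQ.
have er := ht_step_r h1 rr2 ry2 Q0 t2 sP sQ.
exists A2, B2, C2, D2; split=> //.
  by move: (ht A2 B2) (ht C2 D2) (ht A1 B1) (ht C1 D1) h3 h4 ey er => *; nia.
by move: (ht A2 B2) (ht C2 D2) (ht A1 B1) (ht C1 D1) h3 h4 ey er => *; nia.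
Qed.

End Orbits.

Lemma size_cancel (n u v w : nat) : (w <= n.+1 -> 0 < v ->
  (n.+1 + u).-1 <= (w + v).-1 -> u <= v)%N.
Proof. lia. Qed.

Lemma size_cancel2 (n w c d c' d' : nat) :
  (0 < c -> 0 < d -> 0 < c' -> 0 < d' ->
   (n + (c + c').-1).-1 = (w + (d + d').-1).-1 -> c <= d -> c' <= d' -> 0 < w -> w <= n)%N.
Proof. lia. Qed.

(** * Exact heights on a line y = const *)

Section OrbitsExact.
Variable K : fieldType.
Local Notation L := {fraction {poly K}}.
Local Notation tf := (@FracField.tofrac {poly K}).
Implicit Types A B C D P Q : {poly K}.
Variables (al be : K) (al0 : al != 0).
Local Notation a := (tf al%:P).
Local Notation b := (tf be%:P).

Lemma coprimep_lin (A B E : {poly K}) c : c != 0 -> coprimep B A ->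
  coprimep (B ^+ 2) (c%:P * A ^+ 2 + E * B).
Proof.
move=> c0 cBA; rewrite coprimep_expl // addrC coprimep_addl_mul.
by rewrite mul_polyC coprimepZr // coprimep_expr.
Qed.

Lemma coprimep_size1 (A B c : {poly K}) : coprimep A B -> c %| A -> c %| B ->
  size c = 1%N.
Proof.
by move=> /coprimepP h cA cB; apply/eqP; rewrite size_poly_eq1; exact: h.
Qed.

(** The two size hypotheses say that, at the infinite point of the line, r has a simple pole and y
    is finite. As t has degree 2, the term P D^2 dominates and the right-hand side W has degree 2
    h(y) + 2. Nothing cancels, because D^2 is prime to al C^2 plus a multiple of D. *)
Lemma ht_exact_r r y A B A' B' C D P : rep r A B ->
  rep (rF a b r y) A' B' -> rep y C D -> tF a b r y = tf P -> size P = 3 ->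
  size A = (size B).+1 -> (size C <= size D)%N ->
  (ht A B + ht A' B' = ht C D + ht C D + 2)%N /\ size A' = (size B').+1.
Proof.
move=> rr rr' ry tE sP sAB sCD.
have tE1 : tF a b r y = tf P / tf 1 by rewrite tE tofrac1 divr1.
have [h1 h2] := rep_cross_r rr rr' ry (oner_neq0 _) tE1; rewrite !mul1r in h1 h2.
case: rr rr' ry => [cAB B0 _] [cAB' B'0 _] [cCD D0 _].
have sD : size D = (ht C D).+1 by rewrite -(htP C D0) (maxn_idPr sCD).
have sC : (size C <= (ht C D).+1)%N by rewrite -sD.
set n := ht C D in sC sD *.
have sD2 : size (D ^+ 2) = (n + n).+1 by rewrite expr2; exact: size_mul_eq.
have sV : (size (al%:P * C ^+ 2 + al%:P * C * D + be%:P * D ^+ 2)%R <= (n + n).+1)%N.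
  apply: size_le_add; first apply: size_le_add.
  - by apply: (size_le_mul (size_le_const al 0) (size_le_sqr sC (leqnn _))).
  - by apply: (size_le_mul (size_le_mul (size_le_const al 0) sC (leqnn _)) (_ : (_ <= n.+1)%N)); rewrite ?sD.
  - by apply: (size_le_mul (size_le_const be 0) (_ : (_ <= (n + n).+1)%N)); rewrite ?sD2.
have sW : size (- (al%:P * C * D) - P * D ^+ 2) = (n + n + 2).+1.
  have e : size (P * D ^+ 2) = (2 + (n + n)).+1 by exact: size_mul_eq.
  rewrite addrC size_polyDl size_polyN; first by rewrite e addnC.
  rewrite size_polyN e.
  apply: (@leq_ltn_trans (n + n).+1); last by rewrite ltnS; lia.
  by apply: (size_le_mul (size_le_mul (size_le_const al 0) sC (leqnn _)) (_ : (_ <= n.+1)%N)); rewrite ?sD.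
have A0 : A != 0 by rewrite -size_poly_gt0 sAB.
have D20 : D ^+ 2 != 0 by rewrite expf_neq0.
split.
  apply: (vieta_eq cAB cAB' B0 B'0 D20 h1 h2).
    move=> c cU cV _; apply: coprimep_size1 cU cV.
    have -> : al%:P * C ^+ 2 + al%:P * C * D + be%:P * D ^+ 2 =
      al%:P * C ^+ 2 + (al%:P * C + be%:P * D) * D by ring.
    by apply: coprimep_lin; rewrite // coprimep_sym.
  by rewrite sD2 sW; apply/eqP; rewrite eqn_leq !geq_max !leq_max; lia.
have W0 : - (al%:P * C * D) - P * D ^+ 2 != 0 by rewrite -size_poly_gt0 sW.
have A'0 : A' != 0.
  apply: contra_neqN W0 => /eqP A'0.
  move/eqP: h2; rewrite A'0 !mulr0 eq_sym mulf_eq0 mulf_eq0 (negPf B0) (negPf B'0) !orbF.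
  by move/eqP.
have := congr1 (fun p : {poly K} => size p) h2.
rewrite (size_mul D20 (mulf_neq0 A0 A'0)) (size_mul W0 (mulf_neq0 B0 B'0)).
rewrite (size_mul A0 A'0) (size_mul B0 B'0) sD2 sW sAB.
move: A'0 B0 B'0; rewrite -!size_poly_gt0.
by move: (size A') (size B) (size B') => u v w; lia.
Qed.

(** The lost unit comes from deg B = deg A - 1: the product A B has degree 2 h(r) - 1. A common
    divisor of U, V and W divides B^2, to which W is prime. *)
Lemma ht_exact_y r y A B C' D' C D P : r != 0 -> rep r A B ->
  rep (yF r y) C' D' -> rep y C D -> tF a b r y = tf P ->
  size A = (size B).+1 -> (size C <= size D)%N ->
  (ht C D + ht C' D' + 1 = ht A B + ht A B)%N /\ (size C' <= size D')%N.
Proof.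
move=> r0 rr ry' ry tE sAB sCD.
have tE1 : tF a b r y = tf P / tf 1 by rewrite tE tofrac1 divr1.
have [h1 h2] := rep_cross_y al0 r0 rr ry' ry (oner_neq0 _) tE1; rewrite !mul1r in h1 h2.
have A0 := rep_neq0 rr r0.
case: rr ry' ry => [cAB B0 _] [cCD' D'0 _] [cCD D0 _].
have alP0 : al%:P != 0 :> {poly K} by rewrite polyC_eq0.
have sA : size A = (ht A B).+1.
  by rewrite -(htP A B0); apply/esym/maxn_idPl; rewrite sAB.
have sB : size B = ht A B by apply: succn_inj; rewrite -sAB.
have n0 : (0 < ht A B)%N by rewrite -sB size_poly_gt0.
have sD : size D = (ht C D).+1 by rewrite -(htP C D0) (maxn_idPr sCD).
set n := ht A B in sA sB n0 *; set d := ht C D in sD *.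
have U0 : al%:P * A * B != 0 by rewrite !mulf_neq0.
have sU : size (al%:P * A * B) = (n + n)%N.
  by rewrite -mulrA mul_polyC size_scale // size_mul // sA sB.
have sApB : size (A + B) = n.+1 by rewrite size_polyDl sA // sB.
have V0 : A + B != 0 by rewrite -size_poly_gt0 sApB.
have sV : size (- (al%:P * (A + B) * B)) = (n + n)%N.
  by rewrite size_polyN -mulrA mul_polyC size_scale // size_mul // sApB sB.
have sC' : (size C' <= size D')%N.
  have [->|C'0] := eqVneq C' 0; first by rewrite size_poly0.
  (* This is y' = - y - 1 - 1 / r over a common denominator; as y and 1 / r are finite at infinity,
     so is y'. *)
  have e : A * D * C' = - ((A + B) * D + A * C) * D'.
    apply: (mulfI (mulf_neq0 alP0 B0)).
    have -> : al%:P * B * (A * D * C') =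
      al%:P * A * B * (C * D' + C' * D) - al%:P * A * B * C * D' by ring.
    by rewrite h1; ring.
  have le : (size ((A + B) * D + A * C)%R <= (n + d).+1)%N.
    apply: size_le_add; first by apply: (size_le_mul (_ : (_ <= n.+1)%N) (_ : (_ <= d.+1)%N)); rewrite ?sApB ?sD.
    by apply: (size_le_mul (_ : (_ <= n.+1)%N) (_ : (_ <= d.+1)%N)); rewrite ?sA -?sD.
  have := congr1 (fun p : {poly K} => size p) e.
  rewrite mulNr size_polyN (size_mul (mulf_neq0 A0 D0) C'0) (size_mul_eq sA sD) /= => e'.
  have := size_polyMleq ((A + B) * D + A * C) D'; rewrite -{}e'.
  move: (D'0); rewrite -size_poly_gt0.
  by move: (size C') (size D') (size ((A + B) * D + A * C)%R) le; exact: size_cancel.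
split=> //.
pose W := P * B ^+ 2 - A ^+ 2 + be%:P * A * B.
(* W / U is y y', which is finite at infinity, so W is not larger than U. *)
have sW : (size W <= n + n)%N.
  have [->|W0] := eqVneq W 0; first by rewrite size_poly0.
  have : al%:P * A * B * (C * C') != 0 by rewrite h2 !mulf_neq0.
  rewrite mulf_eq0 (negPf U0) orFb mulf_eq0 negb_or => /andP[C0 C'0].
  have := congr1 (fun p : {poly K} => size p) h2; rewrite -/W.
  rewrite (size_mul U0 (mulf_neq0 C0 C'0)) (size_mul W0 (mulf_neq0 D0 D'0)).
  rewrite (size_mul C0 C'0) (size_mul D0 D'0) sU.
  by move/size_cancel2; apply; rewrite // size_poly_gt0.
have -> : (n + n)%N = (n + n).-1.+1 by rewrite prednK // addn_gt0 n0.
rewrite addn1; congr S; apply: (vieta_eq cCD cCD' D0 D'0 U0 h1 h2).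
  move=> c cU cV cW; apply: (@coprimep_size1 (B ^+ 2) W) => //.
    have -> : W = (-1)%:P * A ^+ 2 + (P * B + be%:P * A) * B.
      by rewrite /W polyCN polyC1; ring.
    by apply: coprimep_lin; rewrite ?oppr_eq0 ?oner_neq0 // coprimep_sym.
  rewrite -(dvdpZr _ _ al0) -mul_polyC.
  have -> : al%:P * B ^+ 2 = - (- (al%:P * (A + B) * B)) - al%:P * A * B by ring.
  by apply: dvdp_sub => //; rewrite -mulN1r dvdp_mull.
rewrite sU sV prednK ?addn_gt0 ?n0 //.
by rewrite (maxn_idPl sW) maxnn.
Qed.

Lemma orbit_ht_exact r0 y0 A B C D P : let o := orbitF a b r0 y0 in
  (forall m, (o m).1 != 0) -> rep r0 A B -> rep y0 C D ->
  ht A B = 1%N -> ht C D = 0%N -> size A = (size B).+1 -> (size C <= size D)%N ->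
  tF a b r0 y0 = tf P -> size P = 3 ->
  forall m, exists C D, rep (o m).2 C D /\ ht C D = (m ^ 2)%N.
Proof.
move=> o on0 rr ry hAB hCD sAB sCD tE sP m.
(* The values h(y_m) = m^2 and h(r_m) = m^2 + m + 1 solve the two exact recurrences. *)
suff [A' [B' [C' [D' [h1 h2 [h3 h4] h5 h6]]]]] : exists A B C D,
    [/\ rep (o m).1 A B, rep (o m).2 C D,
    ht C D = (m ^ 2)%N /\ ht A B = (m ^ 2 + m + 1)%N, size A = (size B).+1 &
    (size C <= size D)%N] by exists C', D'.
elim: m => [|m [A1 [B1 [C1 [D1 [h1 h2 [h3 h4] h5 h6]]]]]].
  by exists A, B, C, D; split.
rewrite /o orbitFS -/o /=.
have [C2 [D2 ry2]] := rep_exists (yF (o m).1 (o m).2).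
have [A2 [B2 rr2]] := rep_exists (rF a b (o m).1 (yF (o m).1 (o m).2)).
have t1 : tF a b (o m).1 (o m).2 = tf P by rewrite tF_orbit.
have t2 : tF a b (o m).1 (yF (o m).1 (o m).2) = tf P by rewrite tF_yF.
have [ey sy] := ht_exact_y (on0 m) h1 ry2 h2 t1 h5 h6.
have [er sr] := ht_exact_r h1 rr2 ry2 t2 sP h5 sy.
exists A2, B2, C2, D2; split=> //.
move: (ht A2 B2) (ht C2 D2) er ey; rewrite h3 h4 => *; split; nia.
Qed.

End OrbitsExact.

(** * Degrees of rational maps of the plane *)

Section Homogenization.
Variable K : fieldType.
Local Notation M := (mpoly.mpoly 2 K).
Local Notation tf := (@FracField.tofrac M).
Local Notation msize := (mpoly.mmeasure mpoly.mdeg).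

(** The subtraction is truncated: the monomial has degree d only if that of m is at most d. *)
Definition hom_mon d (m : mpoly.multinom 2) : mpoly.multinom 3 :=
  mpoly.Multinom [tuple (d - mpoly.mdeg m)%N; m 0; m 1].

Definition homogenize d (p : M) : mpoly.mpoly 3 K :=
  \sum_(m <- mpoly.msupp p) mpoly.mcoeff m p *: mpoly.mpolyX K (hom_mon d m).

Lemma mdeg2 (m : mpoly.multinom 2) : mpoly.mdeg m = (m 0%R + m 1%R)%N.
Proof.
by rewrite mpoly.mdegE big_ord_recl big_ord1; congr (m _ + m _)%N; exact/val_inj.
Qed.

Lemma homogenize_homog d p : (msize p <= d.+1)%N ->
  homogenize d p \is mpoly.ishomog1 d mpoly.mdeg.
Proof.
move=> sp; rewrite /homogenize big_seq; apply: rpred_sum => m mp.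
apply: rpredZ; rewrite mpoly.dhomogX -[X in X == _]/(mpoly.mdeg (hom_mon d m)).
rewrite mpoly.mdegE !big_ord_recl big_ord0 !mpoly.multinomE.
have lt := leq_trans (mpoly.msize_mdeg_lt mp) sp.
apply/eqP; move: lt => /=; rewrite mdeg2 !(tnth_nth 0%N) /=. move: (m 0) (m 1) => u v /=; lia.
Qed.

Lemma dehomogenizeK d p : dehomogenize (homogenize d p) = p.
Proof.
rewrite /dehomogenize /homogenize raddf_sum [RHS]mpoly.mpolyE.
apply: eq_bigr => m _; apply: (etrans (mpoly.comp_mpolyZ _ _ _)); congr (_ *: _).
rewrite mpoly.comp_mpolyX mpoly.mpolyXE_id !big_ord_recl !big_ord0.
rewrite expr1n mul1r !mulr1.
rewrite !mpoly.multinomE !(tnth_nth 0%N) !(tnth_nth 0) /= /aff_var.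
by have -> : lift ord0 ord0 = 1 :> 'I_2 by exact/val_inj.
Qed.

Lemma dehomogenize_msize (q : mpoly.mpoly 3 K) : (msize (dehomogenize q) <= mpoly.mmeasure mpoly.mdeg q)%N.
Proof.
rewrite /dehomogenize mpoly.comp_mpolyEX; apply: (leq_trans (mpoly.msize_sum _ _ _)).
apply/bigmax_leqP_seq => m mq _; apply: (leq_trans (mpoly.msizeZ_le _ _)).
rewrite mpoly.comp_mpolyX !big_ord_recl big_ord0 expr1n mul1r mulr1.
have lt := mpoly.msize_mdeg_lt mq; apply: leq_trans lt.
rewrite !(tnth_nth 0) /= /aff_var !mpoly.mpolyXn -mpoly.mpolyXD mpoly.msizeX ltnS.
rewrite mpoly.mdegD !mpoly.mdegMn !mpoly.mdeg1 !mul1n mpoly.mdegE !big_ord_recl big_ord0.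
by rewrite addn0 leq_addl.
Qed.

Lemma dehomogenizeM (p q : mpoly.mpoly 3 K) :
  dehomogenize (p * q) = dehomogenize p * dehomogenize q.
Proof. exact: rmorphM. Qed.

Lemma homog_msize n d (p : mpoly.mpoly n K) :
  p \is mpoly.ishomog1 d mpoly.mdeg -> (mpoly.mmeasure mpoly.mdeg p <= d.+1)%N.
Proof.
move=> hp; rewrite mpoly.msizeE; apply/bigmax_leqP_seq => m mp _.
by rewrite (mpoly.dhomog_mf hp mp).
Qed.

(** [mmeasure] is the degree plus one, and 0 on the zero polynomial; hence the predecessors and the
    separate role of q = 0. *)
Lemma msize_cofactor n d (h q : mpoly.mpoly n K) : h != 0 ->
  (mpoly.mmeasure mpoly.mdeg (h * q)%R <= d.+1)%N ->
  (mpoly.mmeasure mpoly.mdeg q <= (d - (mpoly.mmeasure mpoly.mdeg h).-1).+1)%N /\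
  (q != 0 -> ((mpoly.mmeasure mpoly.mdeg h).-1 <= d)%N).
Proof.
move=> h0; have [->|q0] := eqVneq q 0; first by rewrite mpoly.mmeasure0.
rewrite mpoly.msizeM // (mpoly.mpolySpred mpoly.mdeg h0) (mpoly.mpolySpred mpoly.mdeg q0).
move: (mpoly.mmeasure _ h).-1 (mpoly.mmeasure _ q).-1 => u v.
by rewrite addSn addnS /= !ltnS => uv; split=> [|_]; lia.
Qed.

Definition triple (f : ratmap K) d (p : 'I_3 -> M) : Prop :=
  [/\ forall i, (msize (p i) <= d.+1)%N, p 0 != 0,
      f.1 * tf (p 0) = tf (p 1) & f.2 * tf (p 0) = tf (p 2)].

Lemma triple_exists f : exists d p, triple f d p.
Proof.
have [P [Q [Q0 e1]]] := fracP f.1; have [P' [Q' [Q'0 e2]]] := fracP f.2.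
pose p (i : 'I_3) := if i == 0 then Q * Q' else if i == 1 then P * Q' else P' * Q.
exists (\max_i msize (p i))%N, p; split => [i|||].
- by apply: leqW; exact: (@leq_bigmax _ (fun i => msize (p i)) i).
- by rewrite mulf_neq0.
- by rewrite e1 /p /= !tofracM mulrA divfK // tofrac_eq0.
- by rewrite e2 /p /= !tofracM mulrCA mulrA [_ * tf Q]mulrC mulrA divfK ?tofrac_eq0 // mulrC.
Qed.

(** A representation with least degree bound always exists, and its minimality takes the place of
    greatest common divisors in several variables. *)
Definition min_triple f d p :=
  triple f d p /\ forall d' p', triple f d' p' -> (d <= d')%N.

Lemma min_triple_exists f : exists d p, min_triple f d p.
Proof.
have ex : exists d, `[< exists p, triple f d p >].
  by have [d h] := triple_exists f; exists d; exact/asboolP.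
case: (ex_minnP ex) => d /asboolP[p hp] dmin; exists d, p; split=> // d' p' h.
by apply: dmin; apply/asboolP; exists p'.
Qed.

Lemma min_triple_factor f d p h k e : min_triple f d p ->
  (forall i, p i = h * k i) -> (forall i, (msize (k i) <= (d - e).+1)%N) ->
  (e <= d)%N -> e = 0%N.
Proof.
move=> [[sp p0 e1 e2] dmin] pE sk ed; suff : triple f (d - e) k by move/dmin; lia.
have h0 : h != 0 by apply: contraNneq p0 => h0; rewrite pE h0 mul0r.
have th : tf h != 0 by rewrite tofrac_eq0.
split=> //.
- by apply: contraNneq p0 => k0; rewrite pE k0 mulr0.
- by apply: (mulfI th); rewrite -tofracM -pE -e1 pE tofracM mulrCA.
- by apply: (mulfI th); rewrite -tofracM -pE -e2 pE tofracM mulrCA.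
Qed.

Lemma min_triple_no_factor f d p h k : min_triple f d p ->
  (forall i, p i = h * k i) -> (msize h <= 1)%N.
Proof.
move=> mp pE; have [[sp p0 _ _] _] := mp.
have h0 : h != 0 by apply: contraNneq p0 => h0; rewrite pE h0 mul0r.
have k0 : k 0 != 0 by apply: contraNneq p0 => k0; rewrite pE k0 mulr0.
have sg i : (msize (h * k i)%R <= d.+1)%N by rewrite -pE.
have sk i := msize_cofactor h0 (sg i).
have e0 := min_triple_factor mp pE (fun i => (sk i).1) ((sk 0).2 k0).
by move: e0; case: (msize h) => [|[]].
Qed.

(** Let h divide the homogenized triple; h may be a power of the variable at infinity. The
    dehomogenized cofactors satisfy the degree bound d - deg h, so [min_triple_factor] gives deg h =
    0. *)
Lemma min_triple_degree f d p : min_triple f d p -> has_degree f d.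
Proof.
move=> mp; have [[sp p0 e1 e2] _] := mp.
have t0 : tf (p 0) != 0 by rewrite tofrac_eq0.
exists (fun i => homogenize d (p i)).
  split=> [i|||]; first exact: homogenize_homog.
  - by rewrite dehomogenizeK.
  - by rewrite !dehomogenizeK -e1 mulfK.
  - by rewrite !dehomogenizeK -e2 mulfK.
move=> h /(_ _)/cid hq; pose q i := sval (hq i).
have gE i : homogenize d (p i) = h * q i := svalP (hq i).
have pE i : p i = dehomogenize h * dehomogenize (q i).
  by rewrite -dehomogenizeM -gE dehomogenizeK.
have h0 : h != 0.
  by apply: contraNneq p0 => h0; rewrite -(dehomogenizeK d (p 0)) gE h0 mul0r /dehomogenize raddf0.
have q0 : q 0 != 0.
  by apply: contraNneq p0 => q0; rewrite pE q0 /dehomogenize raddf0 mulr0.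
have sg i : (mpoly.mmeasure mpoly.mdeg (h * q i)%R <= d.+1)%N.
  by rewrite -gE; apply: homog_msize; exact: homogenize_homog.
have sk i := msize_cofactor h0 (sg i).
have e0 := min_triple_factor mp pE (fun i => leq_trans (dehomogenize_msize _) (sk i).1) ((sk 0).2 q0).
by exists (mpoly.mcoeff mpoly.mnm0 h); apply: mpoly.msize1_polyC; move: e0; case: mpoly.mmeasure => [|[]].
Qed.

End Homogenization.

(** * Gauss's lemma over K[s], with K algebraically closed *)

Lemma add_fraction (R : comNzRingType) (m d n i g x : R) : m * i = 1 ->
  m * (d * g) * x + d * n = d * m * (g * x + n * i).
Proof. by move=> mi; rewrite mulrDr [d * m * (n * i)]mulrACA mi; ring. Qed.

Lemma polyC_divff (F : fieldType) (c : F) : c != 0 -> c%:P * (c^-1)%:P = 1.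
Proof. by move=> c0; rewrite -polyCM divff. Qed.

Section GaussLemma.
Variable K : closedFieldType.
Local Notation A := {poly K}.
Local Notation L0 := {fraction A}.
Local Notation tf := (@FracField.tofrac A).
Local Notation spec s := (map_poly (horner_eval s) : {poly A} -> {poly K}).
Local Notation iota := (map_poly tf : {poly A} -> {poly L0}).
Implicit Types (g p q G P : {poly A}) (c d : A) (s : K).

Lemma spec0_dvd s q : spec s q = 0 -> exists q1, q = ('X - s%:P)%:P * q1.
Proof.
move=> q0; exists (map_poly (fun c => c %/ ('X - s%:P)) q).
apply/polyP => i; rewrite coefCM coef_map_id0 ?div0p // mulrC divpK //.
rewrite dvdp_XsubCl; apply/rootP.
by have := congr1 (fun p : {poly K} => p`_i) q0; rewrite coef_map coef0.
Qed.

(** As K is algebraically closed, g is primitive iff no specialization s of its coefficients kills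
    it. Each linear factor taken out of the coefficients lowers the degree of the leading
    coefficient, which bounds the process. *)
Lemma primitive_part G : G != 0 -> exists c g,
  [/\ c != 0, G = c%:P * g & forall s, spec s g != 0].
Proof.
have [n] := ubnP (size (lead_coef G)); elim: n G => // n ih G sG G0.
have [h|/existsNP[s /negP]] := pselect (forall s, spec s G != 0).
  by exists 1, G; rewrite oner_neq0 polyC1 mul1r.
rewrite negbK => /eqP /spec0_dvd [q Gq].
have q0 : q != 0 by apply: contraNneq G0 => q0; rewrite Gq q0 mulr0.
have [||c [g [c0 qE gs]]] := ih q; rewrite ?q0 //.
  move: sG; rewrite Gq lead_coefM lead_coefC size_mul ?polyXsubC_eq0 ?lead_coef_eq0 //.
  by rewrite size_XsubC.
exists (('X - s%:P) * c), g; split=> //; first by rewrite mulf_neq0 ?polyXsubC_eq0.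
by rewrite Gq qE polyCM mulrA.
Qed.

Lemma clear_denominators (G : {poly L0}) : exists d g,
  d != 0 /\ iota g = (tf d)%:P * G.
Proof.
elim/poly_ind: G => [|G c [d [g [d0 gE]]]].
  by exists 1, 0; rewrite oner_neq0 rmorph0 mulr0.
have [n [m [m0 ->]]] := fracP c.
exists (d * m), (m%:P * g * 'X + (d * n)%:P); split; first by rewrite mulf_neq0.
rewrite rmorphD !rmorphM /= map_polyX !map_polyC /= gE.
by apply: add_fraction; apply: polyC_divff; rewrite tofrac_eq0.
Qed.

Lemma iota_inj : injective iota.
Proof. by apply: map_inj_poly; [move=> c d /eqP; rewrite tofrac_eq => /eqP|rewrite tofrac0]. Qed.

(** Clearing denominators gives d P = g q0. A root s of d kills the specialization of g q0, hence
    that of q0 because g survives, and the factor vanishing at s cancels on both sides; the degree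
    of d drops. *)
Lemma gauss_dvd g P : (forall s, spec s g != 0) -> iota g %| iota P ->
  exists q, P = g * q.
Proof.
move=> gs /dvdpP[Q PQ]; have [d [q0 [d0 qE]]] := clear_denominators Q.
have : d%:P * P = g * q0.
  apply: iota_inj; rewrite !rmorphM /= map_polyC /= PQ qE mulrA mulrC.
  by [].
have [n] := ubnP (size d); elim: n d d0 q0 {Q PQ qE} => // n ih d d0 q0 sd e.
have [s1|s1] := boolP (size d == 1%N).
  have /size_poly1P[k k0 dk] := s1; exists ((k^-1)%:P%:P * q0).
  by rewrite mulrCA -e dk mulrA -!polyCM mulVf // mul1r.
have /closed_rootP[s /factor_theorem[d1 dE]] := s1.
have sX : spec s ('X - s%:P)%:P = 0.
  by rewrite map_polyC /= /horner_eval hornerXsubC subrr.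
have : spec s g * spec s q0 = 0.
  rewrite -[LHS](rmorphM (map_poly (horner_eval s))) -e dE polyCM -mulrA mulrCA.
  by apply: (etrans (rmorphM (map_poly (horner_eval s)) _ _)); rewrite /= sX mul0r.
move/eqP; rewrite mulf_eq0 (negPf (gs s)) => /eqP /spec0_dvd [q1 q1E].
have d10 : d1 != 0 by apply: contraNneq d0 => d10; rewrite dE d10 mul0r.
apply: (ih d1 d10 q1).
  by move: sd; rewrite dE size_mul ?polyXsubC_eq0 // size_XsubC addn2.
apply: (mulfI (_ : ('X - s%:P)%:P != 0)); first by rewrite polyC_eq0 polyXsubC_eq0.
by rewrite [RHS]mulrCA -q1E -e dE polyCM mulrCA mulrA.
Qed.

(** Clearing the denominators of c and then taking the primitive part leaves its degree unchanged;
    [gauss_dvd] descends the divisibility. *)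
Lemma gauss_common_factor (I : Type) (p : I -> {poly A}) (c : {poly L0}) :
  c != 0 -> (forall i, c %| iota (p i)) ->
  exists g, size g = size c /\ forall i, exists q, p i = g * q.
Proof.
move=> c0 cp; have [d [G [d0 GE]]] := clear_denominators c.
have td0 : tf d != 0 by rewrite tofrac_eq0.
have sG : size G = size c.
  rewrite -(size_scale c td0) -mul_polyC -GE size_map_inj_poly ?tofrac0 //.
  by move=> u v /eqP; rewrite tofrac_eq => /eqP.
have G0 : G != 0 by rewrite -size_poly_gt0 sG size_poly_gt0.
have [e [g [e0 GgE gs]]] := primitive_part G0.
have te0 : tf e != 0 by rewrite tofrac_eq0.
exists g; split=> [|i]; first by rewrite -sG GgE mul_polyC size_scale.
apply: (gauss_dvd gs); apply: dvdp_trans (cp i).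
rewrite -(dvdpZr _ _ td0) -mul_polyC -GE GgE rmorphM /= map_polyC /= dvdp_mull //.
Qed.

End GaussLemma.

(** * Restriction to generic horizontal and vertical lines *)

Section Lines.
Variable K : fieldType.
Local Notation A := {poly K}.
Local Notation L0 := {fraction A}.
Local Notation L := {fraction {poly L0}}.
Local Notation M := (mpoly.mpoly 2 K).
Local Notation msize := (mpoly.mmeasure mpoly.mdeg).
Variable sw : bool.

(** For [sw] = false the line is y = s with parameter x, for [sw] = true it is x = s with parameter
    y. The constant s is the variable of the coefficient ring, so that a single line over K(s)
    represents the pencil. *)
Definition out_var : 'I_2 := if sw then 1 else 0.
Definition in_var : 'I_2 := if sw then 0 else 1.

Definition bipoly_var (i : 'I_2) : {poly A} := if i == out_var then 'X else 'X%:P.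

Definition bipoly (p : M) : {poly A} := mpoly.mmap (polyC \o polyC) bipoly_var p.

Lemma bipoly_is_zmod_morphism : zmod_morphism bipoly.
Proof. by move=> p q; rewrite /bipoly rmorphB. Qed.

Lemma bipoly_is_monoid_morphism : monoid_morphism bipoly.
Proof. by split=> [|p q]; rewrite /bipoly ?rmorph1 ?rmorphM. Qed.

HB.instance Definition _ := GRing.isZmodMorphism.Build M {poly A} bipoly bipoly_is_zmod_morphism.
HB.instance Definition _ := GRing.isMonoidMorphism.Build M {poly A} bipoly bipoly_is_monoid_morphism.

Lemma bipoly_varE : bipoly_var out_var = 'X /\ bipoly_var in_var = 'X%:P.
Proof. by rewrite /bipoly_var /out_var /in_var; case: sw. Qed.

Lemma bipolyX m : mpoly.mmap1 bipoly_var m = 'X^(m out_var) * ('X^(m in_var))%:P.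
Proof.
have [e1 e2] := bipoly_varE.
have e : mpoly.mmap1 bipoly_var m = bipoly_var 0 ^+ m 0%R * bipoly_var 1 ^+ m 1%R.
  rewrite /mpoly.mmap1 big_ord_recl big_ord1.
  by have -> : lift ord0 ord0 = 1 :> 'I_2 by exact/val_inj.
rewrite e rmorphXn /= -e2 -e1; rewrite /out_var /in_var; case: sw => //.
by rewrite mulrC.
Qed.

Lemma bipolyE p : bipoly p = \sum_(m <- mpoly.msupp p)
  (mpoly.mcoeff m p)%:P%:P * ('X^(m out_var) * ('X^(m in_var))%:P).
Proof. by apply: eq_bigr => m _; rewrite bipolyX. Qed.

Lemma mnm2_eq (m m' : mpoly.multinom 2) :
  (m == m') = (m out_var == m' out_var) && (m in_var == m' in_var).
Proof.
apply/eqP/andP => [->|[/eqP e1 /eqP e2]]; first by rewrite !eqxx.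
have H : m 0 = m' 0 /\ m 1 = m' 1 by move: e1 e2; rewrite /out_var /in_var; case: sw.
apply/mpoly.mnmP => -[[|[|//]] li].
  by have -> : Ordinal li = 0; [exact/val_inj|exact: H.1].
by have -> : Ordinal li = 1; [exact/val_inj|exact: H.2].
Qed.

Lemma coef_bipoly p (m : mpoly.multinom 2) : (bipoly p)`_(m out_var)`_(m in_var) = mpoly.mcoeff m p.
Proof.
rewrite bipolyE coef_sum coef_sum [p in RHS]mpoly.mpolyE raddf_sum.
apply: eq_bigr => m' _; rewrite -[RHS]/(mpoly.mcoeff m _) mpoly.mcoeffZ mpoly.mcoeffX.
rewrite coefCM coefMC coefXn coefCM [m' == m]eq_sym mnm2_eq.
by case: eqP => _; rewrite ?mul1r ?mul0r ?coef0 // coefXn.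
Qed.

Lemma bipoly_inj : injective bipoly.
Proof. by move=> p q e; apply/mpoly.mpolyP => m; rewrite -!coef_bipoly e. Qed.

Lemma bipolyM p q : bipoly (p * q) = bipoly p * bipoly q.
Proof. exact: (rmorphM bipoly). Qed.

Lemma bipoly_eq0 p : (bipoly p == 0) = (p == 0).
Proof. by rewrite -(inj_eq bipoly_inj) (rmorph0 bipoly). Qed.

Lemma size_bipoly p : (size (bipoly p) <= msize p)%N.
Proof.
rewrite bipolyE; apply: (leq_trans (size_sum _ _ _)); apply/bigmax_leqP_seq => m mp _.
apply: leq_trans (mpoly.msize_mdeg_lt mp).
rewrite mulrCA -polyCM mulrC mul_polyC; apply: (leq_trans (size_scale_leq _ _)).
rewrite size_polyXn ltnS mdeg2 /out_var; case: sw; [exact: leq_addl|exact: leq_addr].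
Qed.

Lemma mnm_lt_size p m : m \in mpoly.msupp p -> (m out_var < size (bipoly p))%N.
Proof.
rewrite mpoly.mcoeff_msupp -coef_bipoly; apply: contraNltn => h.
by rewrite (nth_default _ h) coef0.
Qed.

Lemma bipoly_surj P : exists p, bipoly p = P.
Proof.
have [e1 e2] := bipoly_varE.
have bV i : bipoly (mpoly.mpolyX K (mpoly.mnm1 i)) = bipoly_var i.
  by rewrite /bipoly mpoly.mmapX mpoly.mmap1U.
elim/poly_ind: P => [|P c [p <-]]; first by exists 0; rewrite rmorph0.
suff [q <-] : exists q, bipoly q = c%:P.
  by exists (p * mpoly.mpolyX K (mpoly.mnm1 out_var) + q); rewrite rmorphD rmorphM /= bV e1.
elim/poly_ind: c => [|c d [q qE]]; first by exists 0; rewrite rmorph0.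
exists (q * mpoly.mpolyX K (mpoly.mnm1 in_var) + mpoly.mpolyC 2 d).
rewrite rmorphD rmorphM /= bV e2 qE polyCD polyCM; congr (_ + _).
by rewrite /bipoly mpoly.mmapC.
Qed.

Local Notation tf0 := (@FracField.tofrac A).
Local Notation tf := (@FracField.tofrac {poly L0}).

Definition line_poly (p : M) : {poly L0} := map_poly tf0 (bipoly p).

Definition line (p : M) : L := tf (line_poly p).

Lemma line_is_zmod_morphism : zmod_morphism line.
Proof. by move=> p q; rewrite /line /line_poly !rmorphB. Qed.

Lemma line_is_monoid_morphism : monoid_morphism line.
Proof. by split=> [|p q]; rewrite /line /line_poly ?rmorph1 // !rmorphM. Qed.

HB.instance Definition _ := GRing.isZmodMorphism.Build M L line line_is_zmod_morphism.
HB.instance Definition _ := GRing.isMonoidMorphism.Build M L line line_is_monoid_morphism.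

Lemma size_line_poly p : size (line_poly p) = size (bipoly p).
Proof.
by rewrite size_map_inj_poly ?tofrac0 // => u v /eqP; rewrite tofrac_eq => /eqP.
Qed.

Lemma line_inj p : line p = 0 -> p = 0.
Proof.
by move/eqP; rewrite tofrac_eq0 -size_poly_eq0 size_line_poly size_poly_eq0 bipoly_eq0 => /eqP.
Qed.

Definition restr : {rmorphism ratfun K -> L} := fextR line_inj.

Lemma restr_tofrac p : restr (FracField.tofrac p) = tf (line_poly p).
Proof. exact: (fext_tofrac line_inj). Qed.

Lemma restr_cst c : restr (rat_cst c) = tf (tf0 c%:P)%:P.
Proof. by rewrite restr_tofrac /line_poly /bipoly mpoly.mmapC map_polyC. Qed.

Lemma restr_var i : restr (FracField.tofrac (mpoly.mpolyX K (mpoly.mnm1 i))) =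
  tf (map_poly tf0 (bipoly_var i)).
Proof. by rewrite restr_tofrac /line_poly /bipoly mpoly.mmapX mpoly.mmap1U. Qed.

End Lines.

(** * Quadratic growth *)

Section BaseLines.
Variables (K : fieldType) (al be s : K).
Local Notation tf := (@FracField.tofrac {poly K}).
Local Notation a := (tf al%:P).
Local Notation b := (tf be%:P).

Lemma tF_affine (L : fieldType) (A B x y : L) : y != 0 ->
  tF A B ((x - 1) / y) y =
  ((x - 1) ^+ 2 - B * (x - 1) * y - A * ((x - 1) * y ^+ 3 + (x - 1) * y ^+ 2 + y ^+ 3)) /
  y ^+ 2.
Proof. by move=> y0; rewrite /tF; field. Qed.

Lemma rep_horizontal_y : rep (tf s%:P) s%:P 1 /\ ht s%:P 1 = 0%N.
Proof.
split; first by split; rewrite ?coprimep1 ?oner_neq0 // tofrac1 divr1.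
rewrite /ht size_poly1; apply/eqP; rewrite -leqn0 -ltnS prednK ?leq_max ?orbT //.
by rewrite geq_max size_polyC_leq1.
Qed.

Hypothesis s0 : s != 0.

Lemma rep_horizontal_r : let rho := s^-1 *: ('X - 1) in
  [/\ rep ((tf 'X - 1) / tf s%:P) rho 1, ht rho 1 = 1%N & size rho = 2].
Proof.
move=> rho; have srho : size rho = 2.
  by rewrite size_scale ?invr_eq0 // -[1]polyC1 size_XsubC.
split; rewrite // /ht ?srho ?size_poly1 //; split; rewrite ?coprimep1 ?oner_neq0 //.
have s0' : tf s%:P != 0 by rewrite tofrac_eq0 polyC_eq0.
apply/eqP; rewrite eqr_div ?tofrac1 ?oner_neq0 // mulr1 -tofrac1 -tofracB -tofracM tofrac_eq.
by rewrite /rho -mul_polyC mulrAC -polyCM mulVf // mul1r.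
Qed.

Lemma tF_horizontal : exists P, tF a b ((tf 'X - 1) / tf s%:P) (tf s%:P) = tf P /\ size P = 3.
Proof.
have [[_ _ rE] _ srho] := rep_horizontal_r.
set rho := s^-1 *: ('X - 1) in rE srho.
exists (rho ^+ 2 + (- (be%:P * rho) - al%:P * (rho * s%:P ^+ 2 + rho * s%:P + s%:P))); split.
  rewrite rE tofrac1 divr1 /tF addrA.
  by rewrite !(tofracD, tofracN, tofracM, tofracXn).
have s2 : size (rho ^+ 2) = 3 by rewrite expr2; exact: (@size_mul_eq _ 1 1).
rewrite size_polyDl s2 // ltnS.
have sr : (size rho <= 2)%N by rewrite srho.
have sc : (size (s%:P ^+ 2)%R <= 1)%N by apply: (size_le_sqr (size_le_const s 0)).
apply: size_le_add; apply: size_le_opp; first by apply: (size_le_mul (size_le_const be 0) sr).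
apply: (size_le_mul (size_le_const al 0) (n := 1)) => //; apply: size_le_add; last exact: size_le_const.
by apply: size_le_add; [apply: (size_le_mul sr sc)|apply: (size_le_mul sr (size_le_const s 0))].
Qed.

Hypothesis s1 : s != 1.

Lemma rep_vertical_y : rep (tf 'X) 'X 1 /\ (ht ('X : {poly K}) 1 <= 1)%N.
Proof.
by split; [split; rewrite ?coprimep1 ?oner_neq0 // tofrac1 divr1|rewrite /ht size_polyX size_poly1].
Qed.

Lemma rep_vertical_r : rep ((tf s%:P - 1) / tf 'X) (s - 1)%:P 'X /\
  (ht (s - 1)%:P 'X <= 1)%N.
Proof.
split; last first.
  by rewrite /ht size_polyX (maxn_idPr _) // (leq_trans (size_polyC_leq1 _)).
split; rewrite ?polyX_eq0 ?polyCB ?tofracB ?tofrac1 //.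
by rewrite coprimep_sym -[X in coprimep X]subr0 -polyC0 coprimep_sym coprimep_XsubC -polyCB rootC subr_eq0.
Qed.

Lemma tF_vertical : exists P, [/\ tF a b ((tf s%:P - 1) / tf 'X) (tf 'X) = tf P / tf ('X ^+ 2) &
  (size P <= 5)%N].
Proof.
have X0 : tf 'X != 0 by rewrite tofrac_eq0 polyX_eq0.
rewrite (tF_affine _ _ _ X0).
exists ((s%:P - 1) ^+ 2 - be%:P * (s%:P - 1) * 'X -
  al%:P * ((s%:P - 1) * 'X ^+ 3 + (s%:P - 1) * 'X ^+ 2 + 'X ^+ 3)); split.
  by rewrite !(tofracD, tofracN, tofracM, tofracXn, tofrac1).
have sc k : (size (s%:P - 1)%R <= k.+1)%N by rewrite -polyC1 -polyCB size_le_const.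
have sX n : (n <= 3)%N -> (size ('X^n : {poly K}) <= 4)%N by rewrite size_polyXn.
apply: size_le_add; last apply: size_le_opp.
  apply: size_le_add; first by apply: (size_le_sqr (sc 0%N)).
  apply: size_le_opp; apply: (size_le_mul (size_le_mul (size_le_const be 0) (sc 0%N) (leqnn _)) (_ : (_ <= 2)%N)) => //.
  by rewrite size_polyX.
apply: (size_le_mul (size_le_const al 0) (n := 4)) => //.
apply: size_le_add; last by apply: leqW; exact: sX.
by apply: size_le_add; apply: (size_le_mul (sc 0%N) (n := 3)) => //; exact: sX.
Qed.

End BaseLines.

(** * Degree of a map against heights on a line *)

Lemma dvdp_gcd3 (F : fieldType) (E P0 P1 P2 : {poly F}) :
  (forall c, c %| P0 -> c %| P1 -> c %| P2 -> (size c <= 1)%N) -> P0 != 0 ->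
  P0 %| E * P1 -> P0 %| E * P2 -> P0 %| E.
Proof.
move=> h P00 d1 d2; set G := gcdp P0 (gcdp P1 P2).
have G0 : G != 0 by rewrite gcdp_eq0 negb_and P00.
have : (size G <= 1)%N.
  by apply: h; [exact: dvdp_gcdl| |]; apply: dvdp_trans (dvdp_gcdr _ _) _;
    [exact: dvdp_gcdl|exact: dvdp_gcdr].
rewrite leq_eqVlt ltnS leqn0 size_poly_eq0 (negPf G0) orbF size_poly_eq1 => G1.
have EG : E * G %= E by have := eqp_mull E G1; rewrite mulr1.
rewrite -(eqp_dvdr _ EG) (eqp_dvdr _ (mulp_gcdr _ _ _)) dvdp_gcd dvdp_mull //=.
by rewrite (eqp_dvdr _ (mulp_gcdr _ _ _)) dvdp_gcd d1.
Qed.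

Lemma triple_cross (F : fieldType) (A B C D P0 P1 P2 : F) : B != 0 -> D != 0 ->
  (1 + A / B * (C / D)) * P0 = P1 -> C / D * P0 = P2 ->
  (B * D + A * C) * P0 = B * D * P1 /\ (C * B) * P0 = B * D * P2.
Proof. by move=> B0 D0 <- <-; split; field; rewrite ?B0 ?D0. Qed.

Lemma triple_cross_tofrac (R : idomainType) (A B C D P0 P1 P2 : R) :
  let tf := @FracField.tofrac R in B != 0 -> D != 0 ->
  (1 + tf A / tf B * (tf C / tf D)) * tf P0 = tf P1 ->
  tf C / tf D * tf P0 = tf P2 ->
  (B * D + A * C) * P0 = B * D * P1 /\ (C * B) * P0 = B * D * P2.
Proof.
move=> tf B0 D0 e1 e2.
have [|| h1 h2] := triple_cross _ _ e1 e2; rewrite ?tofrac_eq0 //.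
by split; apply/eqP; rewrite -tofrac_eq !(tofracM, tofracD); apply/eqP.
Qed.

(** With r = A / B and y = C / D, the map (1 + r y, y) is [B D : B D + A C : B C] on the line, and
    this is e times the coprime triple P0, P1, P2, which gives the upper bounds. Conversely y = P2 /
    P0 with C / D in lowest terms, so P0 = w D and P2 = w C, whence ht(y) <= n. *)
Lemma triple_size (F : fieldType) (A B C D P0 P1 P2 : {poly F}) n :
  (forall c, c %| P0 -> c %| P1 -> c %| P2 -> (size c <= 1)%N) -> P0 != 0 ->
  B != 0 -> D != 0 -> coprimep C D ->
  (B * D + A * C) * P0 = B * D * P1 -> (C * B) * P0 = B * D * P2 ->
  (size P0 <= n.+1)%N -> (size P2 <= n.+1)%N ->
  let N := (ht A B + ht C D).+1 in
  [/\ (size P0 <= N)%N, (size P1 <= N)%N, (size P2 <= N)%N & (ht C D <= n)%N].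
Proof.
move=> gcd1 P00 B0 D0 cCD h1 h2 s0 s2 N.
have /dvdpP[e eE] : P0 %| B * D.
  by apply: (dvdp_gcd3 gcd1 P00); [rewrite -h1|rewrite -h2]; exact: dvdp_mull.
have e0 : e != 0.
  by apply: contraNneq (mulf_neq0 B0 D0) => e0; rewrite eE e0 mul0r.
have e1' : B * D + A * C = e * P1.
  by apply: (mulIf P00); rewrite h1 eE mulrAC.
have e2' : C * B = e * P2.
  by apply: (mulIf P00); rewrite h2 eE mulrAC.
have [sA sB] := ht_size A B0; have [sC sD] := ht_size C D0.
have le (E P : {poly F}) : (size E <= N)%N -> E = e * P -> (size P <= N)%N.
  move=> + EP; rewrite EP; have [->|P_0] := eqVneq P 0; first by rewrite size_poly0.
  apply: leq_trans; rewrite size_mul //; move: e0; rewrite -size_poly_gt0.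
  by case: (size e) => // k _; rewrite addSn leq_addl.
split.
- by apply: (le _ _ _ eE); apply: (size_le_mul sB sD).
- by apply: (le _ _ _ e1'); apply: size_le_add; [apply: (size_le_mul sB sD)|apply: (size_le_mul sA sC)].
- by apply: (le _ _ _ e2'); rewrite mulrC; apply: (size_le_mul sB sC).
have h3 : C * P0 = D * P2 by apply: (mulfI B0); rewrite mulrA [B * C]mulrC h2 mulrA.
have /dvdpP[w wE] : D %| P0.
  by rewrite -(Gauss_dvdpr P0 (_ : coprimep D C)) ?h3 ?dvdp_mulr // coprimep_sym.
have w0 : w != 0 by apply: contraNneq P00 => w0; rewrite wE w0 mul0r.
have w2 : P2 = w * C by apply: (mulfI D0); rewrite -h3 wE; ring.
have le2 (E P : {poly F}) : (size P <= n.+1)%N -> P = w * E -> (size E <= n.+1)%N.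
  move=> + PE; rewrite PE; have [->|E0] := eqVneq E 0; first by rewrite size_poly0.
  apply: leq_trans; rewrite size_mul //; move: w0; rewrite -size_poly_gt0.
  by case: (size w) => // k _; rewrite addSn leq_addl.
by rewrite -ltnS -(htP C D0) geq_max (le2 _ _ s2 w2) (le2 _ _ s0 wE).
Qed.

Lemma I3_ind (Q : 'I_3 -> Prop) : Q 0 -> Q 1 -> Q 2 -> forall i, Q i.
Proof.
move=> q0 q1 q2 [[|[|[|//]]] li]; [move: q0|move: q1|move: q2];
  congr Q; exact/val_inj.
Qed.

Section Growth.
Variables (K : closedFieldType) (a b : K) (a0 : a != 0).
Local Notation A0 := {poly K}.
Local Notation L0 := {fraction A0}.
Local Notation L := {fraction {poly L0}}.
Local Notation msize := (mpoly.mmeasure mpoly.mdeg).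
Local Notation tf0 := (@FracField.tofrac A0).
Local Notation tf := (@FracField.tofrac {poly L0}).
Local Notation cst := (@rat_cst K).
Local Notation f m := (ratmap_iter m (kmap (cubic a b))).
Local Notation o m := (orbitF (cst a) (cst b) (rat_r K) (rat_y K) m).
Local Notation al := (tf0 a%:P).
Local Notation be := (tf0 b%:P).

(** A common divisor of positive degree of the restricted triple over K(s) would descend, by Gauss's
    lemma, to a nonconstant common factor of the p i, which minimality excludes. Hence [triple_size]
    applies. *)
Lemma line_bound sw m d p A B C D : min_triple (f m) d p ->
  rep (restr K sw (o m).1) A B -> rep (restr K sw (o m).2) C D ->
  (forall i, size (line_poly sw (p i)) <= (ht A B + ht C D).+1)%N /\
  (ht C D <= d)%N.
Proof.
move=> mp [cAB B0 rE] [cCD D0 yE].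
have := @ratmap_iterE K a b m.
move: (o m) rE yE => [r y] /= rE yE [f1 f2 _ _].
have [[sp p00 e1 e2] _] := mp.
pose P i := line_poly sw (p i).
have P00 : P 0 != 0 by rewrite -size_poly_eq0 size_line_poly size_poly_eq0 bipoly_eq0.
have restrM u v : restr K sw (u * v) = restr K sw u * restr K sw v := rmorphM _ u v.
have E1 : (1 + tf A / tf B * (tf C / tf D)) * tf (P 0) = tf (P 1).
  rewrite -rE -yE -!restr_tofrac -e1 restrM f1.
  by rewrite (rmorph_kmap1 (restr K sw)).
have E2 : tf C / tf D * tf (P 0) = tf (P 2).
  by rewrite -yE -!restr_tofrac -e2 restrM f2.
have [h1 h2] := triple_cross_tofrac B0 D0 E1 E2.
have gcd1 c : c %| P 0 -> c %| P 1 -> c %| P 2 -> (size c <= 1)%N.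
  move=> c0 c1 c2; have cn0 : c != 0 by apply: contraTneq c0 => ->; rewrite dvd0p.
  have [|g [<- gq]] := @gauss_common_factor K 'I_3 (fun i => bipoly sw (p i)) c cn0.
    exact: (I3_ind c0 c1 c2).
  have [h hE] := bipoly_surj sw g; rewrite -hE.
  apply: (leq_trans (size_bipoly sw h)).
  have /choice[k kE] : forall i, exists q, p i = h * q.
    move=> i; have [q qE] := gq i; have [k kE] := bipoly_surj sw q; exists k.
    by apply: (@bipoly_inj _ sw); rewrite bipolyM hE kE qE.
  exact: min_triple_no_factor mp kE.
have sP i : (size (P i) <= d.+1)%N.
  by rewrite size_line_poly; exact: leq_trans (size_bipoly _ _) (sp i).
have [l0 l1 l2 l3] := triple_size gcd1 P00 B0 D0 cCD h1 h2 (sP 0) (sP 2).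
split; last exact: l3.
exact: (@I3_ind (fun i => (size (line_poly sw (p i)) <= (ht A B + ht C D).+1)%N) l0 l1 l2).
Qed.

Local Notation s := (tf0 'X).

Lemma s_neq0 : s != 0.
Proof. by rewrite tofrac_eq0 polyX_eq0. Qed.

Lemma s_neq1 : s != 1.
Proof.
rewrite -tofrac1 tofrac_eq; apply/eqP => /(congr1 (fun p : {poly K} => p.[0])).
by rewrite hornerX hornerC => /esym/eqP; rewrite oner_eq0.
Qed.

Lemma al_neq0 : al != 0.
Proof. by rewrite tofrac_eq0 polyC_eq0. Qed.

Lemma restr_x sw : restr K sw (rat_x K) = if sw then tf s%:P else tf 'X.
Proof. by rewrite (restr_var K sw 0) /bipoly_var /out_var; case: sw; rewrite /= ?map_polyX ?map_polyC. Qed.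

Lemma restr_y sw : restr K sw (rat_y K) = if sw then tf 'X else tf s%:P.
Proof. by rewrite (restr_var K sw 1) /bipoly_var /out_var; case: sw; rewrite /= ?map_polyX ?map_polyC. Qed.

Lemma restr_r sw : restr K sw (rat_r K) =
  if sw then (tf s%:P - 1) / tf 'X else (tf 'X - 1) / tf s%:P.
Proof. by rewrite /rat_r (rmorph_rat_r (restr K sw)) restr_x restr_y; case: sw. Qed.

Local Notation ol sw m := (orbitF (tf al%:P) (tf be%:P) (restr K sw (rat_r K))
  (restr K sw (rat_y K)) m).

Lemma restr_orbit sw m : restr K sw (o m).1 = (ol sw m).1 /\ restr K sw (o m).2 = (ol sw m).2.
Proof.
by have := rmorph_orbitF (restr K sw) (cst a) (cst b) (rat_r K) (rat_y K) m; rewrite !restr_cst.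
Qed.

Lemma restr_orbit_neq0 sw m : (ol sw m).1 != 0.
Proof.
rewrite -(restr_orbit sw m).1 fmorph_eq0.
have := @ratmap_iterE K a b m; case: (o m) => r y [_ _ r0 _]; exact: r0.
Qed.

Lemma line_height sw m : exists A B C D,
  [/\ rep (restr K sw (o m).1) A B, rep (restr K sw (o m).2) C D &
    (ht A B + ht C D <= 2 + 4 * (2 * m + 1) ^ 2)%N].
Proof.
have [-> ->] := restr_orbit sw m; have on0 := restr_orbit_neq0 sw.
move: on0; rewrite restr_r restr_y; case: sw => on0.
  have [rr hr] := rep_vertical_r s_neq1; have [ry hy] := rep_vertical_y L0.
  have [P [tE sP]] := tF_vertical al be s.
  have X0 : 'X ^+ 2 != 0 :> {poly L0} by rewrite expf_neq0 // polyX_eq0.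
  have sX : (size ('X ^+ 2 : {poly L0}) <= 5)%N by rewrite size_polyXn.
  exact: (orbit_ht al_neq0 on0 rr ry hr hy tE X0 sP sX).
have [rr hr _] := rep_horizontal_r s_neq0; have [ry hy] := rep_horizontal_y s.
have [P [tE sP]] := tF_horizontal al be s_neq0.
have hr1 : (ht (s^-1 *: ('X - 1)) 1 <= 1)%N by rewrite hr.
have hy1 : (ht s%:P 1 <= 1)%N by rewrite hy.
have tE1 : tF (tf al%:P) (tf be%:P) ((tf 'X - 1) / tf s%:P) (tf s%:P) = tf P / tf 1.
  by rewrite tE tofrac1 divr1.
have sP5 : (size P <= 5)%N by rewrite sP.
have s15 : (size (1%R : {poly L0}) <= 5)%N by rewrite size_poly1.
exact: (orbit_ht al_neq0 on0 rr ry hr1 hy1 tE1 (oner_neq0 _) sP5 s15).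
Qed.

(** The two lines bound the degree of each p i in x and in y, hence its total degree; minimality of
    d is then used against the same triple p with this new bound. *)
Lemma degree_upper m d p : min_triple (f m) d p -> (d <= 2 * (3 + 4 * (2 * m + 1) ^ 2))%N.
Proof.
move=> mp; have [[sp p0 e1 e2] dmin] := mp.
apply: (dmin _ p); split=> // i.
have bnd sw : (size (bipoly sw (p i)) <= 3 + 4 * (2 * m + 1) ^ 2)%N.
  have [A [B [C [D [rA rC h]]]]] := line_height sw m.
  have [h1 _] := line_bound mp rA rC.
  by rewrite -size_line_poly; apply: leq_trans (h1 i) _; rewrite (addSn 2) ltnS.
rewrite mpoly.msizeE; apply/bigmax_leqP_seq => m' m'p _.
have := leq_trans (mnm_lt_size false m'p) (bnd false).
have := leq_trans (mnm_lt_size true m'p) (bnd true).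
by rewrite mdeg2 /out_var; move: (m' 0) (m' 1) (3 + _)%N => u v w; lia.
Qed.

(** On y = const the second coordinate has height m^2, and the last bound of [line_bound] compares
    it with d. *)
Lemma degree_lower m d p : min_triple (f m) d p -> (m ^ 2 <= d)%N.
Proof.
move=> mp; have [A [B [_ [_ [rA _ _]]]]] := line_height false m.
have [rr hr sr] := rep_horizontal_r s_neq0; have [ry hy] := rep_horizontal_y s.
have [P [tE sP]] := tF_horizontal al be s_neq0.
have on0 := restr_orbit_neq0 false; have [_ yE] := restr_orbit false m.
rewrite restr_r restr_y in on0 yE.
have [|| C [D [rC hC]]] := orbit_ht_exact al_neq0 on0 rr ry hr hy _ _ tE sP m.
- by rewrite sr size_poly1.
- by rewrite [X in (_ <= X)%N]size_poly1; exact: size_polyC_leq1.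
rewrite -yE in rC; rewrite -hC.
exact: (line_bound mp rA rC).2.
Qed.

End Growth.

Local Open Scope classical_set_scope.
Local Open Scope ring_scope.

Lemma kmap_quadratic_growth (R : realType) (a b : R[i]) : a != 0 ->
  quadratic_degree_growth (kmap (cubic a b)).
Proof.
move=> a0.
have /choice[deg degP] : forall m, exists d, exists p,
    min_triple (ratmap_iter m (kmap (cubic a b))) d p.
  by move=> m; exact: min_triple_exists.
exists deg; split; first by move=> m; have [p mp] := degP m; exact: min_triple_degree mp.
(* The upper bound 2 (3 + 4 (2 m + 1)^2) equals 78 at m = 1, and is at most 78 m^2 for every m >=
   1. *)
exists 1, 78%:R; rewrite ltr01 ler1n; split=> //.
near=> m; have [p mp] := degP m.
have lo := degree_lower a0 mp; have up := degree_upper a0 mp.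
rewrite mul1r -natrX -natrM !ler_nat lo /=.
have m1 : (0 < m)%N by near: m; exact: nbhs_infty_gt.
by apply: leq_trans up _; nia.
Unshelve. all: by end_near.
Qed.

Lemma near_differentiable (K : numFieldType) (V W : normedModType K)
    (f g : V -> W) (x : V) :
  (\forall y \near x, f y = g y) -> differentiable f x -> differentiable g x.
Proof.
move=> fg df; have [dfc dfx] := (diff_locallyP x f).1 df.
have gx : g x = f x by rewrite (nbhs_singleton fg).
have fg0 : \forall h \near (0 : V), f (h + x) = g (h + x).
  by have := fg; rewrite (near_shift 0) /= subr0.
have H : g \o shift x = cst (g x) + 'd f x +o_ 0 id.
  apply/eqaddoP => e e0.
  have := (eqaddoP _ _ _ _).1 dfx e e0.
  move=> H; near=> h.
  have -> : (g \o shift x - (cst (g x) + 'd f x)) h =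
            (f \o shift x - (cst (f x) + 'd f x)) h.
    rewrite !fctE /= gx; congr (_ - _); apply/esym; near: h; exact: fg0.
  by near: h.
have E := diff_unique dfc H.
apply/diff_locallyP; rewrite E; split => //.
Unshelve. all: by end_near. Qed.

(** * Gluing complex manifolds *)

Section ManifoldLemmas.
Variables (C : numClosedFieldType) (E G : normedModType C).
Variables (X : complexManifold E) (Y : complexManifold G).

Lemma chart_inv_cont (Z : complexManifold E) (c : chart E Z) (z : Z) :
  atlas c -> cdom c z -> {for cmap c z, continuous (cinv c)}.
Proof. by move=> ac cz; exact: (chart_inv_cts (atlas_chart ac) cz). Qed.

Lemma chart_inv_cvg (Z : complexManifold E) (c : chart E Z) (z : Z) :
  atlas c -> cdom c z -> cinv c @ cmap c z --> z.
Proof.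
move=> ac cz.
by rewrite -[X in _ --> X](chart_mapK (atlas_chart ac) cz); exact: chart_inv_cont.
Qed.

Lemma near_cdom (Z : complexManifold E) (c : chart E Z) (z : Z) :
  atlas c -> cdom c z -> \forall y \near z, cdom c y.
Proof.
move=> ac cz; apply: open_nbhs_nbhs; split => //.
exact: chart_dom_open (atlas_chart ac).
Qed.

End ManifoldLemmas.

Section ManifoldCriteria.
Variables (C : numClosedFieldType) (E G : normedModType C).
Variables (X : complexManifold E) (Y : complexManifold G).

(** One pair of charts is enough, since the transitions to any other pair are differentiable. *)
Lemma holomorphic_at_chart (f : X -> Y) c d x :
  atlas c -> atlas d -> cdom c x -> cdom d (f x) -> {for x, continuous f} ->
  differentiable (cmap d \o f \o cinv c) (cmap c x) -> holomorphic_at f x.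
Proof.
move=> ac ad cx dfx fc df; split => // c' d' ac' ad' cx' dfx'.
have h1 := atlas_transition ac' ac cx' cx.
have h2 := atlas_transition ad ad' dfx dfx'.
apply: (@near_differentiable _ _ _
   ((cmap d' \o cinv d) \o (cmap d \o f \o cinv c) \o (cmap c \o cinv c'))).
  have cc := chart_inv_cvg ac' cx'.
  have n1 : \forall q \near cmap c' x, cdom c (cinv c' q).
    exact: (cc _ (near_cdom ac cx)).
  have n2 : \forall q \near cmap c' x, cdom d (f (cinv c' q)).
    exact: (cc _ (fc _ (near_cdom ad dfx))).
  near=> q => /=.
  rewrite (chart_mapK (atlas_chart ac)); last by near: q.
  by rewrite (chart_mapK (atlas_chart ad)) //; near: q.
have cK : cinv c' (cmap c' x) = x by rewrite (chart_mapK (atlas_chart ac')).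
have cK' : cinv c (cmap c x) = x by rewrite (chart_mapK (atlas_chart ac)).
apply: differentiable_comp => //=.
rewrite cK; apply: differentiable_comp => //=.
by rewrite cK'.
Unshelve. all: by end_near. Qed.

Lemma holomorphic_fun_at_chart (f : X -> C) c x : atlas c -> cdom c x ->
  differentiable (f \o cinv c) (cmap c x) -> holomorphic_fun_at f x.
Proof.
move=> ac cx df c' ac' cx'.
have h1 := atlas_transition ac' ac cx' cx.
apply: (@near_differentiable _ _ _ ((f \o cinv c) \o (cmap c \o cinv c'))).
  have cc := chart_inv_cvg ac' cx'.
  have n1 : \forall q \near cmap c' x, cdom c (cinv c' q).
    exact: (cc _ (near_cdom ac cx)).
  near=> q => /=.
  by rewrite (chart_mapK (atlas_chart ac)) //; near: q.
apply: differentiable_comp => //=.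
by rewrite (chart_mapK (atlas_chart ac')).
Unshelve. all: by end_near. Qed.

End ManifoldCriteria.

(** The points form a bare set, parametrized by open sets of E; the topology comes afterwards.
    [gl_coord] i inverts [gl_par] i on its domain only, and the second half of [gl_link] makes
    overlaps open. *)
Record gluing (C : numClosedFieldType) (E : normedModType C) := Gluing {
  gl_pts : Type;
  gl_ix : Type;
  gl_dom : gl_ix -> set E;
  gl_par : gl_ix -> E -> gl_pts;
  gl_coord : gl_ix -> gl_pts -> E;
  gl_domP : forall i, open (gl_dom i);
  gl_coordK : forall i p, gl_dom i p -> gl_coord i (gl_par i p) = p;
  gl_cover : forall z, exists i p, gl_dom i p /\ gl_par i p = z;
  gl_link : forall i j p, gl_dom i p -> (gl_par j @` gl_dom j) (gl_par i p) ->
    differentiable (gl_coord j \o gl_par i) p /\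
    \forall q \near p, (gl_par j @` gl_dom j) (gl_par i q) }.

Section Gluing.
Variables (C : numClosedFieldType) (E : normedModType C) (L : gluing E).
Notation T := (gl_pts L).
Notation D := (@gl_dom C E L).
Notation psi := (@gl_par C E L).
Notation phi := (@gl_coord C E L).

Definition glue_type : Type := gl_pts L.

HB.instance Definition _ := gen_eqMixin glue_type.
HB.instance Definition _ := gen_choiceMixin glue_type.

(** The final topology of the parametrizations. *)
Definition glue_open (U : set glue_type) := forall i, open (D i `&` psi i @^-1` U).

Let glue_openT : glue_open setT.
Proof. by move=> i; rewrite preimage_setT setIT; exact: gl_domP. Qed.

Let glue_openI : setI_closed glue_open.
Proof.
move=> A B oA oB i; rewrite preimage_setI setIIr; exact: openI.
Qed.

Let glue_open_bigU (J : Type) (f : J -> set glue_type) :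
  (forall j, glue_open (f j)) -> glue_open (\bigcup_j f j).
Proof.
move=> of_ i; rewrite preimage_bigcup setI_bigcupr.
by apply: bigcup_open => j _; exact: of_.
Qed.

HB.instance Definition _ :=
  isOpenTopological.Build glue_type glue_openT glue_openI glue_open_bigU.

Lemma glue_openE (U : set glue_type) :
  open U = forall i, open (D i `&` psi i @^-1` U).
Proof. by []. Qed.

Lemma glue_par_cts i p : D i p -> {for p, continuous (psi i : E -> glue_type)}.
Proof.
move=> Dp U; rewrite nbhsE => -[V [oV Vp] VU].
rewrite /= nbhs_simpl nbhsE; exists (D i `&` psi i @^-1` V).
  by split => //; exact: oV.
by move=> q [_]; exact: VU.
Qed.

Lemma glue_par_open i (V : set E) : open V -> V `<=` D i ->
  open (psi i @` V : set glue_type).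
Proof.
move=> oV VD; rewrite glue_openE => j; rewrite openE => p [Dp [q Vq qp]].
have [dp np] := @gl_link _ _ L j i p Dp (ex_intro2 _ _ q (VD _ Vq) qp).
have pq : (phi i \o psi j) p = q by rewrite /= -qp gl_coordK //; exact: VD.
have cp := differentiable_continuous dp.
rewrite /interior /=; near=> p'; split => /=.
  near: p'; apply: open_nbhs_nbhs; split => //; exact: gl_domP.
have : (psi i @` D i) (psi j p') by near: p'.
case=> q' Dq' q'p'; exists q' => //.
have <- : (phi i \o psi j) p' = q' by rewrite /= -q'p' gl_coordK.
near: p'; apply: cp; rewrite pq; exact: open_nbhs_nbhs.
Unshelve. all: by end_near. Qed.

Definition glue_chart i : chart E glue_type :=
  Chart (psi i @` D i) (phi i) (psi i).

Definition glue_atlas : set (chart E glue_type) := range glue_chart.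

Lemma glue_coord_cts i (z : glue_type) : (psi i @` D i) z ->
  {for z, continuous (phi i : glue_type -> E)}.
Proof.
move=> [p Dp <-] U; rewrite gl_coordK // nbhsE => -[V [oV Vp] VU].
rewrite /= nbhs_simpl nbhsE; exists (psi i @` (D i `&` V)).
  split; last by exists p.
  by apply: glue_par_open => [|q []//]; apply: openI => //; exact: gl_domP.
by move=> _ [q [Dq Vq] <-]; rewrite /= gl_coordK //; exact: VU.
Qed.

Lemma glue_atlas_chart c : glue_atlas c -> is_chart c.
Proof.
move=> [i _ <-]; split => /=.
- by apply: glue_par_open => //; exact: gl_domP.
- suff -> : phi i @` (psi i @` D i) = D i by exact: gl_domP.
  apply/seteqP; split => [_ [_ [p Dp <-] <-]|p Dp].
    by rewrite gl_coordK.
  by exists (psi i p); [exists p|rewrite gl_coordK].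
- by move=> _ [p Dp <-]; rewrite gl_coordK.
- by move=> z; exact: glue_coord_cts.
- by move=> _ [p Dp <-]; rewrite gl_coordK //; exact: glue_par_cts.
Qed.

Lemma glue_atlas_cover z : exists2 c, glue_atlas c & cdom c z.
Proof.
by have [i [p [Dp pz]]] := gl_cover z; exists (glue_chart i); [exists i|exists p].
Qed.

Lemma glue_atlas_transition c d z : glue_atlas c -> glue_atlas d -> cdom c z ->
  cdom d z -> differentiable (cmap d \o cinv c) (cmap c z).
Proof.
move=> [i _ <-] [j _ <-] [p Dp <-] /= jz.
by rewrite gl_coordK //; have [] := @gl_link _ _ L i j p Dp jz.
Qed.

Definition glue_manifold : complexManifold E :=
  ComplexManifold glue_atlas_chart glue_atlas_cover glue_atlas_transition.

Lemma glue_atlasP i : @atlas _ _ glue_manifold (glue_chart i).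
Proof. by exists i. Qed.

End Gluing.

Lemma near_neq0 (C : numClosedFieldType) (T : topologicalType) (f : T -> C) x :
  {for x, continuous f} -> f x != 0 -> \forall y \near x, f y != 0.
Proof.
move=> cf fx; apply: (cf [set c | c != 0]).
apply: open_nbhs_nbhs; split => //.
have -> : [set c : C | c != 0] = ~` [set 0].
  by apply/seteqP; split => c /= /eqP.
apply: closed_openC; apply: accessible_closed_set1; apply: hausdorff_accessible.
exact: norm_hausdorff.
Qed.

Section LambdaDiff.
Variables (C : numClosedFieldType) (V : normedModType C).
Implicit Types (f g : V -> C) (x : V).

Lemma diff_addf f g x : differentiable f x -> differentiable g x ->
  differentiable (fun p => f p + g p) x.
Proof. exact: differentiableD. Qed.

Lemma diff_oppf f x : differentiable f x -> differentiable (fun p => - f p) x.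
Proof. exact: differentiableN. Qed.

Lemma diff_mulf f g x : differentiable f x -> differentiable g x ->
  differentiable (fun p => f p * g p) x.
Proof. exact: differentiableM. Qed.

Lemma diff_invf f x : differentiable f x -> f x != 0 ->
  differentiable (fun p => (f p)^-1) x.
Proof. exact: differentiableV. Qed.

Lemma diff_expf f n x : differentiable f x -> differentiable (fun p => f p ^+ n) x.
Proof.
move=> df; elim: n => [|n ih].
  by under eq_fun do rewrite expr0; exact: differentiable_cst.
by under eq_fun do rewrite exprS; exact: diff_mulf.
Qed.

Lemma diff_constf (c : C) x : differentiable (fun=> c) x.
Proof. exact: differentiable_cst. Qed.

Lemma near_diff_neq0 f x : differentiable f x -> f x != 0 ->
  \forall y \near x, f y != 0.
Proof. by move=> /differentiable_continuous; exact: near_neq0. Qed.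

End LambdaDiff.

Ltac diff1 :=
  first
  [ exact: differentiable_fst | exact: differentiable_snd
  | exact: diff_constf
  | assumption
  | apply: diff_addf | apply: diff_oppf | apply: diff_mulf | apply: diff_invf
  | apply: diff_expf | apply: differentiable_pair ].
Ltac diffs := repeat diff1.

(** * The surface *)

Section Surface.
Variables (C : numClosedFieldType) (a b : C).
Hypothesis a0 : a != 0.

(** The component of multiplicity 4 in the coordinate z = r / y^2. The arms meet it at z = 0 and z =
    a, and its point z = oo is [N4]. *)
Definition a4pt := {z : C | (z != 0) && (z != a)}.

(* The points of the surface: [Aff] is the affine (r, y)-plane; [PB], [Q4],
   [Q3 e], [Q2 e], [Q1 e] (with [N4] in [Q4] and [N21 e] in [Q2 e]) are the
   components of the fibre t = oo, of multiplicities 2, 4, 3, 2, 1; [PS e] are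
   two sections. *)
Inductive pts :=
  | Aff of C & C
  | PB of C
  | N4
  | Q4 of a4pt
  | Q3 of bool & C
  | Q2 of bool & C
  | N21 of bool
  | Q1 of bool & C
  | PS of bool & C.

Variant cix := c0 | cB | c4 | c43 | c32 | c21 | c1 | cS.

(** Each removed point is one that the surface blows up: z = a, where the second arm is attached, in
    [c4] and [c43]; x = 0 on [Q1], where the section passes, in [c21]. *)
Definition cdomain (k : cix) : set (C * C) :=
  match k with
  | c4 => [set p | p <> (a^-1, 0)]
  | c43 => [set p | p <> (a, 0)]
  | c21 => [set p | p <> (0, -1)]
  | _ => setT
  end.

(** At z = 0 and z = a the value [N4] is a default, which is not met on the domains of the
    charts. *)
Definition mkP4 (z : C) : pts := if insub z is Some s then Q4 s else N4.

Definition fpol (y : C) : C := a * y ^+ 2 + a * y + b.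

(** The inverse [ccoord] shows the coordinates as monomials in r, y and x = r y + 1. The parameter
    of [Q1] is x, and that of [PS] is x y. *)
Definition cpar (k : cix) (p : C * C) : pts :=
  match k with
  | c0 => Aff p.1 p.2
  | cB => if p.1 == 0 then PB p.2 else Aff p.1^-1 p.2
  | c4 => if p.2 == 0 then if p.1 == 0 then N4 else mkP4 p.1^-1
          else if p.1 == 0 then PB p.2^-1 else Aff (p.1 * p.2 ^+ 2)^-1 p.2^-1
  | c43 => if p.1 == 0 then Q3 false p.2
           else if p.2 == 0 then mkP4 p.1
           else Aff (p.1 * p.2 ^+ 2)^-1 (p.1 * p.2)^-1
  | c32 => if p.2 == 0 then Q2 false p.1
           else if p.1 == 0 then Q3 false p.2^-1
           else Aff p.1^-1 (p.1 * p.2)^-1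
  | c21 => if p.1 == 0 then
             if p.2 == 0 then N21 false else Q1 false (p.2^-1 + 1)
           else if p.2 == 0 then Q2 false p.1^-1 else Aff p.1 (p.1 * p.2)^-1
  | c1 => if p.2 == 0 then Q1 false p.1
          else if p.1 == 0 then PS false p.2^-1
          else Aff ((p.1 - 1) * p.1 * p.2) (p.1 * p.2)^-1
  | cS => if p.2 == 0 then PS false p.1
          else Aff ((p.1 * p.2 - 1) * p.2) p.2^-1
  end.

Definition ccoord (k : cix) (z : pts) : C * C :=
  match k, z with
  | c0, Aff r y => (r, y)
  | cB, Aff r y => (r^-1, y)
  | cB, PB y => (0, y)
  | c4, Aff r y => (y ^+ 2 / r, y^-1)
  | c4, PB y => (0, y^-1)
  | c4, Q4 s => ((val s)^-1, 0)
  | c43, Aff r y => (r / y ^+ 2, y / r)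
  | c43, Q4 s => (val s, 0)
  | c43, Q3 _ l => (0, l)
  | c32, Aff r y => (r^-1, r / y)
  | c32, Q3 _ l => (0, l^-1)
  | c32, Q2 _ u => (u, 0)
  | c21, Aff r y => (r, (r * y)^-1)
  | c21, Q2 _ u => (u^-1, 0)
  | c21, Q1 _ w => (0, (w - 1)^-1)
  | c1, Aff r y => (r * y + 1, ((r * y + 1) * y)^-1)
  | c1, Q1 _ w => (w, 0)
  | c1, PS _ v => (0, v^-1)
  | cS, Aff r y => ((r * y + 1) * y, y^-1)
  | cS, PS _ v => (v, 0)
  | _, _ => (0, 0)
  end.

(** As y tends to oo, ([fpol] y - r) / y^2 tends to a - z, whence the action on [Q4]. The second arm
    and section are the images of the first ones by j, hence the exchange of labels. *)
Definition jpt (z : pts) : pts :=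
  match z with
  | Aff r y => Aff (fpol y - r) y
  | PB y => PB y
  | N4 => N4
  | Q4 s => mkP4 (a - val s)
  | Q3 e l => Q3 (~~ e) l
  | Q2 e u => Q2 (~~ e) u
  | N21 e => N21 (~~ e)
  | Q1 e w => Q1 (~~ e) w
  | PS e v => PS (~~ e) v
  end.

Lemma mkP4_val (s : a4pt) : mkP4 (val s) = Q4 s.
Proof. by rewrite /mkP4 valK. Qed.

Lemma mkP4P z : z != 0 -> z != a -> exists2 s : a4pt, mkP4 z = Q4 s & val s = z.
Proof.
move=> z0 za; have zP : (z != 0) && (z != a) by rewrite z0.
by exists (Sub z zP); rewrite ?SubK // -mkP4_val SubK.
Qed.

Lemma a4pt_neq0 (s : a4pt) : val s != 0.
Proof. by case/andP: (valP s). Qed.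

Lemma a4pt_neqa (s : a4pt) : val s != a.
Proof. by case/andP: (valP s). Qed.

Lemma jptK : involutive jpt.
Proof.
case=> //= [r y|s|e ?|e ?|e|e ?|e ?]; rewrite ?negbK //; first by congr Aff; ring.
have s1 : a - val s != 0 by rewrite subr_eq0 eq_sym a4pt_neqa.
have s2 : a - val s != a.
  by rewrite -subr_eq0 addrC addKr oppr_eq0 a4pt_neq0.
have [s' -> s'E] := mkP4P s1 s2; rewrite /= s'E.
by rewrite opprB addrC subrK mkP4_val.
Qed.

Definition dom (i : bool * cix) : set (C * C) := cdomain i.2.

Definition jif (e : bool) (z : pts) : pts := if e then jpt z else z.

Definition par (i : bool * cix) (p : C * C) : pts := jif i.1 (cpar i.2 p).

Definition zcoord (i : bool * cix) (z : pts) : C * C := ccoord i.2 (jif i.1 z).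

Lemma jifK e : involutive (jif e).
Proof. by case: e => // z; exact: jptK. Qed.

(** One distinguished chart through each point, where the point has the coordinates [hubc]. Any two
    charts at a point are compared by passing through it. *)
Definition hub (z : pts) : bool * cix :=
  match z with
  | Aff _ _ => (false, c0)
  | PB _ => (false, cB)
  | N4 | Q4 _ => (false, c4)
  | Q3 e _ => (e, c43)
  | Q2 e _ => (e, c32)
  | N21 e => (e, c21)
  | Q1 e _ => (e, c1)
  | PS e _ => (e, cS)
  end.

Definition hubc (z : pts) : C * C :=
  match z with
  | Aff r y => (r, y)
  | PB y => (0, y)
  | N4 => (0, 0)
  | Q4 s => ((val s)^-1, 0)
  | Q3 e l => (0, l)
  | Q2 e u => (u, 0)
  | N21 e => (0, 0)
  | Q1 e w => (w, 0)
  | PS e v => (v, 0)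
  end.

Lemma hub_dom z : dom (hub z) (hubc z).
Proof.
case: z => //= [|s|e l|e]; rewrite /dom /=.
- by case=> /esym/eqP; rewrite invr_eq0 (negPf a0).
- by case=> /invr_inj/eqP; rewrite (negPf (a4pt_neqa s)).
- by case=> /esym/eqP; rewrite (negPf a0).
- by case=> /eqP; rewrite eq_sym oppr_eq0 oner_eq0.
Qed.

Lemma hub_par z : par (hub z) (hubc z) = z.
Proof.
case: z => //= [y||s|[] l|[] u|[]|[] w|[] v] ; rewrite /par /= ?eqxx //=.
by rewrite invr_eq0 (negPf (a4pt_neq0 s)) invrK mkP4_val.
Qed.

Lemma cdomain_open k : open (cdomain k).
Proof.
have op (p : C * C) : open [set q | q <> p].
  have -> : [set q | q <> p] = ~` [set p] by [].
  apply: closed_openC; apply: accessible_closed_set1; apply: hausdorff_accessible.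
  exact: norm_hausdorff.
by case: k => //=; exact: openT.
Qed.

Lemma dom_open i : open (dom i).
Proof. exact: cdomain_open. Qed.

Lemma ccoordK k p : cdomain k p -> ccoord k (cpar k p) = p.
Proof.
case: p => u v.
have P4K z : z != 0 -> z != a -> [/\ ccoord c4 (mkP4 z) = (z^-1, 0) &
    ccoord c43 (mkP4 z) = (z, 0)].
  by move=> z0 za; have [s -> <-] := mkP4P z0 za.
case: k => //=; do ?[case: (eqVneq u 0) => [->|u0] /=];
  do ?[case: (eqVneq v 0) => [->|v0] /=]; move=> Dp; rewrite ?invrK ?addrK ?invrK //.
all: try by congr pair; field; rewrite ?u0 ?v0.
- have uA : u^-1 != a by apply/eqP => ua; apply: Dp; rewrite -ua invrK.
  by have [+ _] := P4K _ (invr_neq0 u0) uA; rewrite invrK.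
- have uA : u != a by apply/eqP => ua; apply: Dp; rewrite -ua.
  by have [_] := P4K _ u0 uA.
Qed.

Lemma zcoordK i p : dom i p -> zcoord i (par i p) = p.
Proof. by case: i => e k; rewrite /zcoord /par jifK; exact: ccoordK. Qed.

(* Chart i is smoothly compatible with chart j at the point with coordinates p
   in chart i and q in chart j. *)
Definition link (i j : bool * cix) (p q : C * C) : Prop :=
  exists g : C * C -> C * C, [/\ g p = q, differentiable g p, dom j q &
    \forall p' \near p, par j (g p') = par i p'].

Lemma link_refl i p : dom i p -> link i i p p.
Proof.
move=> Dp; exists id; split => //; last by near=> p'.
Unshelve. all: by end_near. Qed.

Lemma link_trans j i k p q r : link i j p q -> link j k q r -> link i k p r.
Proof.
move=> [g [gp dg Dq ng]] [h [hq dh Dr nh]]; exists (h \o g); split => //.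
- by rewrite /= gp.
- by apply: differentiable_comp => //; rewrite gp.
- have cg := differentiable_continuous dg.
  have nh2 : \forall p' \near p, par k (h (g p')) = par j (g p').
    by apply: (cg [set q' | par k (h q') = par j q']); rewrite gp.
  near=> p' => /=; rewrite -(_ : par j (g p') = par i p'); last by near: p'.
  by near: p'.
Unshelve. all: by end_near. Qed.

Lemma link_jpt e e' k k' p q :
  link (e, k) (e', k') p q -> link (~~ e, k) (~~ e', k') p q.
Proof.
have jifN d z : jif (~~ d) z = jpt (jif d z) by case: d => //=; rewrite jptK.
move=> [g [gp dg Dq ng]]; exists g; split => //.
near=> p'; rewrite /par /= !jifN; congr jpt.
suff : par (e', k') (g p') = par (e, k) p' by [].
by near: p'.
Unshelve. all: by end_near. Qed.

Lemma mk_link (g : C * C -> C * C) e k e' k' p q : g p = q -> differentiable g p ->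
  cdomain k' q -> (\forall p' \near p, jif e' (cpar k' (g p')) = jif e (cpar k p')) ->
  link (e, k) (e', k') p q.
Proof. by move=> gp dg Dq ng; exists g; split. Qed.

Lemma near_fst_neq0 (p : C * C) : p.1 != 0 -> \forall q \near p, q.1 != 0.
Proof. exact/near_diff_neq0/differentiable_fst. Qed.

Lemma near_snd_neq0 (p : C * C) : p.2 != 0 -> \forall q \near p, q.2 != 0.
Proof. exact/near_diff_neq0/differentiable_snd. Qed.

Lemma link_hub_hub z : link (hub z) (hub z) (hubc z) (hubc z).
Proof. exact/link_refl/hub_dom. Qed.

Lemma link_c4_cB y : y != 0 -> link (false, c4) (false, cB) (0, y^-1) (0, y).
Proof.
move=> y0; apply: (@mk_link (fun p => (p.1 * p.2 ^+ 2, p.2^-1))) => //=.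
- by rewrite mul0r invrK.
- by diffs; rewrite /= invr_eq0.
have n : \forall q \near ((0 : C, y^-1) : C * C), q.2 != 0.
  by apply: near_snd_neq0; rewrite invr_eq0.
near=> p; have p2 : p.2 != 0 by near: p.
by rewrite (negPf p2) mulf_eq0 (negPf (expf_neq0 _ p2)) orbF.
Unshelve. all: by end_near. Qed.

End Surface.

(** * Transitions between the charts *)

Section Links.
Variables (C : numClosedFieldType) (a b : C).
Hypothesis a0 : a != 0.

Notation link := (link a b).
Notation cpar := (@cpar C a).
Notation par := (@par C a b).
Notation Aff := (@Aff C a).

Ltac nz h := rewrite ?(negPf h) ?h /=.

Lemma jptM z (s : z != 0) (sa : z != a) : jpt b (mkP4 a z) = mkP4 a (a - z).
Proof. by have [s' -> <-] := mkP4P s sa. Qed.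

Definition affinv (k : cix) (p : C * C) : C * C :=
  match k with
  | c0 => p
  | cB => (p.1^-1, p.2)
  | c4 => ((p.1 * p.2 ^+ 2)^-1, p.2^-1)
  | c43 => ((p.1 * p.2 ^+ 2)^-1, (p.1 * p.2)^-1)
  | c32 => (p.1^-1, (p.1 * p.2)^-1)
  | c21 => (p.1, (p.1 * p.2)^-1)
  | c1 => ((p.1 - 1) * p.1 * p.2, (p.1 * p.2)^-1)
  | cS => ((p.1 * p.2 - 1) * p.2, p.2^-1)
  end.

Definition affcond (k : cix) (p : C * C) : bool :=
  match k with
  | c0 => true
  | cB => p.1 != 0
  | cS => p.2 != 0
  | _ => (p.1 != 0) && (p.2 != 0)
  end.

Lemma mkP4_Aff z r y : mkP4 a z <> Aff r y.
Proof. by rewrite /mkP4; case: insub. Qed.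

Lemma cpar_Aff k p : affcond k p -> cpar k p = Aff (affinv k p).1 (affinv k p).2.
Proof.
by case: k => //=; do ?[case/andP=> h1 h2; nz h1; nz h2] => // h; nz h.
Qed.

Lemma Aff_affcond k p r y : cpar k p = Aff r y -> affcond k p.
Proof.
case: k => //=; case: ifP => h1; rewrite ?h1 ?(negbT h1) //=;
  case: ifP => h2 //=; rewrite ?h2 //= => /mkP4_Aff //.
Qed.

Lemma near_affcond k p : affcond k p -> \forall q \near p, affcond k q.
Proof.
case: k => /=; try (by move=> _; near=> q); try exact: near_fst_neq0;
  try exact: near_snd_neq0;
  by case/andP=> /near_fst_neq0 h1 /near_snd_neq0 h2; near=> q;
  apply/andP; split; near: q.
Unshelve. all: by end_near. Qed.

Lemma diff_affinv k p : affcond k p -> differentiable (affinv k) p.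
Proof.
case: k => /=; try (move=> _; exact: (differentiable_pair (differentiable_fst _) (differentiable_snd _)));
 try (case/andP); move=> *; diffs; rewrite /= ?mulf_neq0 ?expf_neq0 //.
Qed.

Definition affcoord (k : cix) (q : C * C) : C * C := ccoord k (Aff q.1 q.2).

Definition coordcond (k : cix) (q : C * C) : bool :=
  match k with
  | c0 => true
  | cB => q.1 != 0
  | cS => q.2 != 0
  | c1 => (q.2 != 0) && (q.1 * q.2 + 1 != 0)
  | _ => (q.1 != 0) && (q.2 != 0)
  end.

Lemma affcoord_cond k p : affcond k p -> coordcond k (affinv k p).
Proof.
case: k => //=; try (case/andP => h1 h2); move=> *;
  rewrite ?mulf_neq0 ?invr_neq0 ?mulf_neq0 ?expf_neq0 //=.
  by rewrite h1.
by rewrite (_ : _ + 1 = p.1) //; field; rewrite h1 h2.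
Qed.

Lemma affcoordK k q : coordcond k q -> cpar k (affcoord k q) = Aff q.1 q.2.
Proof.
case: q => r y; case: k => //=;
  try (by move=> h; nz h; rewrite ?invr_eq0 ?(negPf h); congr Aff; field; rewrite h);
  case/andP => h1 h2;
  rewrite ?mulf_eq0 ?invr_eq0 ?mulf_eq0 ?expf_eq0 ?(negPf h1) ?(negPf h2) /=
    ?(negPf h1) ?(negPf h2) /=;
  by congr Aff; field; rewrite ?h1 ?h2.
Qed.

Lemma near_coordcond k p : coordcond k p -> \forall q \near p, coordcond k q.
Proof.
have dd q : differentiable (fun p : C * C => p.1 * p.2 + 1) q by diffs.
case: k => /=; try (by move=> _; near=> q); try exact: near_fst_neq0;
  try exact: near_snd_neq0;
  try (by case/andP=> /near_fst_neq0 h1 /near_snd_neq0 h2; near=> q;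
  apply/andP; split; near: q).
by case/andP=> /near_snd_neq0 h1 /(near_diff_neq0 (dd p)) h2; near=> q;
  apply/andP; split; near: q.
Unshelve. all: by end_near. Qed.

Lemma diff_affcoord k p : coordcond k p -> differentiable (affcoord k) p.
Proof.
rewrite /affcoord; case: k => /=; try (case/andP); move=> *; diffs; rewrite /= ?mulf_neq0 ?expf_neq0 //.
Qed.

(** On the part that meets the affine plane, each chart is an explicit rational change of
    coordinates, treated uniformly. The lemmas that follow handle the curves at infinity common to
    two neighbouring charts. *)
Lemma link_c0 k p : cdomain a k p -> affcond k p ->
  link (false, k) (false, c0) p (affinv k p) /\
  link (false, c0) (false, k) (affinv k p) p.
Proof.
move=> Dp cp; split.
  apply: (@mk_link _ _ _ (affinv k)) => //; first exact: diff_affinv.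
  have n := near_affcond cp.
  by near=> p' => /=; rewrite cpar_Aff //; near: p'.
have cc := affcoord_cond cp.
apply: (@mk_link _ _ _ (affcoord k)) => //.
- by rewrite /affcoord -cpar_Aff // ccoordK.
- exact: diff_affcoord.
have n := near_coordcond cc.
by near=> p' => /=; rewrite affcoordK //; near: p'.
Unshelve. all: by end_near. Qed.

Lemma link_cB_c4 y : y != 0 -> link (false, cB) (false, c4) (0, y) (0, y^-1).
Proof.
move=> y0; apply: (@mk_link _ _ _ (fun p => (p.1 * p.2 ^+ 2, p.2^-1))) => /=.
- by rewrite mul0r.
- by diffs.
- by case=> /esym/eqP; rewrite invr_eq0 (negPf a0).
have n : \forall q \near ((0 : C, y) : C * C), q.2 != 0 by exact: near_snd_neq0.
near=> p; have p2 : p.2 != 0 by near: p.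
rewrite invr_eq0 (negPf p2) mulf_eq0 (negPf (expf_neq0 _ p2)) orbF !invrK.
case: eqVneq => // p1; congr Aff; field; by rewrite p1 p2.
Unshelve. all: by end_near. Qed.

Lemma link_c43_c4 (s : a4pt a) :
  link (false, c43) (false, c4) (val s, 0) ((val s)^-1, 0).
Proof.
have s0 := a4pt_neq0 s.
apply: (@mk_link _ _ _ (fun p => (p.1^-1, p.1 * p.2))) => /=.
- by rewrite mulr0.
- by diffs.
- by case=> /invr_inj/eqP; rewrite (negPf (a4pt_neqa s)).
have n : \forall q \near ((val s, 0 : C) : C * C), q.1 != 0 by exact: near_fst_neq0.
near=> p; have p1 : p.1 != 0 by near: p.
rewrite invr_eq0 (negPf p1) mulf_eq0 (negPf p1) /= invrK.
case: eqVneq => // p2; congr Aff; field; by rewrite p1 p2.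
Unshelve. all: by end_near. Qed.

Lemma link_c4_c43 (s : a4pt a) :
  link (false, c4) (false, c43) ((val s)^-1, 0) (val s, 0).
Proof.
have s0 := a4pt_neq0 s.
apply: (@mk_link _ _ _ (fun p => (p.1^-1, p.1 * p.2))) => /=.
- by rewrite mulr0 invrK.
- by diffs; rewrite /= invr_eq0.
- by case=> /eqP; rewrite (negPf (a4pt_neqa s)).
have n : \forall q \near (((val s)^-1, 0 : C) : C * C), q.1 != 0.
  by apply: near_fst_neq0; rewrite invr_eq0.
near=> p; have p1 : p.1 != 0 by near: p.
rewrite invr_eq0 (negPf p1) mulf_eq0 (negPf p1) /=.
case: eqVneq => // p2; congr Aff; field; by rewrite p1 p2.
Unshelve. all: by end_near. Qed.

Lemma link_c32_c43 l : l != 0 -> link (false, c32) (false, c43) (0, l^-1) (0, l).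
Proof.
move=> l0; apply: (@mk_link _ _ _ (fun p => (p.1 * p.2 ^+ 2, p.2^-1))) => /=.
- by rewrite mul0r invrK.
- by diffs; rewrite /= invr_eq0.
- by case=> /esym/eqP; rewrite (negPf a0).
have n : \forall q \near ((0 : C, l^-1) : C * C), q.2 != 0.
  by apply: near_snd_neq0; rewrite invr_eq0.
near=> p; have p2 : p.2 != 0 by near: p.
rewrite invr_eq0 (negPf p2) mulf_eq0 (negPf (expf_neq0 _ p2)) orbF.
case: eqVneq => // p1; congr Aff; field; by rewrite p1 p2.
Unshelve. all: by end_near. Qed.

Lemma link_c43_c32 l : l != 0 -> link (false, c43) (false, c32) (0, l) (0, l^-1).
Proof.
move=> l0; apply: (@mk_link _ _ _ (fun p => (p.1 * p.2 ^+ 2, p.2^-1))) => //=.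
- by rewrite mul0r.
- by diffs.
have n : \forall q \near ((0 : C, l) : C * C), q.2 != 0 by exact: near_snd_neq0.
near=> p; have p2 : p.2 != 0 by near: p.
rewrite invr_eq0 (negPf p2) mulf_eq0 (negPf (expf_neq0 _ p2)) orbF invrK.
case: eqVneq => // p1; congr Aff; field; by rewrite p1 p2.
Unshelve. all: by end_near. Qed.

Lemma link_c21_c32 u : u != 0 -> link (false, c21) (false, c32) (u^-1, 0) (u, 0).
Proof.
move=> u0; apply: (@mk_link _ _ _ (fun p => (p.1^-1, p.1 ^+ 2 * p.2))) => //=.
- by rewrite mulr0 invrK.
- by diffs; rewrite /= invr_eq0.
have n : \forall q \near ((u^-1, 0 : C) : C * C), q.1 != 0.
  by apply: near_fst_neq0; rewrite invr_eq0.
near=> p; have p1 : p.1 != 0 by near: p.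
rewrite invr_eq0 (negPf p1) mulf_eq0 (negPf (expf_neq0 _ p1)) /=.
case: eqVneq => // p2; congr Aff; field; by rewrite ?p1 ?p2.
Unshelve. all: by end_near. Qed.

Lemma link_c32_c21 u : u != 0 -> link (false, c32) (false, c21) (u, 0) (u^-1, 0).
Proof.
move=> u0; apply: (@mk_link _ _ _ (fun p => (p.1^-1, p.1 ^+ 2 * p.2))) => /=.
- by rewrite mulr0.
- by diffs.
- by case=> _ /eqP; rewrite eq_sym oppr_eq0 oner_eq0.
have n : \forall q \near ((u, 0 : C) : C * C), q.1 != 0 by exact: near_fst_neq0.
near=> p; have p1 : p.1 != 0 by near: p.
rewrite invr_eq0 (negPf p1) mulf_eq0 (negPf (expf_neq0 _ p1)) /= invrK.
case: eqVneq => // p2; congr Aff; field; by rewrite ?p1 ?p2.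
Unshelve. all: by end_near. Qed.

Lemma link_c21_c1 w : w != 0 -> w != 1 ->
  link (false, c21) (false, c1) (0, (w - 1)^-1) (w, 0).
Proof.
move=> w0 w1; have w1' : w - 1 != 0 by rewrite subr_eq0.
have w2 : 1 + (w - 1)^-1 != 0.
  by rewrite (_ : _ + _ = w / (w - 1)) ?mulf_neq0 ?invr_neq0 //; field.
apply: (@mk_link _ _ _ (fun p => (p.2^-1 + 1, p.1 * p.2 ^+ 2 / (1 + p.2)))) => //=.
- by rewrite !mul0r invrK subrK.
- by diffs; rewrite /= ?invr_eq0.
have n : \forall q \near ((0 : C, (w - 1)^-1) : C * C), q.2 != 0.
  by apply: near_snd_neq0; rewrite invr_eq0.
have n2 : \forall q \near ((0 : C, (w - 1)^-1) : C * C), 1 + q.2 != 0.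
  by apply: (@near_diff_neq0 _ _ (fun q : C * C => 1 + q.2)) => //; diffs.
near=> p; have p2 : p.2 != 0 by near: p.
have p3 : 1 + p.2 != 0 by near: p.
have p4 : p.2^-1 + 1 != 0.
  by rewrite (_ : _ + _ = (1 + p.2) / p.2) ?mulf_neq0 ?invr_neq0 //; field.
rewrite !mulf_eq0 invr_eq0 (negPf p3) (negPf p2) (negPf p4) !orbF.
rewrite ?(negPf p4) ?(negPf (expf_neq0 _ p2)) ?orbF.
by case: eqVneq => // p1; congr Aff; field; rewrite ?p1 ?p2 ?p3.
Unshelve. all: by end_near. Qed.

Lemma link_c1_c21 w : w != 0 -> w != 1 ->
  link (false, c1) (false, c21) (w, 0) (0, (w - 1)^-1).
Proof.
move=> w0 w1; have w1' : w - 1 != 0 by rewrite subr_eq0.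
apply: (@mk_link _ _ _ (fun p => ((p.1 - 1) * p.1 * p.2, (p.1 - 1)^-1))) => /=.
- by rewrite mulr0.
- by diffs.
- case=> /(congr1 GRing.inv); rewrite invrK invrN invr1 => /eqP.
  by rewrite -subr_eq0 opprK subrK (negPf w0).
have n : \forall q \near ((w, 0 : C) : C * C), q.1 != 0 by exact: near_fst_neq0.
have n2 : \forall q \near ((w, 0 : C) : C * C), q.1 - 1 != 0.
  by apply: (@near_diff_neq0 _ _ (fun q : C * C => q.1 - 1)) => //; diffs.
near=> p; have p1 : p.1 != 0 by near: p.
have p3 : p.1 - 1 != 0 by near: p.
rewrite !mulf_eq0 invr_eq0 (negPf p1) (negPf p3) /= invrK subrK.
by case: eqVneq => // p2; congr Aff; field; rewrite ?p1 ?p2 ?p3.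
Unshelve. all: by end_near. Qed.

Lemma link_c1_cS v : v != 0 -> link (false, c1) (false, cS) (0, v^-1) (v, 0).
Proof.
move=> v0; apply: (@mk_link _ _ _ (fun p => (p.2^-1, p.1 * p.2))) => //=.
- by rewrite mul0r invrK.
- by diffs; rewrite /= invr_eq0.
have n : \forall q \near ((0 : C, v^-1) : C * C), q.2 != 0.
  by apply: near_snd_neq0; rewrite invr_eq0.
near=> p; have p2 : p.2 != 0 by near: p.
rewrite mulf_eq0 (negPf p2) orbF.
by case: eqVneq => // p1; congr Aff; field; rewrite ?p1 ?p2.
Unshelve. all: by end_near. Qed.

Lemma link_cS_c1 v : v != 0 -> link (false, cS) (false, c1) (v, 0) (0, v^-1).
Proof.
move=> v0; apply: (@mk_link _ _ _ (fun p => (p.1 * p.2, p.1^-1))) => //=.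
- by rewrite mulr0.
- by diffs.
have n : \forall q \near ((v, 0 : C) : C * C), q.1 != 0 by exact: near_fst_neq0.
near=> p; have p1 : p.1 != 0 by near: p.
rewrite invr_eq0 mulf_eq0 (negPf p1) /= invrK.
by case: eqVneq => // p2; congr Aff; field; rewrite ?p1 ?p2.
Unshelve. all: by end_near. Qed.

End Links.

Section Hubs.
Variables (C : numClosedFieldType) (a b : C).
Hypothesis a0 : a != 0.

Notation link := (link a b).
Notation cpar := (@cpar C a).
Notation par := (@par C a b).
Notation zcoord := (@zcoord C a b).
Notation dom := (@dom C a).
Notation jpt := (@jpt C a b).

(** A germ in one direction does not supply its inverse, so both directions are recorded. *)
Definition hlink i (z : pts a) p :=
  link i (hub z) p (hubc z) /\ link (hub z) i (hubc z) p.

Lemma hlink_hub z : hlink (hub z) z (hubc z).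
Proof. by split; exact: link_hub_hub. Qed.

Lemma coord_hub z : zcoord (hub z) z = hubc z.
Proof. by rewrite -{2}(hub_par b z) zcoordK //; exact: hub_dom. Qed.

Lemma hlink_id i z p : dom i p -> par i p = z -> hub z = i -> hlink i z p.
Proof.
move=> Dp pz hz; have -> : p = hubc z by rewrite -(zcoordK b Dp) -coord_hub hz pz.
by rewrite -hz; exact: hlink_hub.
Qed.

Lemma hlink_false k p : cdomain a k p -> hlink (false, k) (cpar k p) p.
Proof.
move=> Dp; case: (boolP (affcond k p)) => cp.
  by rewrite (cpar_Aff a cp) /hlink /= -surjective_pairing; exact: link_c0.
have idl : hub (cpar k p) = (false, k) -> hlink (false, k) (cpar k p) p.
  exact: hlink_id.
case: p Dp cp idl => u v; case: k => //=.
- by move=> _; case: eqVneq => //= u0 _; apply.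
- case: (eqVneq v 0) => [->|v0]; case: (eqVneq u 0) => [->|u0] //= Dp _.
  + by apply.
  + have uA : u^-1 != a by apply/eqP => ua; apply: Dp; rewrite -ua invrK.
    by have [s -> _] := mkP4P (invr_neq0 u0) uA; apply.
  + move=> _; have v0' := invr_neq0 v0.
    have := link_c4_cB a b v0'; have := link_cB_c4 b a0 v0'.
    by rewrite invrK.
- case: (eqVneq u 0) => [->|u0] /=; first by move=> _ _; apply.
  case: (eqVneq v 0) => [->|v0] //= Dp _ _.
  have uA : u != a by apply/eqP => ua; apply: Dp; rewrite -ua.
  have [s -> us] := mkP4P u0 uA; rewrite -us.
  by have := link_c43_c4 b s; have := link_c4_c43 b s.
- case: (eqVneq v 0) => [->|v0] /=; first by move=> _ _; apply.
  case: (eqVneq u 0) => [->|u0] //= Dp _ _; have v0' := invr_neq0 v0.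
  have := link_c43_c32 a b v0'; have := link_c32_c43 b a0 v0'.
  by rewrite invrK.
- case: (eqVneq u 0) => [->|u0]; case: (eqVneq v 0) => [->|v0] //= Dp _.
  + by apply.
  + move=> _; have v1 : v^-1 != 0 by rewrite invr_eq0.
    have w1 : v^-1 + 1 != 1 by rewrite -subr_eq0 addrK.
    have w0 : v^-1 + 1 != 0.
      rewrite addr_eq0; apply/eqP => /(congr1 GRing.inv).
      by rewrite invrK invrN invr1 => v1'; apply: Dp; rewrite v1'.
    have := link_c21_c1 a b w0 w1; have := link_c1_c21 a b w0 w1.
    by rewrite addrK invrK.
  + move=> _; have u0' := invr_neq0 u0.
    have := link_c21_c32 a b u0'; have := link_c32_c21 a b u0'.
    by rewrite invrK.
- case: (eqVneq v 0) => [->|v0] /=; first by move=> _ _; apply.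
  case: (eqVneq u 0) => [->|u0] //= Dp _ _; have v0' := invr_neq0 v0.
  have := link_c1_cS a b v0'; have := link_cS_c1 a b v0'.
  by rewrite invrK.
- by case: (eqVneq v 0) => [->|v0] //= _ _; apply.
Qed.

(** The part off the arms and sections. It is stable under j and all its hubs are in the family
    [false], so j must be written there in those charts; on the arms j merely exchanges the two
    families. *)
Definition base (z : pts a) : bool :=
  match z with Aff _ _ | PB _ | N4 | Q4 _ => true | _ => false end.

Lemma base_jpt z : base (jpt z) = base z.
Proof. by case: z => //= s; rewrite /mkP4; case: insub. Qed.

(** Since [fpol] (1 / v) = g(v) / v^2, the reflection r |-> [fpol] y - r reads u |-> u / (u g(v) -
    1) for u = y^2 / r and v = 1 / y. *)
Lemma link_c4_c4 t : t * a != 1 ->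
  link (true, c4) (false, c4) (t, 0) (t / (t * a - 1), 0).
Proof.
move=> ta; have ta1 : t * a - 1 != 0 by rewrite subr_eq0.
pose g (y : C) := a + a * y + b * y ^+ 2.
apply: (@mk_link _ _ _ (fun p => (p.1 / (p.1 * g p.2 - 1), p.2))) => /=.
- by rewrite /g mulr0 !addr0 expr0n /= mulr0 addr0.
- rewrite /g; diffs => /=.
  by rewrite mulr0 !addr0 expr0n /= mulr0 addr0.
- case=> h; have : a^-1 * (t * a - 1) = t by rewrite -h divfK.
  rewrite mulrBr mulr1 mulrCA mulVf // mulr1 => /eqP.
  by rewrite -subr_eq0 addrC addKr oppr_eq0 invr_eq0 (negPf a0).
have n : \forall q \near ((t, 0 : C) : C * C), q.1 * g q.2 - 1 != 0.
  apply: (@near_diff_neq0 _ _ (fun q : C * C => q.1 * g q.2 - 1)).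
    by rewrite /g; diffs.
  by rewrite /= /g mulr0 !addr0 expr0n /= mulr0 addr0.
near=> p; have p1 : p.1 * g p.2 - 1 != 0 by near: p.
rewrite mulf_eq0 invr_eq0 (negPf p1) orbF.
case: (eqVneq p.2 0) => [p2|p2]; case: (eqVneq p.1 0) => [q1|q1] //=.
- rewrite p2 (_ : g 0 = a) in p1 *; last first.
    by rewrite /g mulr0 !addr0 expr0n /= mulr0 addr0.
  have q1' := invr_neq0 q1.
  have q1a : p.1^-1 != a.
    by apply/eqP => h; move/eqP: p1; apply; rewrite -h mulfV // subrr.
  by rewrite jptM //; congr mkP4; field; rewrite q1 p1.
- by congr Aff; rewrite /g in p1 *; rewrite /fpol; field; rewrite p1 p2 q1.
Unshelve. all: by end_near. Qed.

Lemma link_base_jpt z : base z ->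
  link (true, (hub z).2) (false, (hub z).2) (hubc z) (hubc (jpt z)).
Proof.
case: z => //= [r y|y||s] _.
- apply: (@mk_link _ _ _ (fun p => (fpol a b p.2 - p.1, p.2))) => //=.
    by rewrite /fpol; diffs.
  by near=> p.
- apply: (@mk_link _ _ _
    (fun p => (p.1 / (p.1 * fpol a b p.2 - 1), p.2))) => //=.
  + by rewrite mul0r.
  + rewrite /fpol; diffs => /=.
    by rewrite mul0r add0r oppr_eq0 oner_eq0.
  have n : \forall q \near ((0 : C, y) : C * C), q.1 * fpol a b q.2 - 1 != 0.
    apply: (@near_diff_neq0 _ _ (fun q : C * C => q.1 * fpol a b q.2 - 1)).
      by rewrite /fpol; diffs.
    by rewrite /= mul0r add0r oppr_eq0 oner_eq0.
  near=> p; have p2 : p.1 * fpol a b p.2 - 1 != 0 by near: p.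
  rewrite mulf_eq0 invr_eq0 (negPf p2) orbF.
  by case: eqVneq => //= p1; congr Aff; field; rewrite p1 p2.
- have := link_c4_c4 (t := 0); rewrite !mul0r; apply.
  by rewrite eq_sym oner_eq0.
- have s0 := a4pt_neq0 s; have sa := a4pt_neqa s.
  have as0 : a - val s != 0 by rewrite subr_eq0 eq_sym.
  have asa : a - val s != a by rewrite -subr_eq0 addrC addKr oppr_eq0.
  have ta : (val s)^-1 * a != 1.
    apply/eqP => h; move/eqP: sa; apply.
    by rewrite -[LHS]mulr1 -h mulVKf.
  have [s' -> s'E] := mkP4P as0 asa; rewrite /= [sval s']s'E.
  have E v : v != 0 -> a - v != 0 -> (a - v)^-1 = v^-1 / (v^-1 * a - 1).
    move=> v0 av; rewrite (_ : v^-1 * a - 1 = (a - v) / v); last by field.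
    by rewrite invf_div mulrA mulVf // mul1r.
  by rewrite (E _ s0 as0); exact: link_c4_c4.
Unshelve. all: by end_near. Qed.

Lemma hlink_base_jpt z : base z -> hlink (true, (hub z).2) (jpt z) (hubc z).
Proof.
move=> bz; have hub_false w : base w -> hub w = (false, (hub w).2) by case: w.
have hubJ : (hub (jpt z)).2 = (hub z).2.
  by case: (z) bz => //= s _; rewrite /mkP4; case: insub.
have bJ : base (jpt z) by rewrite base_jpt.
split; rewrite (hub_false _ bJ) hubJ.
  exact: link_base_jpt.
have := link_jpt (link_base_jpt bJ); by rewrite jptK hubJ.
Qed.

Lemma hub_cpar k p : (hub (cpar k p)).1 = false.
Proof.
by case: k => //=; do 2?[case: ifP => //=]; rewrite /mkP4; do ?case: insub => //=.
Qed.

(** For the family [true], the links of the family [false] are transported by j. On an arm this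
    already gives the hub; at a base point the expression of j in the hub chart is composed with
    it. *)
Lemma hlink_par i p : dom i p -> hlink i (par i p) p.
Proof.
case: i => -[] k Dp; last exact: hlink_false.
have [h1 h2] := hlink_false Dp.
rewrite /par /=; set w := cpar k p in h1 h2 *.
case: (boolP (base w)) => bw.
  have hub_false : hub w = (false, (hub w).2) by case: (w) bw.
  rewrite hub_false in h1 h2.
  have [h3 h4] := hlink_base_jpt bw.
  by split; [exact: link_trans (link_jpt h1) h3|exact: link_trans h4 (link_jpt h2)].
have aw : exists kw, hub w = (false, kw) /\ hub (jpt w) = (true, kw)
    /\ hubc (jpt w) = hubc w.
  have : (hub w).1 = false by exact: hub_cpar.
  by case: (w) bw => // -[] // *; [exists c43|exists c32|exists c21|exists c1|exists cS].
by case: aw => kw [E1 [E2 E3]]; rewrite /hlink E2 E3; rewrite E1 in h1 h2;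
  split; [exact: (link_jpt h1)|exact: (link_jpt h2)].
Qed.

Lemma link_par_par i j p q : dom i p -> dom j q -> par i p = par j q ->
  link i j p q.
Proof.
move=> /hlink_par[h1 _] /hlink_par[_ h2] E.
by rewrite -E in h2; exact: link_trans h1 h2.
Qed.

Lemma zgl_cover z : exists i p, dom i p /\ par i p = z.
Proof.
by exists (hub z), (hubc z); split; [exact: hub_dom|exact: hub_par].
Qed.

Lemma zgl_link i j p : dom i p -> (par j @` dom j) (par i p) ->
  differentiable (zcoord j \o par i) p /\
  \forall q \near p, (par j @` dom j) (par i q).
Proof.
move=> Dp [q Dq E]; have [g [gp dg Dq' ng]] := link_par_par Dp Dq (esym E).
have cg := differentiable_continuous dg.
have Dg : \forall p' \near p, dom j (g p').
  apply: (cg (dom j)); rewrite gp; apply: open_nbhs_nbhs; split => //.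
  exact: dom_open.
split.
  apply: near_differentiable dg; near=> p' => /=.
  rewrite -(_ : par j (g p') = par i p'); last by near: p'.
  by rewrite zcoordK //; near: p'.
by near=> p'; exists (g p'); near: p'.
Unshelve. all: by end_near. Qed.

Definition Zglue : gluing (C * C)%type :=
  Gluing (@dom_open C a) (@zcoordK C a b) zgl_cover zgl_link.

Definition Zsurf : complexSurface C := glue_manifold Zglue.

End Hubs.

Lemma diff_idf (K : numFieldType) (V : normedModType K) (x : V) :
  differentiable (fun p : V => p) x.
Proof. exact: (@ex_diff _ _ _ _ _ id id). Qed.

(** * Topology of the surface *)

Section Topology.
Variables (C : numClosedFieldType) (a b : C).
Hypothesis a0 : a != 0.

Notation cpar := (@cpar C a).
Notation par := (@par C a b).
Notation dom := (@dom C a).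
Notation jpt := (@jpt C a b).
Notation Z := (Zsurf b a0).
Notation ftor := (fpol a b).

Lemma torus_affcond k (p : C * C) : p.1 != 0 -> p.2 != 0 ->
  affcond k p /\ (affinv k p).2 != 0.
Proof. by case: k => /= h1 h2; rewrite ?h1 ?h2 ?invr_eq0 ?mulf_eq0 ?(negPf h1) ?(negPf h2). Qed.

Lemma dnbhs_add_neq0 (c : C) : \forall e \near (0 : C)^', c + e != 0.
Proof.
have [->|c0] := eqVneq c 0.
  by near=> e; rewrite add0r; near: e; exact: nbhs_dnbhs_neq.
have : \forall e \near (0 : C), c + e != 0.
  apply: (@near_diff_neq0 _ _ (fun e => c + e)); last by rewrite addr0.
  by diffs; exact: diff_idf.
exact: nbhs_dnbhs.
Unshelve. all: by end_near. Qed.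

Lemma torus_dense (p : C * C) (U : set (C * C)) : nbhs p U ->
  exists q, [/\ U q, q.1 != 0 & q.2 != 0].
Proof.
move=> Up; pose h (e : C) := (p.1 + e, p.2 + e).
have hc : {for 0, continuous h}.
  by apply/differentiable_continuous; rewrite /h; diffs; exact: diff_idf.
have h0 : h 0 = p by rewrite /h !addr0 -surjective_pairing.
have nz c : \forall e \near (0 : C)^', c + e != 0 by exact: dnbhs_add_neq0.
have hU : \forall e \near (0 : C)^', U (h e).
  by apply: nbhs_dnbhs; apply: hc; rewrite h0.
have [e [Ue e1 e2]] : exists e, [/\ U (h e), p.1 + e != 0 & p.2 + e != 0].
  apply: (@filter_ex _ ((0 : C)^')); near=> e; split; near: e => //; exact: nz.
by exists (h e).
Unshelve. all: by end_near. Qed.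

Lemma par_nbhs i p (V : set (C * C)) : dom i p -> nbhs p V ->
  nbhs (par i p : Z) (par i @` (V `&` dom i)).
Proof.
move=> Dp Vp; rewrite nbhsE; exists (par i @` (V^° `&` dom i)).
  split; last by exists p.
  apply: (@glue_par_open _ _ (Zglue b a0) i) => [|q []//].
  apply: openI; [exact: open_interior|exact: dom_open].
by move=> _ [q [Wq Dq] <-]; exists q => //; split => //; exact: interior_subset.
Qed.

Lemma par_cts i p : dom i p -> {for p, continuous (par i : C * C -> Z)}.
Proof. exact: (@glue_par_cts _ _ (Zglue b a0) i). Qed.

Lemma par_torus i q : q.1 != 0 -> q.2 != 0 ->
  exists r y, y != 0 /\ par i q = Aff a r y.
Proof.
case: i => e k q1 q2; have [h1 h2] := torus_affcond k q1 q2.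
rewrite /par (cpar_Aff a h1).
by case: e; eexists; exists (affinv k q).2; split; try exact: h2; reflexivity.
Qed.

Lemma Aff_dense (U : set Z) (z : Z) : nbhs z U -> exists r y, y != 0 /\ U (Aff a r y).
Proof.
rewrite -(hub_par b z) => Uz; have Dz := hub_dom a0 z.
have [q [Uq q1 q2]] := torus_dense (par_cts Dz Uz).
by have [r [y [y0 E]]] := par_torus (hub z) q1 q2; exists r, y; rewrite -E.
Qed.

Section Rep.
Variables (phi : C -> C -> C) (A B : bool * cix -> C * C -> C).
Hypothesis dA : forall i p, differentiable (A i) p.
Hypothesis dB : forall i p, differentiable (B i) p.
Hypothesis AB : forall i p r y, dom i p -> par i p = Aff a r y -> y != 0 ->
  A i p = phi r y * B i p.

(** If two points have no disjoint neighbourhoods, these contain common affine points with y != 0,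
    where both pairs (A, B) are proportional to (phi, 1); the vanishing of the determinant passes to
    the limit. A pair (0, 0) is allowed and carries no information, so phi only has to be written in
    the charts where it serves. *)
Lemma cluster_rep (z1 z2 : Z) : cluster (nbhs z1) z2 ->
  A (hub z1) (hubc z1) * B (hub z2) (hubc z2) =
  A (hub z2) (hubc z2) * B (hub z1) (hubc z1).
Proof.
move=> cl; apply/eqP; rewrite -subr_eq0; apply/negPn/negP => M0.
have D1 := hub_dom a0 z1; have D2 := hub_dom a0 z2.
pose M (p : (C * C) * (C * C)) : C := A (hub z1) p.1 * B (hub z2) p.2 -
  A (hub z2) p.2 * B (hub z1) p.1.
have dM : differentiable M (hubc z1, hubc z2).
  rewrite /M; apply: diff_addf; [|apply: diff_oppf]; apply: diff_mulf;
    apply: differentiable_comp => //; try exact: differentiable_fst;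
    exact: differentiable_snd.
have [[V1 V2] /= [V1z V2z] VM] := near_diff_neq0 dM M0.
have N1 := par_nbhs D1 V1z; have N2 := par_nbhs D2 V2z.
rewrite !hub_par in N1 N2.
rewrite nbhsE in N1; case: N1 => W1 oW1 sW1.
rewrite nbhsE in N2; case: N2 => W2 oW2 sW2.
have [z0 [Wz1 Wz2]] := cl _ _ (open_nbhs_nbhs oW1) (open_nbhs_nbhs oW2).
have oW : nbhs z0 (W1 `&` W2).
  by apply: open_nbhs_nbhs; split => //; apply: openI; [case: oW1|case: oW2].
have [r [y [y0 [/sW1[p1 [V1p D1p] E1] /sW2[p2 [V2p D2p] E2]]]]] := Aff_dense oW.
have /eqP := VM (p1, p2) (conj V1p V2p); apply; rewrite /M /=.
by rewrite (AB D1p E1 y0) (AB D2p E2 y0); ring.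
Qed.

End Rep.

Lemma cluster_par i p q : dom i p -> dom i q ->
  cluster (nbhs (par i p : Z)) (par i q) -> p = q.
Proof.
move=> Dp Dq cl; apply: (@norm_hausdorff _ (C * C)%type) => U V Up Vq.
have [z [[p' [Up' Dp'] <-] [q' [Vq' Dq'] E]]] :=
  cl _ _ (par_nbhs Dp Up) (par_nbhs Dq Vq).
exists p'; split => //.
by rewrite -(zcoordK b Dp') -E (zcoordK b Dq').
Qed.

(** The function 1 / y in the charts that reach y = oo; the value in [c0] and [cB] is a default. *)
Definition etak (k : cix) (p : C * C) : C :=
  match k with c0 => 1 | cB => 1 | c4 | cS => p.2 | _ => p.1 * p.2 end.

(** The function r / y^2 in the charts of an arm. *)
Definition zetak (k : cix) (p : C * C) : C :=
  match k with
  | c43 => p.1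
  | c32 => p.1 * p.2 ^+ 2
  | c21 => p.1 ^+ 3 * p.2 ^+ 2
  | c1 => (p.1 - 1) * (p.1 * p.2) ^+ 3
  | cS => (p.1 * p.2 - 1) * p.2 ^+ 3
  | _ => 0
  end.

(** On an arm, ([fpol] y - r) / y^2: the function r / y^2 after j. *)
Definition gk (k : cix) (p : C * C) : C :=
  a + a * etak k p + b * etak k p ^+ 2 - zetak k p.

Definition arm (k : cix) : bool :=
  match k with c0 | cB | c4 => false | _ => true end.

(** [yrep], [rrep] and [zrep] are y, r and r / y^2 as points of P^1. In [rrep] and [zrep] the pair
    (0, 0) marks the charts where nothing is asked. *)
Definition yrep (i : bool * cix) (p : C * C) : C * C :=
  match i.2 with c0 | cB => (p.2, 1) | k => (1, etak k p) end.

Definition rrep (i : bool * cix) (p : C * C) : C * C :=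
  match i with
  | (false, c0) => (p.1, 1)
  | (false, cB) => (1, p.1)
  | _ => (0, 0)
  end.

Definition zrep (i : bool * cix) (p : C * C) : C * C :=
  match i with
  | (_, c0) | (_, cB) | (true, c4) => (0, 0)
  | (false, c4) => (1, p.1)
  | (false, k) => (zetak k p, 1)
  | (true, k) => (gk k p, 1)
  end.

(** The functions r, r / y, x - 1 and x y of [aphi]; between them they distinguish the hubs of one
    arm. *)
Definition arep (n : nat) (k : cix) (p : C * C) : C * C :=
  match n, k with
  | 0, c43 => (1, p.1 * p.2 ^+ 2)
  | 0, c32 => (1, p.1)
  | 0, c21 => (p.1, 1)
  | 0, c1 => ((p.1 - 1) * p.1 * p.2, 1)
  | 0, cS => ((p.1 * p.2 - 1) * p.2, 1)
  | 1, c43 => (1, p.2)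
  | 1, c32 => (p.2, 1)
  | 2, c21 => (1, p.2)
  | 2, c1 => (p.1 - 1, 1)
  | 3, c21 => (1 + p.2, p.1 * p.2 ^+ 2)
  | 3, c1 => (1, p.2)
  | 3, cS => (p.1, 1)
  | _, _ => (0, 0)
  end.

Definition aphi (n : nat) (r y : C) : C :=
  match n with 0 => r | 1 => r / y | 2 => r * y | _ => (r * y + 1) * y end.

Definition arepe e n (i : bool * cix) p : C * C :=
  if i.1 == e then arep n i.2 p else (0, 0).

Lemma diff_etak k p : differentiable (etak k) p.
Proof. by case: k; rewrite /etak; diffs. Qed.

Lemma diff_zetak k p : differentiable (zetak k) p.
Proof. by case: k; rewrite /zetak; diffs. Qed.

Lemma diff_gk k p : differentiable (gk k) p.
Proof.
have := diff_etak k p; have := diff_zetak k p; rewrite /gk => *; diffs.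
Qed.

Lemma cpar_AffE k p r y : cpar k p = Aff a r y ->
  [/\ affcond k p, r = (affinv k p).1 & y = (affinv k p).2].
Proof. by move=> E; have h := Aff_affcond E; move: E; rewrite cpar_Aff // => -[]. Qed.

Lemma par_AffE e k p r y : par (e, k) p = Aff a r y ->
  [/\ affcond k p, y = (affinv k p).2 &
     r = if e then ftor y - (affinv k p).1 else (affinv k p).1].
Proof.
have : jif b e (par (e, k) p) = cpar k p by rewrite /par jifK.
by case: e => /= E E'; rewrite E' in E; have [h e1 e2] := cpar_AffE (esym E);
  split=> //; rewrite -e1 opprB addrC subrK.
Qed.

Lemma etakE k p r y : cpar k p = Aff a r y -> k <> c0 -> k <> cB ->
  y = (etak k p)^-1 /\ etak k p != 0.
Proof.
move=> /cpar_AffE[+ _ ->]; case: k => //=; try (case/andP=> h1 h2) ;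
 move=> *; rewrite ?mulf_neq0 //.
Qed.

Lemma zetakE k p r y : cpar k p = Aff a r y -> arm k -> y != 0 -> zetak k p = r / y ^+ 2.
Proof.
move=> /cpar_AffE[+ -> ->]; case: k => //=; try (case/andP=> h1 h2); move=> *;
 field; rewrite ?h1 ?h2 //.
Qed.

Definition cross (u v : C * C) : Prop := u.1 * v.2 = v.1 * u.2.

Section Clusters.
Variables (z1 z2 : Z).
Hypothesis cl : cluster (nbhs z1) z2.

Lemma cluster_pairs (phi : C -> C -> C) (A : bool * cix -> C * C -> C * C) :
  (forall i p, differentiable (fun p => (A i p).1) p) ->
  (forall i p, differentiable (fun p => (A i p).2) p) ->
  (forall i p r y, dom i p -> par i p = Aff a r y -> y != 0 ->
     (A i p).1 = phi r y * (A i p).2) ->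
  cross (A (hub z1) (hubc z1)) (A (hub z2) (hubc z2)).
Proof. by move=> d1 d2 AB; exact: (cluster_rep d1 d2 AB cl). Qed.

Lemma cluster_y : cross (yrep (hub z1) (hubc z1)) (yrep (hub z2) (hubc z2)).
Proof.
apply: (cluster_pairs (phi := fun _ y => y)) => -[e k] p.
- by case: k; rewrite /yrep /etak /=; diffs.
- by case: k; rewrite /yrep /etak /=; diffs.
- move=> r y _ /par_AffE[+ -> _] _; rewrite /yrep.
  case: k => //=; try (case/andP=> h1 h2); move=> *;
  rewrite ?mulr1 ?mulVf ?mulf_neq0 //.
Qed.

Lemma cluster_r : cross (rrep (hub z1) (hubc z1)) (rrep (hub z2) (hubc z2)).
Proof.
apply: (cluster_pairs (phi := fun r _ => r)) => -[e k] p.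
- by case: e; case: k; rewrite /rrep /=; diffs.
- by case: e; case: k; rewrite /rrep /=; diffs.
- move=> r y _ /par_AffE[+ _ ->] _; rewrite /rrep.
  by case: e; case: k => //= h; rewrite ?mulr0 ?mulr1 ?mulVf.
Qed.

Lemma cluster_z : cross (zrep (hub z1) (hubc z1)) (zrep (hub z2) (hubc z2)).
Proof.
apply: (cluster_pairs (phi := fun r y => r / y ^+ 2)) => -[e k] p.
- by have := diff_gk k p; have := diff_zetak k p; case: e; case: k;
    rewrite /zrep /= => *; diffs.
- by case: e; case: k; rewrite /zrep /=; diffs.
- move=> r y _ E y0; have [cp yE rE] := par_AffE E.
  case ak : (arm k); last first.
    case: e k ak cp yE rE {E} => -[] //= _; rewrite ?mulr0 //.
    by case/andP => h1 h2 -> ->; field; rewrite h1 h2.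
  have cE : cpar k p = Aff a (if e then ftor y - r else r) y.
    by rewrite (cpar_Aff a cp) -yE rE; case: (e) => //; rewrite opprB addrC subrK.
  have zE := zetakE cE ak y0.
  have [ye e0] : y = (etak k p)^-1 /\ etak k p != 0 by apply: etakE cE _ _; case: (k) ak.
  have gE : gk k p = a + a / y + b / y ^+ 2 - zetak k p.
    by rewrite /gk ye -exprVn invrK.
  case: e {E} rE cE zE => rE cE zE.
    suff : gk k p = r / y ^+ 2 by case: (k) ak => //= _ ->; rewrite mulr1.
    by rewrite gE zE /fpol; field.
  by case: (k) ak zE => //= _ ->; rewrite mulr1.
Qed.

Lemma cluster_arm (e : bool) (n : nat) :
  cross (arepe e n (hub z1) (hubc z1)) (arepe e n (hub z2) (hubc z2)).
Proof.
apply: (cluster_pairs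
  (phi := fun r y => aphi n (if e then ftor y - r else r) y)) => -[e' k] p;
  rewrite /arepe.
- by case: (_ == _); case: n => [|[|[|[|n]]]]; case: k; rewrite /arep /=; diffs.
- by case: (_ == _); case: n => [|[|[|[|n]]]]; case: k; rewrite /arep /=; diffs.
- move=> r y _ /par_AffE[cp yE rE] y0 /=.
  case: eqVneq => [ee|_]; last by rewrite mulr0.
  rewrite ee in rE; have {rE} -> : (if e then ftor y - r else r) = (affinv k p).1.
    by rewrite rE; case: (e) => //; rewrite opprB addrC subrK.
  rewrite yE; case: n => [|[|[|[|n]]]]; case: k cp {yE} => //=;
  try (case/andP=> h1 h2); move=> *; rewrite ?mulr0 ?mulr1 //;
  try (by field; rewrite ?h1 ?h2).
Qed.

Lemma cluster_hub : hub z1 = hub z2 -> z1 = z2.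
Proof.
move=> h; rewrite -(hub_par b z1) -(hub_par b z2) h; congr par.
apply: (@cluster_par (hub z2)).
- by rewrite -h; exact: hub_dom.
- exact: hub_dom.
- by rewrite -{1}h !hub_par.
Qed.

End Clusters.

Definition finy (z : pts a) : bool :=
  match z with Aff _ _ | PB _ => true | _ => false end.

Definition armof (z : pts a) : option bool :=
  match z with
  | Q3 e _ | Q2 e _ | N21 e | Q1 e _ | PS e _ => Some e
  | _ => None
  end.

Lemma yrep_finy z : (yrep (hub z) (hubc z)).2 = (finy z)%:R /\
  (~~ finy z -> (yrep (hub z) (hubc z)).1 = 1).
Proof. by case: z => //= *; rewrite /yrep /= ?mulr0 ?mul0r. Qed.

Lemma cluster_finy (z1 z2 : Z) : cluster (nbhs z1) z2 -> finy z1 = finy z2.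
Proof.
move=> /cluster_y; rewrite /cross.
have [-> h1] := yrep_finy z1; have [-> h2] := yrep_finy z2.
move: h1 h2; case: (finy z1); case: (finy z2) => //= h1 h2.
  by rewrite h2 // mulr0 mulr1 => /esym/eqP; rewrite oner_eq0.
by rewrite h1 // mulr0 mulr1 => /eqP; rewrite oner_eq0.
Qed.

Lemma zrep_armof z : ~~ finy z -> match armof z with
  | Some e => zrep (hub z) (hubc z) = (if e then a else 0, 1)
  | None => exists2 t, zrep (hub z) (hubc z) = (1, t) & a * t != 1
  end.
Proof.
case: z => //= [_|s _|[] l _|[] u _|[] _|[] w _|[] v _];
  rewrite /zrep /gk /= ?expr0n /= ?(mulr0, mul0r, expr0n, addr0, subr0) //=.
- by exists 0 => //; rewrite mulr0 eq_sym oner_eq0.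
- exists (val s)^-1 => //; apply/eqP => h; move/eqP: (a4pt_neqa s); apply.
  by rewrite -[LHS]mul1r -h mulfVK // a4pt_neq0.
Qed.

(** At y = oo the function r / y^2 is 0 on one arm, a on the other, and neither of these on [Q4] and
    [N4]. *)
Lemma cluster_armof (z1 z2 : Z) : cluster (nbhs z1) z2 -> ~~ finy z1 ->
  armof z1 = armof z2.
Proof.
move=> cl f1; have f2 : ~~ finy z2 by rewrite -(cluster_finy cl).
have := cluster_z cl; rewrite /cross.
have e1 := zrep_armof f1; have e2 := zrep_armof f2.
case: (armof z1) e1 => [e1 ->|[t -> t1]]; case: (armof z2) e2 => [e2 ->|[t' -> t1']] //=.
- by case: e1; case: e2 => //; rewrite !mulr1 => /eqP; rewrite ?[0 == a]eq_sym (negPf a0).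
- by case: e1 => /eqP; rewrite mul1r ?mul0r ?(negPf t1') // eq_sym oner_eq0.
- by case: e2 => /eqP; rewrite eq_sym mul1r ?mul0r ?(negPf t1) // eq_sym oner_eq0.
Qed.

Lemma cluster_hub_arm (z1 z2 : Z) e : cluster (nbhs z1) z2 ->
  armof z1 = Some e -> armof z2 = Some e -> hub z1 = hub z2.
Proof.
move=> cl; have ha n := cluster_arm cl e n; move: ha {cl}.
have fin0 : (0 : C) = 1 -> False by move/esym/eqP; rewrite oner_eq0.
have fin1 : (1 : C) = 0 -> False by move/esym.
case: z1 => //= [e1 l|e1 u|e1|e1 w|e1 v] ha [] ee; rewrite ee in ha *;
case: z2 ha => //= [e' l'|e' u'|e'|e' w'|e' v'] ha [] ee'; rewrite ee' in ha *=> //;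
exfalso; rewrite /arepe /cross /= eqxx in ha; move: (ha 0) (ha 1) (ha 2) (ha 3) => {ha} /=;
rewrite !(mulr0, mul0r, mulr1, mul1r, expr0n, addr0, subr0, add0r, sub0r) /=;
by move=> h0 h1 h2 h3; first [exact: fin0 h0|exact: fin1 h0|exact: fin0 h1
 |exact: fin1 h1|exact: fin0 h2|exact: fin1 h2|exact: fin0 h3|exact: fin1 h3].
Qed.

(** Inside one chart the norm separates points, so it suffices to recover the hub from values of
    functions: finiteness of y, then r if y is finite, and otherwise r / y^2 followed by the
    functions of the arm. *)
Lemma Zsurf_hausdorff : hausdorff_space Z.
Proof.
move=> z1 z2 cl; apply: (cluster_hub cl).
have fE := cluster_finy cl; case f1 : (finy z1).
  rewrite f1 in fE; move: (cluster_r cl) f1 fE.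
  case: (z1) => // [r y|y] + _.
    case: (z2) => //= y'; rewrite /cross /= => + _.
    by move=> /eqP; rewrite mulr0 mulr1 eq_sym oner_eq0.
  case: (z2) => //= r' y'; rewrite /cross /= => + _.
  by move=> /eqP; rewrite mulr1 mulr0 oner_eq0.
have aE := cluster_armof cl (negbT f1).
case a1 : (armof z1) => [e|].
  by apply: (cluster_hub_arm cl a1); rewrite -aE.
rewrite a1 in aE; rewrite f1 in fE.
by move: f1 a1 fE aE; case: (z1) => //= [|s]; case: (z2).
Qed.

End Topology.

(** * Compactness and connectedness of the surface *)

Section Compactness.
Variables (C : numClosedFieldType) (a b : C).
Hypothesis a0 : a != 0.
Hypothesis disc_compact : forall M : C, compact [set z : C | `|z| <= M].
Hypothesis C2_connected : connected [set: C * C].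

Notation cpar := (@cpar C a).
Notation par := (@par C a b).
Notation dom := (@dom C a).
Notation jpt := (@jpt C a b).
Notation Z := (Zsurf b a0).
Notation ftor := (fpol a b).

Definition polydisc (M N : C) : set (C * C) := [set p | `|p.1| <= M /\ `|p.2| <= N].

Lemma polydisc_compact M N : compact (polydisc M N).
Proof. exact: (compact_setX (disc_compact (M := M)) (disc_compact (M := N))). Qed.

Definition g4 (y : C) := a + a * y + b * y ^+ 2.

Definition K4 : set (C * C) :=
  [set p | `|p.1| * (`|a| / 3) <= `|p.1 * g4 p.2 - 1|].

(** Compact pieces that cover the surface together with their images by j. In [c43] the radius |a| /
    3 keeps away from z = a; [K4] is the condition |[fpol] y - r| >= |y|^2 |a| / 3 multiplied by
    |u|, so that u = 0 is included. In [c21] the radius 1 / 2 keeps away from -1, and |r y| < 2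
    forces |x| <= 3, the radius in [c1]. *)
Definition Kset (k : cix) : set (C * C) :=
  match k with
  | c4 => polydisc (3 / `|a|) 1 `&` K4
  | c43 => polydisc (`|a| / 3) 1
  | c21 => polydisc 1 2^-1
  | c1 => polydisc 3 1
  | _ => polydisc 1 1
  end.

Lemma na_gt0 : 0 < `|a|. Proof. by rewrite normr_gt0. Qed.

Lemma Kset_dom k : Kset k `<=` cdomain a k.
Proof.
have na := na_gt0.
case: k => //= -[u v].
- move=> [_]; rewrite /K4 /= => H [uE vE]; move: H; rewrite uE vE.
  rewrite /g4 mulr0 expr0n /= mulr0 !addr0 mulVf // subrr normr0.
  rewrite normfV mulrA mulVf ?gt_eqF // mul1r invr_le0.
  by rewrite (lt_geF (ltr0n C 3)).
- move=> [+ _] /= => + [uE _]; rewrite uE.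
  rewrite ler_pdivlMr ?ltr0n // ger_pMr // => h.
  by have := lt_le_trans (ltr_nat C 1 3) h; rewrite ltxx.
- move=> [_] /= => + [_ vE]; rewrite vE normrN normr1.
  rewrite invf_ge1 ?ltr0n // => h.
  by have := lt_le_trans (ltr_nat C 1 2) h; rewrite ltxx.
Qed.

Lemma K4_closed : closed K4.
Proof.
pose h (p : C * C) : C := `|p.1| * (`|a| / 3) - `|p.1 * g4 p.2 - 1|.
have hreal p : h p \is Num.real.
  by rewrite realB ?realM ?normr_real // ?realV ?realn ?realE ?normr_ge0.
have -> : K4 = ~` [set p | 0 < h p].
  apply/seteqP; split => p; rewrite /K4 /=.
    by rewrite -subr_le0 => hp /(lt_le_trans)/(_ hp); rewrite ltxx.
  move=> /negP; rewrite -subr_le0 -/(h p).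
  by case: (real_ltP (real0 C) (hreal p)).
apply: open_closedC; rewrite openE => p /= hp.
have cn (f : C * C -> C) : differentiable f p -> {for p, continuous (fun q => `|f q|)}.
  move=> /differentiable_continuous cf.
  by apply: (@continuous_comp _ _ _ f (fun z : C => `|z|)) => //; exact: norm_continuous.
have hc : h @ p --> h p.
  apply: cvgB; last by apply: cn; rewrite /g4; diffs.
  by apply: cvgM; [apply: cn; diffs|exact: cvg_cst].
have /cvgrPdist_lt/(_ _ hp) := hc.
rewrite /interior /=; apply: filterS => q /=.
have := real_ler_norm (realB (hreal p) (hreal q)) => h1 h2.
by have := le_lt_trans h1 h2; rewrite ltrBlDr ltrDl.
Qed.

Lemma Kset_compact k : compact (Kset k).
Proof.
case: k => /=; try exact: polydisc_compact.
apply: compact_closedI; [exact: polydisc_compact|exact: K4_closed].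
Qed.

Lemma par_compact e k : compact (par (e, k) @` Kset k : set Z).
Proof.
apply: continuous_compact; last exact: Kset_compact.
apply: continuous_in_subspaceT => p; rewrite inE => Kp.
by apply: par_cts; exact: Kset_dom.
Qed.

Definition covered (z : pts a) := exists i p, Kset i.2 p /\ par i p = z.

Lemma norm_cases (x y : C) : (`|x| <= `|y|) || (`|y| < `|x|).
Proof. by case: (real_leP (normr_real x) (normr_real y)). Qed.

(** The chart is found by walking along the arm from [Q4] to the section, with the successive tests
    |y| <= |r|, 1 <= |r|, 2 <= |r y| and 1 <= |x y|. *)
Lemma cover_arm_Aff e r y : 1 < `|y| -> `|r / y ^+ 2| <= `|a| / 3 ->
  exists k p, Kset k p /\ par (e, k) p = jif b e (Aff a r y).
Proof.
move=> y1 ry; have y0 : y != 0 by rewrite -normr_gt0 (lt_trans ltr01).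
have yi : `|y^-1| <= 1 by rewrite normfV invf_le1 ?normr_gt0 // ltW.
have mk k : coordcond k (r, y) -> Kset k (affcoord a k (r, y)) ->
    exists k p, Kset k p /\ par (e, k) p = jif b e (Aff a r y).
  by move=> cc Kk; exists k, (affcoord a k (r, y)); rewrite /par affcoordK.
case/orP: (norm_cases y r) => [yr|ry1].
  have r0 : r != 0 by rewrite -normr_gt0 (lt_le_trans _ yr) // normr_gt0.
  apply: (mk c43); rewrite /= ?r0 ?y0 //; split => //=.
  by rewrite normf_div ler_pdivrMr ?normr_gt0 // mul1r.
case/orP: (norm_cases 1 r) => [|]; rewrite normr1 => r1.
  have r0 : r != 0 by rewrite -normr_gt0 (lt_le_trans ltr01 r1).
  apply: (mk c32); rewrite /= ?r0 ?y0 //; split => /=.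
    by rewrite normfV invf_le1 ?normr_gt0.
  by rewrite normf_div ler_pdivrMr ?normr_gt0 // mul1r ltW.
case/orP: (norm_cases 2 (r * y)) => [|]; rewrite (normr_nat C 2) => w2.
  have w0 : r * y != 0 by rewrite -normr_gt0 (lt_le_trans _ w2).
  have r0 : r != 0 by apply: contraNneq w0 => ->; rewrite mul0r.
  apply: (mk c21); rewrite /= ?r0 ?y0 //; split => /=; first exact: ltW.
  by rewrite normfV lef_pV2 ?qualifE /= ?normr_gt0.
have w3 : `|r * y + 1| <= 3.
  apply: le_trans (ler_normD _ _) _; rewrite normr1.
  by rewrite (_ : 3 = 2 + 1) ?lerD2r ?(ltW w2) // -natr1.
case/orP: (norm_cases 1 ((r * y + 1) * y)) => [|]; rewrite normr1 => v1.
  have v0 : (r * y + 1) * y != 0 by rewrite -normr_gt0 (lt_le_trans ltr01 v1).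
  have w0 : r * y + 1 != 0 by apply: contraNneq v0 => ->; rewrite mul0r.
  apply: (mk c1); rewrite /= ?y0 ?w0 //; split => //=.
  by rewrite normfV invf_le1 ?normr_gt0.
by apply: (mk cS); rewrite /= ?y0 //; split => //=; exact: ltW.
Qed.

Lemma covered_all z : covered z.
Proof.
have na := na_gt0.
have cle i p : Kset i.2 p -> covered (par i p) by move=> Kp; exists i, p.
have inv1 (x : C) : 1 < `|x| -> `|x^-1| <= 1.
  by move=> x1; rewrite normfV invf_le1 ?ltW // (lt_trans ltr01).
have na3 : `|a / 3| = `|a| / 3 by rewrite normf_div (normr_nat C 3).
have a3 : `|a| / 3 != 0 by rewrite mulf_neq0 ?gt_eqF ?invr_gt0 ?ltr0n.
have n0 : `|0 : C| <= 1 by rewrite normr0 ler01.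
case: z => [r y|y||s|e l|e u|e|e w|e v].
- case/orP: (norm_cases y 1); rewrite normr1 => y1.
    case/orP: (norm_cases r 1); rewrite normr1 => r1.
      by apply: (cle (false, c0) (r, y)).
    have r0 : r != 0 by rewrite -normr_gt0 (lt_trans ltr01).
    have := cle (false, cB) (r^-1, y); rewrite /par /= invr_eq0 (negPf r0) invrK.
    by apply; split => //=; exact: inv1.
  have y0 : y != 0 by rewrite -normr_gt0 (lt_trans ltr01).
  case/orP: (norm_cases (r / y ^+ 2) (a / 3)) => h1; rewrite na3 in h1.
    have [k [p [Kp pE]]] := cover_arm_Aff false y1 h1.
    by exists (false, k), p.
  case/orP: (norm_cases ((ftor y - r) / y ^+ 2) (a / 3)) => h2; rewrite na3 in h2.
    have [k [p [Kp]]] := cover_arm_Aff true y1 h2.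
    rewrite /jif /= opprB addrC subrK => <-.
    by exists (true, k), p.
  have z0 : r / y ^+ 2 != 0.
    by rewrite -normr_gt0 (le_lt_trans _ h1) // divr_ge0 ?normr_ge0 ?ler0n.
  have r0 : r != 0 by apply: contraNneq z0 => ->; rewrite mul0r.
  suff K : Kset c4 (affcoord a c4 (r, y)).
    have := cle (false, c4) _ K; rewrite /par affcoordK //=.
    by rewrite r0 y0.
  split; first split => /=.
  - rewrite -[y ^+ 2 / r]invf_div normfV -[3 / _]invf_div.
    by rewrite lef_pV2 ?qualifE /= ?normr_gt0 ?ltW // divr_gt0 ?ltr0n.
  - exact: inv1.
  - rewrite /K4 /= (_ : y ^+ 2 / r * g4 y^-1 - 1 = y ^+ 2 / r * ((ftor y - r) / y ^+ 2)).
      by rewrite [leRHS]normrM ler_wpM2l ?normr_ge0 // ltW.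
    by rewrite /g4 /fpol; field; rewrite r0 y0.
- case/orP: (norm_cases y 1); rewrite normr1 => y1.
    by have := cle (false, cB) (0, y); rewrite /par /= eqxx; apply.
  have y0 : y != 0 by rewrite -normr_gt0 (lt_trans ltr01).
  have := cle (false, c4) (0, y^-1); rewrite /par /= invr_eq0 (negPf y0) eqxx invrK.
  apply; split; first split; rewrite /= ?normr0 ?divr_ge0 ?ler0n ?normr_ge0 ?inv1 //.
  by rewrite /K4 /= normr0 !mul0r normr_ge0.
- have := cle (false, c4) (0, 0); rewrite /par /= !eqxx; apply; split; first split;
    rewrite /= ?normr0 ?divr_ge0 ?ler0n ?normr_ge0 ?ler01 //.
  by rewrite /K4 /= normr0 !mul0r normr_ge0.
- have s0 := a4pt_neq0 s; have sa := a4pt_neqa s.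
  have as0 : a - val s != 0 by rewrite subr_eq0 eq_sym.
  case/orP: (norm_cases (val s) (a / 3)) => h1; rewrite na3 in h1.
    have := cle (false, c43) (val s, 0).
    by rewrite /par /= [sval s == 0](negPf s0) eqxx mkP4_val; apply.
  case/orP: (norm_cases (a - val s) (a / 3)) => h2; rewrite na3 in h2.
    have := cle (true, c43) (a - val s, 0).
    rewrite /par /= [a - sval s == 0](negPf as0) eqxx.
    rewrite jptM //; last by rewrite -subr_eq0 addrC addKr oppr_eq0.
    by rewrite subKr mkP4_val; apply.
  have := cle (false, c4) ((val s)^-1, 0).
  rewrite /par /= eqxx invr_eq0 [sval s == 0](negPf s0) invrK mkP4_val; apply.
  split; first split => /=.
  - by rewrite normfV -[3 / _]invf_div lef_pV2 ?qualifE /= ?normr_gt0 ?ltW // divr_gt0 ?ltr0n.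
  - exact: n0.
  - rewrite /K4 /= (_ : (val s)^-1 * g4 0 - 1 = (val s)^-1 * (a - val s)).
      by rewrite [leRHS]normrM ler_wpM2l ?normr_ge0 // ltW.
    by rewrite /g4 mulr0 expr0n /= mulr0 !addr0 mulrBr mulVf.
- case/orP: (norm_cases l 1); rewrite normr1 => l1.
    have := cle (e, c43) (0, l); rewrite /par /= eqxx.
    by case: (e) => /=; apply; split; rewrite /= ?normr0 ?divr_ge0 ?ler0n ?normr_ge0.
  have l0 : l != 0 by rewrite -normr_gt0 (lt_trans ltr01).
  have := cle (e, c32) (0, l^-1); rewrite /par /= invr_eq0 (negPf l0) eqxx invrK.
  by case: (e) => /=; apply; split => //=; exact: inv1.
- case/orP: (norm_cases u 1); rewrite normr1 => u1.
    have := cle (e, c32) (u, 0); rewrite /par /= eqxx.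
    by case: (e) => /=; apply; split.
  have u0 : u != 0 by rewrite -normr_gt0 (lt_trans ltr01).
  have := cle (e, c21) (u^-1, 0); rewrite /par /= invr_eq0 (negPf u0) eqxx invrK.
  by case: (e) => /=; apply; split; rewrite /= ?normr0 ?invr_ge0 ?ler0n ?inv1.
- have := cle (e, c21) (0, 0); rewrite /par /= !eqxx.
  by case: (e) => /=; apply; split; rewrite /= ?normr0 ?invr_ge0 ?ler0n ?ler01.
- case/orP: (norm_cases w 3); rewrite (normr_nat C 3) => w3.
    have := cle (e, c1) (w, 0); rewrite /par /= eqxx.
    by case: (e) => /=; apply; split.
  have w2 : 2 <= `|w - 1|.
    have h : `|w| <= `|w - 1| + 1.
      by have := ler_normD (w - 1) 1; rewrite subrK normr1.
    by rewrite -(lerD2r 1); apply: le_trans h; rewrite -mulrSr ltW.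
  have w0 : w - 1 != 0 by rewrite -normr_gt0 (lt_le_trans _ w2).
  have := cle (e, c21) (0, (w - 1)^-1).
  rewrite /par /= eqxx invr_eq0 (negPf w0) invrK subrK.
  case: (e) => /=; apply; split; rewrite /= ?normr0 ?ler01 // normfV;
   by rewrite lef_pV2 ?qualifE /= ?normr_gt0.
- case/orP: (norm_cases v 1); rewrite normr1 => v1.
    have := cle (e, cS) (v, 0); rewrite /par /= eqxx.
    by case: (e) => /=; apply; split.
  have v0 : v != 0 by rewrite -normr_gt0 (lt_trans ltr01).
  have := cle (e, c1) (0, v^-1); rewrite /par /= invr_eq0 (negPf v0) eqxx invrK.
  by case: (e) => /=; apply; split; rewrite /= ?normr0 ?ler0n ?inv1.
Qed.

Lemma Zsurf_compact : compact [set: Z].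
Proof.
pose U e : set Z := \big[setU/set0]_(k <- [:: c0; cB; c4; c43; c32; c21; c1; cS])
  (par (e, k) @` Kset k).
have -> : [set: Z] = U false `|` U true.
  apply/seteqP; split=> // z _; have [[e k] [p [Kp pz]]] := covered_all z.
  suff Uz : U e z by case: (e) Uz => ?; [right|left].
  by rewrite /U !big_cons big_nil; case: k Kp pz => Kp pz; do ?[by left; exists p | right].
by apply: compactU; apply: bigsetU_compact => k _; exact: par_compact.
Qed.

Lemma Zsurf_connected : connected [set: Z].
Proof.
have -> : [set: Z] = closure (par (false, c0) @` setT : set Z).
  apply/seteqP; split => // z _ U /Aff_dense [r [y [_ Ury]]].
  by exists (Aff a r y); split => //; exists (r, y).
apply: connected_closure; apply: connected_continuous_connected => //.
by apply: continuous_subspaceT => p; exact: (@par_cts _ _ b a0 (false, c0)).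
Qed.

End Compactness.

(** * Compact discs of C and connectedness of C^2 *)

Section ComplexTopology.
Variable R : realType.
Let C : numClosedFieldType := R[i].

Lemma normc_real (x : R) : `|x%:C%C| = (`|x|)%:C%C :> C.
Proof. by rewrite normc_def /= expr0n /= addr0 sqrtr_sqr. Qed.

Lemma real_complex_continuous : continuous (fun x : R => x%:C%C : C).
Proof.
move=> x; apply/cvgrPdist_lt => e e0.
have eE : e = (complex.Re e)%:C%C by rewrite RRe_real // gtr0_real.
have e0' : 0 < complex.Re e by move: e0; rewrite {1}eE ltcR.
near=> y; rewrite -rmorphB /= normc_real eE ltcR.
by near: y; have /cvgrPdist_lt := @cvg_id _ (nbhs x); apply.
Unshelve. all: by end_near. Qed.

Lemma complex_pair_continuous :
  continuous (fun p : R * R => (p.1 +i* p.2)%C : C).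
Proof.
move=> p.
rewrite (_ : (fun p => _) = fun p : R * R => p.1%:C%C + 'i%C * p.2%:C%C); last first.
  by apply/funext => q; rewrite [LHS]complexE.
apply: cvgD; last apply: cvgM; last 1 first.
- apply: (@continuous_comp _ _ _ snd (fun x : R => x%:C%C : C)); first exact: cvg_snd.
  exact: real_complex_continuous.
- apply: (@continuous_comp _ _ _ fst (fun x : R => x%:C%C : C)); first exact: cvg_fst.
  exact: real_complex_continuous.
- exact: cvg_cst.
Qed.

Lemma complex_disc_compact (M : C) : compact [set z : C | `|z| <= M].
Proof.
have [Mr|Mr] := boolP (M \is Num.real); last first.
  rewrite (_ : [set z | _] = set0); first exact: compact0.
  apply/seteqP; split => // z /= zM; move/negP: Mr; apply.
  by rewrite (ger_real zM) normr_real.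
have ME : M = (complex.Re M)%:C%C by rewrite RRe_real.
set m := complex.Re M in ME.
pose A := [set p : R * R | Num.sqrt (p.1 ^+ 2 + p.2 ^+ 2) <= m].
have -> : [set z : C | `|z| <= M] = (fun p : R * R => (p.1 +i* p.2)%C : C) @` A.
  rewrite ME; apply/seteqP; split => [[x y]|_ [[x y] /= h <-]].
    by rewrite /= normc_def lecR /= => h; exists (x, y).
  by rewrite /= normc_def lecR.
apply: continuous_compact.
  by apply: continuous_subspaceT; exact: complex_pair_continuous.
apply: (@subclosed_compact _ _ (`[-m, m]%classic `*` `[-m, m]%classic)).
- apply: (preimage_closed (f := fun p : R * R => Num.sqrt (p.1 ^+ 2 + p.2 ^+ 2)) (D := [set t | t <= m])).
    move=> p _; apply: (@continuous_comp _ _ _ (fun p : R * R => p.1 ^+ 2 + p.2 ^+ 2) Num.sqrt).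
      apply: cvgD; rewrite !expr2 /=.
        by under eq_fun do rewrite expr2; apply: cvgM; exact: cvg_fst.
      by under eq_fun do rewrite expr2; apply: cvgM; exact: cvg_snd.
    exact: sqrt_continuous.
  exact: closed_le.
- by apply: compact_setX; exact: segment_compact.
- move=> [x y] /= h; have m0 : 0 <= m by apply: le_trans h; exact: sqrtr_ge0.
  have le1 (u v : R) : Num.sqrt (u ^+ 2 + v ^+ 2) <= m -> `|u| <= m.
    by apply: le_trans; rewrite -sqrtr_sqr ler_sqrt ?lerDl ?sqr_ge0 // addr_ge0 ?sqr_ge0.
  split; rewrite /= in_itv /= -ler_norml; first exact: (le1 _ _ h).
  by apply: (le1 _ x); rewrite addrC.
Qed.

(** The plane is a union of real lines through the origin. *)
Lemma complex2_connected : connected [set: (C * C)%type].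
Proof.
pose f (p : C * C) (t : R) : C * C := (t%:C%C * p.1, t%:C%C * p.2).
have fc p : continuous (f p).
  have c1 (u : C) t : {for t, continuous (fun t : R => t%:C%C * u : C)}.
    by apply: cvgM; [exact: real_complex_continuous|exact: cvg_cst].
  by move=> t; exact: (cvg_pair (c1 p.1 t) (c1 p.2 t)).
have -> : [set: (C * C)%type] = \bigcup_(p in [set: (C * C)%type]) (f p @` setT).
  apply/seteqP; split => // p _; exists p => //; exists 1 => //.
  by rewrite /f !mul1r -surjective_pairing.
apply: bigcup_connected.
  by exists (0, 0) => p _; exists 0 => //; rewrite /f !mul0r.
move=> p _; apply: connected_continuous_connected.
  by apply/connected_intervalP.
by apply: continuous_subspaceT; exact: fc.
Qed.

End ComplexTopology.

(** * The involutions on the surface *)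

Section Automorphism.
Variables (C : numClosedFieldType) (a b : C).
Hypothesis a0 : a != 0.

Notation cpar := (@cpar C a).
Notation par := (@par C a b).
Notation dom := (@dom C a).
Notation jpt := (@jpt C a b).
Notation Z := (Zsurf b a0).
Notation ftor := (fpol a b).

(** The limits at infinity of (r, - y - 1 - 1 / r). The line r = 0 is exchanged with the section
    [PS false], as x y tends to y + 1 along the image; every component of the fibre at infinity is
    preserved, and [PS true] is fixed pointwise. *)
Definition ipt (z : pts a) : pts a :=
  match z with
  | Aff r y => if r == 0 then PS a false (y + 1) else Aff a r (- y - 1 - r^-1)
  | PB y => PB a (- y - 1)
  | Q3 e l => Q3 a e (- l)
  | Q1 e w => Q1 a e (if e then - w else 1 - w)
  | PS false v => Aff a 0 (v - 1)
  | z => z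
  end.

Lemma iptK : involutive ipt.
Proof.
case=> //= [r y|y|e l|e w|[] v] //=.
- case: eqVneq => [->|r0] /=; first by rewrite addrK.
  by rewrite (negPf r0); congr Aff; ring.
- by congr PB; ring.
- by rewrite opprK.
- by case: e; congr Q1; ring.
- by rewrite eqxx subrK.
Qed.

Lemma par_holomorphic (f : Z -> Z) i j p (g : C * C -> C * C) :
  dom i p -> dom j (g p) -> differentiable g p ->
  (\forall p' \near p, par j (g p') = f (par i p')) ->
  holomorphic_at f (par i p : Z).
Proof.
move=> Dp Dq dg ng.
have cg := differentiable_continuous dg.
have gz : \forall p' \near p, dom j (g p').
  apply: (cg (dom j)); apply: open_nbhs_nbhs; split => //; exact: dom_open.
have fp := nbhs_singleton ng.
apply: (@holomorphic_at_chart _ _ _ Z Z f (glue_chart (L := Zglue b a0) i)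
   (glue_chart (L := Zglue b a0) j)).
- exact: (glue_atlasP (L := Zglue b a0)).
- exact: (glue_atlasP (L := Zglue b a0)).
- by exists p.
- by exists (g p).
- move=> U; rewrite -fp => Uf.
  have N : \forall p' \near p, U (f (par i p')).
    have : \forall p' \near p, U (par j (g p')) by exact: (cg _ (par_cts Dq Uf)).
    by move=> h; near=> p'; rewrite -(_ : par j (g p') = f (par i p')); near: p'.
  have := par_nbhs b a0 Dp N; rewrite /= nbhs_simpl.
  by apply: filterS => z [p' [Up' _] <-].
- rewrite /= zcoordK //; apply: near_differentiable dg.
  near=> p' => /=; rewrite -(_ : par j (g p') = f (par i p')); last by near: p'.
  by rewrite zcoordK //; near: p'.
Unshelve. all: by end_near. Qed.

(** Between the charts (e, k) and (not e, k), j is the identity of C^2. *)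
Lemma jpt_holomorphic (z : Z) : holomorphic_at (jpt : Z -> Z) z.
Proof.
rewrite -(hub_par b z); case E : (hub z) => [e k].
have Dz := hub_dom a0 z; rewrite E in Dz.
apply: (@par_holomorphic jpt _ (~~ e, k) _ id).
- exact: Dz.
- exact: Dz.
- exact: diff_idf.
- by near=> p'; rewrite /par /=; case: (e) => //=; rewrite jptK.
Unshelve. all: by end_near. Qed.

(** D collects the denominators of g; the identity is only needed where it does not vanish. *)
Lemma par_holomorphic_neq0 (f : Z -> Z) i j p (g : C * C -> C * C) (D : C * C -> C) :
  dom i p -> dom j (g p) -> differentiable g p -> differentiable D p -> D p != 0 ->
  (forall u v, D (u, v) != 0 -> par j (g (u, v)) = f (par i (u, v))) ->
  holomorphic_at f (par i p : Z).
Proof.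
move=> Dp Dq dg dD D0 H; apply: (par_holomorphic Dp Dq dg).
have n := near_diff_neq0 dD D0.
by near=> p'; rewrite [p']surjective_pairing; apply: H; rewrite -surjective_pairing;
  near: p'.
Unshelve. all: by end_near. Qed.

Lemma ipt_holomorphic_Aff r y : holomorphic_at (ipt : Z -> Z) (Aff a r y : Z).
Proof.
have [->|r0] := eqVneq r 0.
  (* Near r = 0 the image has 1 / y' = - r / (r y + r + 1) and x' y' = (y + 1)(r y + r + 1), which
     are the coordinates of [cS]. *)
  apply: (@par_holomorphic_neq0 _ (false, c0) (false, cS) (0, y)
     (fun p => ((p.2 + 1) * (p.1 * p.2 + p.1 + 1), - p.1 / (p.1 * p.2 + p.1 + 1)))
     (fun p => p.1 * p.2 + p.1 + 1)) => //=.
  - by diffs => /=; rewrite mul0r !add0r oner_eq0.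
  - by diffs.
  - by rewrite mul0r !add0r oner_eq0.
  move=> u v h; rewrite /par /= mulf_eq0 oppr_eq0 invr_eq0 (negPf h) orbF.
  case: eqVneq => [->|u0]; first by rewrite mul0r !add0r mulr1.
  by congr Aff; field; rewrite ?u0 ?h.
apply: (@par_holomorphic_neq0 _ (false, c0) (false, c0) (r, y)
   (fun p => (p.1, - p.2 - 1 - p.1^-1)) fst) => //=.
- by diffs.
- by diffs.
by move=> u v u0; rewrite /par /= (negPf u0).
Qed.

Lemma ipt_holomorphic_PB y : holomorphic_at (ipt : Z -> Z) (PB a y : Z).
Proof.
rewrite -(hub_par b (PB a y)).
apply: (@par_holomorphic_neq0 _ (false, cB) (false, cB) (0, y)
   (fun p => (p.1, - p.2 - 1 - p.1)) (fun=> 1)) => //=; do ?[by diffs|exact: oner_neq0].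
move=> u v _; rewrite /par /=.
case: (eqVneq u 0) => [->|h] /=; first by rewrite subr0.
by rewrite invr_eq0 (negPf h) invrK.
Qed.

Lemma mkP4_fix z : ipt (mkP4 a z) = mkP4 a z.
Proof. by rewrite /mkP4; case: insub. Qed.

(** Here and in the next three lemmas m is the factor in y' = - m y. It is regular in the chart and
    equals 1 at the point considered, while r is unchanged. *)
Lemma ipt_holomorphic_c4 t : dom (false, c4) (t, 0) ->
  holomorphic_at (ipt : Z -> Z) (par (false, c4) (t, 0) : Z).
Proof.
move=> Dt; pose m (p : C * C) := 1 + p.2 + p.1 * p.2 ^+ 3.
have m0 : m (t, 0) = 1 by rewrite /m /= expr0n /= mulr0 !addr0.
apply: (@par_holomorphic_neq0 _ (false, c4) (false, c4) (t, 0)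
   (fun p => (p.1 * m p ^+ 2, - p.2 / m p)) m) => //.
- by rewrite m0 /= oppr0 mul0r expr1n mulr1.
- by rewrite /m; diffs; rewrite -/(m (t, 0)) m0 oner_eq0.
- by rewrite /m; diffs.
- by rewrite m0 oner_eq0.
move=> u v; rewrite /m /par /= => p1.
rewrite !mulf_eq0 oppr_eq0 !invr_eq0 ?mulf_eq0 ?expf_eq0 /= (negPf p1) !orbF.
case: (eqVneq v 0) => [->|h2]; case: (eqVneq u 0) => [h1|h1] //=.
- by rewrite mkP4_fix expr0n /= mulr0 !addr0 expr1n mulr1.
- rewrite h1 mul0r addr0 in p1 *.
  by congr PB; field; rewrite h2 p1.
- rewrite invr_eq0 mulf_eq0 expf_eq0 /= (negPf h1) (negPf h2) /=.
  by congr Aff; field; rewrite ?h2 ?p1 ?h1.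
Qed.

Lemma ipt_holomorphic_Q3f l : holomorphic_at (ipt : Z -> Z) (Q3 a false l : Z).
Proof.
rewrite -(hub_par b (Q3 a false l)).
pose m (p : C * C) := 1 + p.1 * p.2 + p.1 ^+ 2 * p.2 ^+ 3.
have m0 : m (0, l) = 1 by rewrite /m /= expr0n /= !mul0r !addr0.
have D0 x : dom (false, c43) (0, x) by case=> /esym/eqP; rewrite (negPf a0).
apply: (@par_holomorphic_neq0 _ (false, c43) (false, c43) (0, l)
   (fun p => (p.1 / m p ^+ 2, - p.2 * m p)) m) => //.
- by rewrite /= mul0r.
- by rewrite /m; diffs; rewrite -/(m (0, l)) m0 expr1n oner_eq0.
- by rewrite /m; diffs.
- by rewrite m0 oner_eq0.
move=> u v; rewrite /m /par /= => p1.
rewrite !mulf_eq0 oppr_eq0 !invr_eq0 ?mulf_eq0 ?expf_eq0 /= (negPf p1) !orbF.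
case: (eqVneq u 0) => [->|h1] /=.
  by rewrite expr0n /= !mul0r !addr0 mulr1.
case: (eqVneq v 0) => [->|h2].
  by rewrite mkP4_fix expr0n /= !mulr0 !addr0 expr1n divr1.
rewrite /= invr_eq0 mulf_eq0 expf_eq0 /= (negPf h1) (negPf h2) /=.
by congr Aff; field; rewrite ?h2 ?p1 ?h1.
Qed.

Lemma ipt_holomorphic_Q2f x : holomorphic_at (ipt : Z -> Z) (Q2 a false x : Z).
Proof.
rewrite -(hub_par b (Q2 a false x)).
pose m (p : C * C) := 1 + p.1 * p.2 + p.1 ^+ 2 * p.2.
have m0 : m (x, 0) = 1 by rewrite /m /= !mulr0 !addr0.
apply: (@par_holomorphic_neq0 _ (false, c32) (false, c32) (x, 0)
   (fun p => (p.1, - p.2 / m p)) m) => //.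
- by rewrite /m; diffs; rewrite -/(m (x, 0)) m0 oner_eq0.
- by rewrite /m; diffs.
- by rewrite m0 oner_eq0.
move=> u v; rewrite /m /par /= => p1.
rewrite !mulf_eq0 oppr_eq0 invr_eq0 (negPf p1) !orbF.
case: (eqVneq v 0) => [_|h2] //=.
case: (eqVneq u 0) => [h1|h1] /=.
  by rewrite h1 expr0n /= !mul0r !addr0 divr1 invrN.
rewrite /= invr_eq0 (negPf h1) /=.
by congr Aff; field; rewrite ?h2 ?p1 ?h1.
Qed.

Lemma dom_c21_0 e : dom (e, c21) (0, 0).
Proof. by case=> /esym/eqP; rewrite oppr_eq0 oner_eq0. Qed.

Lemma ipt_holomorphic_N21f : holomorphic_at (ipt : Z -> Z) (N21 a false : Z).
Proof.
rewrite -(hub_par b (N21 a false)).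
pose m (p : C * C) := 1 + p.2 * (1 + p.1).
have m0 : m (0, 0) = 1 by rewrite /m /= !mul0r !addr0.
apply: (@par_holomorphic_neq0 _ (false, c21) (false, c21) (0, 0)
   (fun p => (p.1, - p.2 / m p)) m).
- exact: dom_c21_0.
- by rewrite /= oppr0 mul0r; exact: dom_c21_0.
- by rewrite /m; diffs; rewrite -/(m (0, 0)) m0 oner_eq0.
- by rewrite /m; diffs.
- by rewrite m0 oner_eq0.
move=> u v; rewrite /m /par /= => p1.
rewrite !mulf_eq0 oppr_eq0 invr_eq0 (negPf p1) !orbF.
case: (eqVneq u 0) => [h1|h1] /=; case: (eqVneq v 0) => [_|h2] //=.
- by rewrite h1 addr0 mulr1 in p1 *; congr Q1; field; rewrite h2 p1.
- rewrite /= (negPf h1) /=.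
  by congr Aff; field; rewrite ?h2 ?p1 ?h1.
Qed.

Lemma ipt_holomorphic_Q1f x : holomorphic_at (ipt : Z -> Z) (Q1 a false x : Z).
Proof.
rewrite -(hub_par b (Q1 a false x)).
pose m (p : C * C) := 1 + (p.1 - 1) * p.2.
pose n (p : C * C) := 1 + p.1 * p.2.
have m0 : m (x, 0) = 1 by rewrite /m /= !mulr0 !addr0.
have n0 : n (x, 0) = 1 by rewrite /n /= !mulr0 !addr0.
apply: (@par_holomorphic_neq0 _ (false, c1) (false, c1) (x, 0)
   (fun p => ((1 - p.1) * n p, p.2 / (m p * n p))) (fun p => m p * n p)) => //.
- by rewrite /m /n; diffs; rewrite -/(m (x, 0)) -/(n (x, 0)) m0 n0 mul1r oner_eq0.
- by rewrite /m /n; diffs.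
- by rewrite m0 n0 mul1r oner_eq0.
move=> u v; rewrite mulf_eq0 negb_or /m /n /par /= => /andP[p1 p2].
rewrite !mulf_eq0 invr_eq0 !mulf_eq0 (negPf p1) (negPf p2) !orbF.
case: (eqVneq v 0) => [->|h2] /=; first by rewrite mulr0 addr0 mulr1.
have [h1|h1] := eqVneq (1 - u) 0.
  have u1 : u = 1 by apply/esym/eqP; rewrite -subr_eq0 h1.
  rewrite u1 oner_eq0 /= !mul1r subrr !mul0r addr0 eqxx in p1 p2 *.
  by congr PS; field; rewrite ?h2 ?p2.
have [h0|h0] := eqVneq u 0.
  rewrite h0 /= subr0 sub0r !mul0r !addr0 !mulr1 subrr !mul0r in p1 *.
  by congr Aff; field; rewrite ?h2 ?p1.
have u1 : u - 1 != 0 by rewrite -opprB oppr_eq0.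
rewrite /= !mulf_eq0 (negPf u1) (negPf h0) (negPf h2) /=.
by congr Aff; field; rewrite ?h2 ?p1 ?p2 ?h0 ?h1 ?u1.
Qed.

Lemma ipt_holomorphic_PSf x : holomorphic_at (ipt : Z -> Z) (PS a false x : Z).
Proof.
rewrite -(hub_par b (PS a false x)).
apply: (@par_holomorphic_neq0 _ (false, cS) (false, c0) (x, 0)
   (fun p => ((p.1 * p.2 - 1) * p.2,
     - (p.1 + (p.1 * p.2 - 1)) / (p.1 * p.2 - 1))) (fun p => p.1 * p.2 - 1)) => //.
- by diffs; rewrite /= mulr0 sub0r oppr_eq0 oner_eq0.
- by rewrite /= mulr0 sub0r oppr_eq0 oner_eq0.
move=> u v; rewrite /par /= => p1.
case: (eqVneq v 0) => [v0|h2] /=.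
  by rewrite v0 !mulr0 sub0r; congr Aff; field.
rewrite mulf_eq0 (negPf p1) (negPf h2) /=.
by congr Aff; field; rewrite ?h2 ?p1.
Qed.

(** For (r', y') = j iota j (r, y), with e = 1 / y and g = ([fpol] y - r) / y^2, [mm] is - y' / y
    and e [kk] is the increment r' - r = [fpol] y' - [fpol] y. Both are regular at e = 0, where g is
    nonzero on the second arm. *)
Definition kk (e g : C) := a * (2 + e) / g + a * e ^+ 3 / g ^+ 2.
Definition mm (e g : C) := 1 + e + e ^+ 3 / g.

(* The conjugate of [ipt] by [jpt], for y = 1/e and r = z/e^2. *)
Lemma conj_ipt e z X Y : let g := a + a * e + b * e ^+ 2 - z in
  e != 0 -> g != 0 -> X = z / e ^+ 2 + e * kk e g -> Y = - mm e g / e ->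
  jpt (Aff a X Y) = ipt (jpt (Aff a (z / e ^+ 2) e^-1)).
Proof.
move=> g e0 g0 -> ->.
have E : ftor e^-1 - z / e ^+ 2 = g / e ^+ 2 by rewrite /fpol /g; field.
rewrite /= E mulf_eq0 invr_eq0 expf_eq0 /= (negPf g0) (negPf e0) /=.
have zE : z = a + a * e + b * e ^+ 2 - g by rewrite /g; ring.
by rewrite zE /mm /kk /fpol; congr Aff; field; rewrite ?e0 ?g0.
Qed.

Section TrueArm.
Variable k : cix.
Let e (p : C * C) : C := etak k p.
Let g := gk a b k.
Let m p := mm (e p) (g p).
Let K p := kk (e p) (g p).

Lemma diff_mm p : g p != 0 -> differentiable m p.
Proof.
by move=> g0; have de := diff_etak k p; have dg := diff_gk a b k p; rewrite /m /mm; diffs.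
Qed.

Lemma diff_kk p : g p != 0 -> differentiable K p.
Proof.
move=> g0; have de := diff_etak k p; have dg := diff_gk a b k p.
by rewrite /K /kk; diffs; rewrite expf_neq0.
Qed.

Lemma mm0 p : e p = 0 -> zetak k p = 0 -> [/\ g p = a, m p = 1 & K p = 2].
Proof.
move=> e0 z0; have g0 : g p = a.
  by rewrite /g /gk z0 -/(e p) e0 expr0n /= !mulr0 !addr0 subr0.
rewrite /m /K /mm /kk e0 g0 expr0n /= mulr0 !mul0r !addr0; split => //.
by rewrite mulrAC divff // mul1r.
Qed.

Lemma conj_ipt_chart u v X Y : affcond k (u, v) -> arm k -> g (u, v) != 0 ->
  X = (affinv k (u, v)).1 + e (u, v) * K (u, v) -> Y = - m (u, v) / e (u, v) ->
  jpt (Aff a X Y) = ipt (jpt (cpar k (u, v))).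
Proof.
move=> h ak g0 XE YE; have cE := cpar_Aff a h.
have [yE e0] : (affinv k (u, v)).2 = (e (u, v))^-1 /\ e (u, v) != 0.
  by apply: etakE cE _ _; case: (k) ak.
have y0 : (affinv k (u, v)).2 != 0 by rewrite yE invr_eq0.
have zE := zetakE cE ak y0.
rewrite yE exprVn invrK in zE.
have rE : (affinv k (u, v)).1 = zetak k (u, v) / e (u, v) ^+ 2.
  by rewrite zE -mulrA mulfV ?mulr1 // expf_neq0.
rewrite cE yE rE; apply: conj_ipt => //; by rewrite -rE XE.
Qed.

End TrueArm.

Lemma ipt_holomorphic_Q3t l : holomorphic_at (ipt : Z -> Z) (Q3 a true l : Z).
Proof.
rewrite -(hub_par b (Q3 a true l)).
pose e (p : C * C) := etak c43 p; pose g := gk a b c43.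
pose m p := mm (e p) (g p); pose K p := kk (e p) (g p).
pose n p := 1 + p.1 ^+ 2 * p.2 ^+ 3 * K p.
have [g0 m0 K0] : [/\ g (0, l) = a, m (0, l) = 1 & K (0, l) = 2].
  by apply: mm0 => //=; rewrite mul0r.
have n0 : n (0, l) = 1 by rewrite /n /= expr0n /= !mul0r addr0.
have D0 x : dom (true, c43) (0, x) by case=> /esym/eqP; rewrite (negPf a0).
have g0' : g (0, l) != 0 by rewrite g0.
have dg : differentiable g (0, l) by exact: diff_gk.
have dm : differentiable m (0, l) by exact: diff_mm.
have dK : differentiable K (0, l) by exact: diff_kk.
have dn : differentiable n (0, l) by rewrite /n; diffs.
apply: (@par_holomorphic_neq0 _ (true, c43) (true, c43) (0, l)
   (fun p => (p.1 * n p / m p ^+ 2, - p.2 * m p / n p)) (fun p => g p * m p * n p)).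
- exact: D0.
- by rewrite /= !mul0r; exact: D0.
- by diffs; rewrite ?m0 ?n0 ?expr1n oner_eq0.
- by diffs.
- by rewrite g0 m0 n0 !mulr1.
move=> u v; rewrite !mulf_eq0 !negb_or => /andP[/andP[pg pm] pn].
rewrite /par /= -/(cpar c43 (u, v)) !mulf_eq0 oppr_eq0 !invr_eq0 ?expf_eq0 /=.
rewrite (negPf pm) (negPf pn) !orbF.
case: (eqVneq u 0) => [u0|u0].
  rewrite /= /n u0; have [_ -> _] : [/\ g (0, v) = a, m (0, v) = 1 & K (0, v) = 2].
    by apply: mm0 => //=; rewrite mul0r.
  by rewrite expr0n /= !mul0r addr0 mulr1 divr1.
case: (eqVneq v 0) => [v0|v0].
  rewrite (_ : u * n (u, v) / m (u, v) ^+ 2 = u).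
    by rewrite /jif /mkP4; case: insub => //= s; rewrite mkP4_fix.
  rewrite /n /m /mm /e /= v0 !mulr0 expr0n /= !mulr0 !mul0r !addr0.
  by rewrite expr1n divr1 mulr1.
rewrite /jif -[X in ipt (jpt X)](_ : cpar c43 (u, v) = _); last first.
  by rewrite /= (negPf u0) (negPf v0).
have c : affcond c43 (u, v) by rewrite /= u0 v0.
apply: conj_ipt_chart => //; rewrite -/(m (u, v)) /= -?/(K (u, v)).
  by rewrite /n /=; field; rewrite ?u0 ?v0 ?pm ?pn.
by rewrite /n /=; field; rewrite ?u0 ?v0 ?pm ?pn.
Qed.

Lemma ipt_holomorphic_Q2t x : holomorphic_at (ipt : Z -> Z) (Q2 a true x : Z).
Proof.
rewrite -(hub_par b (Q2 a true x)).
pose e (p : C * C) := etak c32 p; pose g := gk a b c32.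
pose m p := mm (e p) (g p); pose K p := kk (e p) (g p).
pose n p := 1 + p.1 * e p * K p.
have [g0 m0 K0] : [/\ g (x, 0) = a, m (x, 0) = 1 & K (x, 0) = 2].
  by apply: mm0 => /=; rewrite ?expr0n /= mulr0.
have n0 : n (x, 0) = 1 by rewrite /n /e /= !mulr0 !mul0r addr0.
have g0' : g (x, 0) != 0 by rewrite g0.
have dg : differentiable g (x, 0) by exact: diff_gk.
have de : differentiable e (x, 0) by rewrite /e /etak; diffs.
have dm : differentiable m (x, 0) by exact: diff_mm.
have dK : differentiable K (x, 0) by exact: diff_kk.
have dn : differentiable n (x, 0) by rewrite /n; diffs.
apply: (@par_holomorphic_neq0 _ (true, c32) (true, c32) (x, 0)
   (fun p => (p.1 / n p, - p.2 * n p / m p)) (fun p => g p * m p * n p)).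
- by [].
- by [].
- by diffs; rewrite ?m0 ?n0 oner_eq0.
- by diffs.
- by rewrite g0 m0 n0 !mulr1.
move=> u v; rewrite !mulf_eq0 !negb_or => /andP[/andP[pg pm] pn].
rewrite /par /= -/(cpar c32 (u, v)) !mulf_eq0 oppr_eq0 !invr_eq0 ?expf_eq0 /=.
rewrite (negPf pm) (negPf pn) !orbF.
case: (eqVneq v 0) => [v0|v0].
  by rewrite /= /n /e /= v0 !mulr0 !mul0r addr0 divr1.
case: (eqVneq u 0) => [u0|u0].
  rewrite /= /n u0; have [_ -> _] : [/\ g (0, v) = a, m (0, v) = 1 & K (0, v) = 2].
    by apply: mm0 => //=; rewrite mul0r.
  by rewrite /= !mul0r addr0 mulr1 divr1 invrN.
rewrite /jif -[X in ipt (jpt X)](_ : cpar c32 (u, v) = _); last first.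
  by rewrite /= (negPf u0) (negPf v0).
have c : affcond c32 (u, v) by rewrite /= u0 v0.
apply: conj_ipt_chart => //; rewrite -/(m (u, v)) /= -?/(K (u, v)).
  rewrite /n /e /= in pn *.
  by field; rewrite ?u0 ?v0 ?pm ?pn.
rewrite /n /e /= in pn *.
by field; rewrite ?u0 ?v0 ?pm ?pn.
Qed.

Lemma ipt_holomorphic_N21t : holomorphic_at (ipt : Z -> Z) (N21 a true : Z).
Proof.
rewrite -(hub_par b (N21 a true)).
pose e (p : C * C) := etak c21 p; pose g := gk a b c21.
pose m p := mm (e p) (g p); pose K p := kk (e p) (g p).
pose n p := 1 + p.2 * K p.
have [g0 m0 K0] : [/\ g (0, 0) = a, m (0, 0) = 1 & K (0, 0) = 2].
  by apply: mm0 => /=; rewrite ?expr0n /= mulr0.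
have n0 : n (0, 0) = 1 by rewrite /n /e /= !mul0r addr0.
have g0' : g (0, 0) != 0 by rewrite g0.
have dg : differentiable g (0, 0) by exact: diff_gk.
have dm : differentiable m (0, 0) by exact: diff_mm.
have dK : differentiable K (0, 0) by exact: diff_kk.
have dn : differentiable n (0, 0) by rewrite /n; diffs.
apply: (@par_holomorphic_neq0 _ (true, c21) (true, c21) (0, 0)
   (fun p => (p.1 * n p, - p.2 / (n p * m p))) (fun p => g p * m p * n p)).
- exact: dom_c21_0.
- by rewrite /= !mul0r oppr0 mul0r; exact: dom_c21_0.
- by diffs; rewrite ?m0 ?n0 mul1r oner_eq0.
- by diffs.
- by rewrite g0 m0 n0 !mulr1.
move=> u v; rewrite !mulf_eq0 !negb_or => /andP[/andP[pg pm] pn].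
rewrite /par /= -/(cpar c21 (u, v)) !mulf_eq0 oppr_eq0 !invr_eq0 ?mulf_eq0.
rewrite (negPf pm) (negPf pn) !orbF.
case: (eqVneq u 0) => [u0|u0].
  have [_ m1 K1] : [/\ g (u, v) = a, m (u, v) = 1 & K (u, v) = 2].
    by apply: mm0 => //=; rewrite u0 ?expr0n /= mul0r.
  rewrite m1 /n K1 /= in pn *; rewrite u0 eqxx; case: (eqVneq v 0) => [v0|v0] //=.
  by congr Q1; field; rewrite v0 pn.
case: (eqVneq v 0) => [v0|v0].
  by rewrite /= /n v0 /= mul0r addr0 mulr1 (negPf u0) eqxx.
rewrite /jif.
have c : affcond c21 (u, v) by rewrite /= u0 v0.
apply: conj_ipt_chart => //; rewrite -/(m (u, v)) /= -?/(K (u, v)).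
  by rewrite /n /e /= in pn *; ring.
rewrite /n /e /= in pn *.
by field; rewrite ?u0 ?v0 ?pm ?pn.
Qed.

Section TrueEnd.
Variables (e w : C).
Let z := w * e ^+ 3.
Let g := a + a * e + b * e ^+ 2 - z.
Let h := a + b * e - w * e ^+ 2.
(** As g = a + e h, the quotients ([mm] - 1) / e and ([kk] - 2) / e can be written without dividing
    by e: these are [mm1] and [kk1], and [qq] collects the terms of first order in the product (w +
    [kk]) [mm]. *)
Definition mm1 := 1 + e ^+ 2 / g.
Definition kk1 := (g * (a - (h + h)) + a * e ^+ 2) / g ^+ 2.
Definition qq := kk1 + (w + 2) * mm1 + e * kk1 * mm1.

(** With w = r y = x - 1, the left-hand side is x' = 1 + r' y' for j iota j. It restricts to - x on
    e = 0, and the explicit quotient by e is what the last two charts of the arm need. *)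
Lemma kk_qq : g != 0 -> 1 - (w + kk e g) * mm e g = - (w + 1) - e * qq.
Proof.
move=> g0; have zE : h = (g - a) / e \/ e = 0.
  case: (eqVneq e 0) => [|e0]; [by right|left].
  by rewrite /g /h /z; field.
case: zE => [hE|e0].
  case: (eqVneq e 0) => [e0|e0].
    rewrite /qq /kk /mm /kk1 /mm1 /g /z /h e0 !expr0n /= !(mulr0, mul0r, addr0, subr0).
    by field.
  by rewrite /qq /kk /mm /kk1 /mm1 hE; field; rewrite e0 g0.
rewrite /qq /kk /mm /kk1 /mm1 /g /z /h e0 !expr0n /= !(mulr0, mul0r, addr0, subr0).
by field.
Qed.
End TrueEnd.

Lemma ipt_holomorphic_Q1t x : holomorphic_at (ipt : Z -> Z) (Q1 a true x : Z).
Proof.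
rewrite -(hub_par b (Q1 a true x)).
pose e (p : C * C) := etak c1 p; pose g := gk a b c1.
pose m p := mm (e p) (g p); pose K p := kk (e p) (g p).
pose q p := qq (e p) (p.1 - 1).
(* Since e = u v in this chart, the correction e q is divisible by u, and x' = - u n. *)
pose n p := 1 + p.2 * q p.
have [g0 m0 K0] : [/\ g (x, 0) = a, m (x, 0) = 1 & K (x, 0) = 2].
  by apply: mm0 => /=; rewrite ?mulr0 ?expr0n /= ?mulr0.
have n0 : n (x, 0) = 1 by rewrite /n /e /= !mul0r addr0.
have g0' : g (x, 0) != 0 by rewrite g0.
have dg : differentiable g (x, 0) by exact: diff_gk.
have de : differentiable e (x, 0) by rewrite /e /etak; diffs.
have dm : differentiable m (x, 0) by exact: diff_mm.
have dK : differentiable K (x, 0) by exact: diff_kk.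
have gE p : a + a * e p + b * e p ^+ 2 - (p.1 - 1) * e p ^+ 3 = g p by [].
have dq : differentiable q (x, 0).
  pose h p := a + b * e p - (p.1 - 1) * e p ^+ 2.
  pose k1 p := (g p * (a - (h p + h p)) + a * e p ^+ 2) / g p ^+ 2.
  pose m1 p := 1 + e p ^+ 2 / g p.
  have -> : q = fun p => k1 p + (p.1 - 1 + 2) * m1 p + e p * k1 p * m1 p by [].
  by rewrite /k1 /m1 /h; diffs; rewrite ?expf_neq0.
have dn : differentiable n (x, 0) by rewrite /n; diffs.
apply: (@par_holomorphic_neq0 _ (true, c1) (true, c1) (x, 0)
   (fun p => (- p.1 * n p, p.2 / (m p * n p))) (fun p => g p * m p * n p)).
- by [].
- by [].
- by diffs; rewrite ?m0 ?n0 mul1r oner_eq0.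
- by diffs.
- by rewrite g0 m0 n0 !mulr1.
move=> u v; rewrite !mulf_eq0 !negb_or => /andP[/andP[pg pm] pn].
rewrite /par /= -/(cpar c1 (u, v)) !mulf_eq0 oppr_eq0 !invr_eq0 ?mulf_eq0.
rewrite (negPf pm) (negPf pn) !orbF.
case: (eqVneq v 0) => [v0|v0].
  by rewrite /= /n v0 /= mul0r addr0 mulr1 ?(negPf u0) ?eqxx.
case: (eqVneq u 0) => [u0|u0].
  have [_ m1 K1] : [/\ g (u, v) = a, m (u, v) = 1 & K (u, v) = 2].
    by apply: mm0 => //=; rewrite u0 mul0r ?expr0n /= ?mulr0.
  rewrite m1 (_ : n (u, v) = 1) ?mul1r ?divr1 //.
    by rewrite /= (negPf v0) u0 eqxx.
  rewrite /n /q /qq /kk1 /mm1 /e /= u0 !mul0r; field.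
  exact: a0.
rewrite /jif.
have c : affcond c1 (u, v) by rewrite /= u0 v0.
have E := kk_qq (e := e (u, v)) (w := u - 1) pg.
rewrite -/(K (u, v)) -/(m (u, v)) -/(q (u, v)) subrK in E.
have N : - u * n (u, v) = 1 - (u - 1 + K (u, v)) * m (u, v).
  by rewrite E /n /e /=; ring.
apply: conj_ipt_chart => //; rewrite -/(m (u, v)) /= -?/(K (u, v)).
  rewrite {1}N; field; by rewrite ?u0 ?v0 ?pm ?pn.
by field; rewrite ?u0 ?v0 ?pm ?pn.
Qed.

Lemma ipt_holomorphic_PSt x : holomorphic_at (ipt : Z -> Z) (PS a true x : Z).
Proof.
rewrite -(hub_par b (PS a true x)).
pose e (p : C * C) := etak cS p; pose g := gk a b cS.
pose m p := mm (e p) (g p); pose K p := kk (e p) (g p).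
pose q p := qq (e p) (p.1 * p.2 - 1).
have [g0 m0 K0] : [/\ g (x, 0) = a, m (x, 0) = 1 & K (x, 0) = 2].
  by apply: mm0 => /=; rewrite ?expr0n /= ?mulr0.
have g0' : g (x, 0) != 0 by rewrite g0.
have dg : differentiable g (x, 0) by exact: diff_gk.
have de : differentiable e (x, 0) by rewrite /e /etak; diffs.
have dm : differentiable m (x, 0) by exact: diff_mm.
have dK : differentiable K (x, 0) by exact: diff_kk.
have dq : differentiable q (x, 0).
  pose h (p : C * C) := a + b * e p - (p.1 * p.2 - 1) * e p ^+ 2.
  pose k1 p := (g p * (a - (h p + h p)) + a * e p ^+ 2) / g p ^+ 2.
  pose m1 p := 1 + e p ^+ 2 / g p.
  have -> : q = fun p => k1 p + (p.1 * p.2 - 1 + 2) * m1 p + e p * k1 p * m1 p by [].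
  by rewrite /k1 /m1 /h; diffs; rewrite ?expf_neq0.
apply: (@par_holomorphic_neq0 _ (true, cS) (true, cS) (x, 0)
   (fun p => (m p * (p.1 + q p), - p.2 / m p)) (fun p => g p * m p)).
- by [].
- by [].
- by diffs; rewrite ?m0 oner_eq0.
- by diffs.
- by rewrite g0 m0 !mulr1.
move=> u v; rewrite !mulf_eq0 !negb_or => /andP[pg pm].
rewrite /par /= -/(cpar cS (u, v)) !mulf_eq0 oppr_eq0 !invr_eq0 (negPf pm) !orbF.
case: (eqVneq v 0) => [v0|v0].
  have [_ m1 K1] : [/\ g (u, v) = a, m (u, v) = 1 & K (u, v) = 2].
    by apply: mm0 => //=; rewrite v0 ?expr0n ?mulr0.
  (* At e = 0 and w = -1 one has [kk1] = -1 and [mm1] = 1, so q = 0: iota j-conjugated fixes the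
     section. *)
  rewrite m1 (_ : q (u, v) = 0) ?mul1r ?addr0.
    by rewrite /= v0 eqxx.
  rewrite /q /qq /kk1 /mm1 /e /= v0 !(mulr0, mul0r); field.
  exact: a0.
rewrite /jif.
have c : affcond cS (u, v) by rewrite /= v0.
have E := kk_qq (e := e (u, v)) (w := u * v - 1) pg.
rewrite -/(K (u, v)) -/(m (u, v)) -/(q (u, v)) subrK in E.
have N : m (u, v) * (u + q (u, v)) * (- v / m (u, v)) =
    1 - (u * v - 1 + K (u, v)) * m (u, v).
  by rewrite E /e /=; field.
apply: conj_ipt_chart => //; rewrite -/(m (u, v)) /= -?/(K (u, v)).
  by rewrite N /=; field.
by field; rewrite ?v0 ?pm.
Qed.

Lemma ipt_holomorphic (z : Z) : holomorphic_at (ipt : Z -> Z) z.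
Proof.
case: z => [r y|y||s|[] l|[] u|[]|[] w|[] v].
- exact: ipt_holomorphic_Aff.
- exact: ipt_holomorphic_PB.
- rewrite -(hub_par b (N4 a)); apply: ipt_holomorphic_c4; exact: (hub_dom a0 (N4 a)).
- rewrite -(hub_par b (Q4 s)); apply: ipt_holomorphic_c4; exact: (hub_dom a0 (Q4 s)).
- exact: ipt_holomorphic_Q3t.
- exact: ipt_holomorphic_Q3f.
- exact: ipt_holomorphic_Q2t.
- exact: ipt_holomorphic_Q2f.
- exact: ipt_holomorphic_N21t.
- exact: ipt_holomorphic_N21f.
- exact: ipt_holomorphic_Q1t.
- exact: ipt_holomorphic_Q1f.
- exact: ipt_holomorphic_PSt.
- exact: ipt_holomorphic_PSf.
Qed.

End Automorphism.

(** * The bimeromorphic map to the projective plane *)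

Section HolomorphicComp.
Variables (C : numClosedFieldType) (E F G : normedModType C).
Variables (X : complexManifold E) (Y : complexManifold F) (W : complexManifold G).

Lemma holomorphic_at_comp (f : X -> Y) (g : Y -> W) x :
  holomorphic_at f x -> holomorphic_at g (f x) -> holomorphic_at (g \o f) x.
Proof.
move=> [cf df] [cg dg].
have [c ac cx] := atlas_cover x; have [e ae ex] := atlas_cover (f x).
have [d ad dx] := atlas_cover (g (f x)).
apply: (holomorphic_at_chart ac ad) => //; first exact: continuous_comp.
apply: (@near_differentiable _ _ _ ((cmap d \o g \o cinv e) \o (cmap e \o f \o cinv c))).
  have cc := chart_inv_cvg ac cx.
  have n : \forall q \near cmap c x, cdom e (f (cinv c q)).
    exact: (cc _ (cf _ (near_cdom ae ex))).
  by near=> q => /=; rewrite (chart_mapK (atlas_chart ae)) //; near: q.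
apply: differentiable_comp; first exact: df.
by rewrite /= (chart_mapK (atlas_chart ac)) //; exact: dg.
Unshelve. all: by end_near. Qed.

Lemma holomorphic_at_local (f : X -> Y) c d x (g : E -> F) :
  atlas c -> atlas d -> cdom c x -> cdom d (f x) ->
  differentiable g (cmap c x) -> g (cmap c x) = cmap d (f x) ->
  (\forall y \near x, f y = cinv d (g (cmap c y))) -> holomorphic_at f x.
Proof.
move=> ac ad cx dx dg gx ng.
have cg := differentiable_continuous dg.
have hd := atlas_chart ad; have hc := atlas_chart ac.
apply: (holomorphic_at_chart ac ad) => //.
  move=> U; rewrite (nbhs_singleton ng) gx => Uf.
  have := chart_map_cts hc cx (cg _ _).
  move=> /(_ (cinv d @^-1` U)).
  have h := chart_inv_cts hd dx Uf; rewrite -gx in h => /(_ h) h2.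
  have n2 : \forall y \near x, U (cinv d (g (cmap c y))) := h2.
  suff : \forall y \near x, U (f y) by [].
  by near=> y; rewrite (_ : f y = cinv d (g (cmap c y))); near: y.
apply: near_differentiable dg.
have cc := chart_inv_cvg ac cx.
have n1 : \forall q \near cmap c x, f (cinv c q) = cinv d (g (cmap c (cinv c q))).
  exact: (cc _ ng).
have n2 : \forall q \near cmap c x, (cmap d @` cdom d) (g q).
  apply: (cg (cmap d @` cdom d)); apply: open_nbhs_nbhs; split.
    exact: chart_cod_open hd.
  by exists (f x).
have n3 : \forall q \near cmap c x, (cmap c @` cdom c) q.
  by apply: open_nbhs_nbhs; split; [exact: chart_cod_open hc|exists x].
near=> q => /=.
have [x' cx' x'q] : (cmap c @` cdom c) q by near: q.
have [y' dy' y'q] : (cmap d @` cdom d) (g q) by near: q.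
rewrite (_ : f (cinv c q) = cinv d (g (cmap c (cinv c q)))); last by near: q.
rewrite -[in RHS]x'q (chart_mapK hc) // x'q -y'q (chart_mapK hd) //.
Unshelve. all: by end_near. Qed.

End HolomorphicComp.

Section P2Lemmas.
Variable C : numClosedFieldType.

Definition i1 : 'I_3 := lift 0 0.
Definition i2 : 'I_3 := lift 0 1.

Lemma row3P (P : 'I_3 -> Prop) : P 0 -> P i1 -> P i2 -> forall j, P j.
Proof.
move=> h0 h1 h2 j; case: (unliftP 0 j) => [k ->|-> //].
by case: k => [[|[|//]] lk]; [rewrite (_ : Ordinal lk = 0)|rewrite (_ : Ordinal lk = 1)] => //; exact/val_inj.
Qed.

Lemma P2_class_eq (v v' : nzvec C) c : c != 0 -> val v = c *: val v' ->
  P2_class v = P2_class v'.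
Proof.
move=> c0 vE; apply/eqmodP => /=; rewrite /collinear vE.
by apply/eqmxP; apply: eqmx_scale.
Qed.

Lemma P2_chart_atlas k : @atlas _ _ (P2 C) (P2_chart C k).
Proof. by exists k. Qed.

Lemma diff_affine_row i k (w : (C * C)%type) :
  differentiable (fun w => affine_row i w 0 k) w.
Proof.
rewrite affine_row_coordE.
case: (unlift i k) => [l|]; last exact: differentiable_cst.
by case: (l == 0); [exact: differentiable_fst | exact: differentiable_snd].
Qed.

Lemma affine_row_torus i k (w : (C * C)%type) : w.1 != 0 -> w.2 != 0 ->
  affine_row i w 0 k != 0.
Proof.
move=> w1 w2; rewrite mxE; case: (unlift i k) => [l|]; last exact: oner_neq0.
by case: (l == 0).
Qed.

Lemma hcoord_class (v : nzvec C) : exists2 c, c != 0 &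
  forall j, hcoord (P2_class v) 0 j = c * val v 0 j.
Proof.
by have [c c0 ->] := P2_classP v; exists c => // j; rewrite mxE.
Qed.

Lemma hcoord_affine k (q : P2 C) : hcoord q 0 k != 0 ->
  hcoord q = hcoord q 0 k *: affine_row k (affine_coord k (hcoord q)).
Proof.
move=> qk; apply/rowP => j; rewrite !mxE; case: unliftP => [l ->|->]; last by rewrite mulr1.
case: l => [[|[|//]] lk] /=; rewrite mulrC divfK //; congr (hcoord q 0 (lift k _));
  exact/val_inj.
Qed.

End P2Lemmas.

Section Pi.
Variables (C : numClosedFieldType) (a b : C).
Hypothesis a0 : a != 0.

Notation cpar := (@cpar C a).
Notation par := (@par C a b).
Notation dom := (@dom C a).
Notation jpt := (@jpt C a b).
Notation Z := (Zsurf b a0).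
Notation ftor := (fpol a b).
Notation gchart i := (glue_chart (L := Zglue b a0) i).

Definition good (z : pts a) : bool := if z is Aff _ y then y != 0 else false.

(** Off the affine plane the value is a default. The exceptional set also contains y = 0, because
    (r, y) |-> (1 + r y, y) contracts that line to the point (1, 0). *)
Definition pimap (z : Z) : P2 C :=
  match (z : pts a) with
  | Aff r y => P2_class (affine_vec 0 (1 + r * y, y))
  | _ => P2_class (affine_vec 0 (0, 0))
  end.

Definition piinv (q : P2 C) : Z :=
  let w := affine_coord 0 (hcoord q) in Aff a ((w.1 - 1) / w.2) w.2.

Definition piexc : set Z := [set z | ~~ good z].
Definition picexc : set (P2 C) := [set q | hcoord q 0 0 * hcoord q 0 i2 = 0].

Definition excfun (k : cix) (p : C * C) : C :=
  match k with c0 | cS => p.2 | _ => p.1 * p.2 end.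

Lemma good_jif e z : good (jif b e z) = good z.
Proof. by case: e => //; case: z => //= s; rewrite /mkP4; case: insub. Qed.

Lemma mkP4_ngood z : good (mkP4 a z) = false.
Proof. by rewrite /mkP4; case: insub. Qed.

Lemma good_par i p : good (par i p) = (excfun i.2 p != 0).
Proof.
case: i => e k; rewrite /par good_jif /=.
case: k => //=; rewrite ?mulf_eq0 ?negb_or.
all: try (by case: (eqVneq p.1 0); case: (eqVneq p.2 0) => //= h1 h2; rewrite ?mkP4_ngood ?invr_eq0 ?mulf_eq0 ?(negPf h1) ?(negPf h2)).
all: case: (eqVneq p.2 0) => //= h; rewrite ?invr_eq0 ?h //.
all: by case: (eqVneq p.1 0) => //= h'; rewrite ?mkP4_ngood ?invr_eq0 ?eqxx ?h.
Qed.

Lemma diff_excfun k p : differentiable (excfun k) p.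
Proof. by case: k; rewrite /excfun; diffs. Qed.

Lemma gchart_atlas i : @atlas _ _ Z (gchart i).
Proof. exact: (glue_atlasP (L := Zglue b a0)). Qed.

Lemma gchart_hub z : cdom (gchart (hub z)) z.
Proof. by exists (hubc z); [exact: hub_dom|exact: hub_par]. Qed.

Lemma piexc_analytic : analytic_subset piexc.
Proof.
move=> z; set i := hub z.
exists 1%N, (fun _ z => excfun i.2 (zcoord b i z)).
near=> z'.
have [p Dp pz] : cdom (gchart i) z' by near: z'; exact: (near_cdom (gchart_atlas i) (gchart_hub z)).
split.
  move=> _; apply: (holomorphic_fun_at_chart (gchart_atlas i)); first by exists p.
  rewrite -pz /= zcoordK //.
  apply: near_differentiable (diff_excfun i.2 p).
  have n : \forall p' \near p, dom i p'.
    by apply: open_nbhs_nbhs; split => //; exact: dom_open.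
  by near=> p' => /=; rewrite zcoordK //; near: p'.
rewrite /piexc /= -pz good_par zcoordK // negbK.
by split=> [/eqP//|/(_ ord0) ->].
Unshelve. all: by end_near. Qed.

Lemma piexc_dense : dense (~` piexc).
Proof.
move=> O [z Oz] oO; have /Aff_dense [r [y [y0 Oy]]] : nbhs z O.
  by apply: open_nbhs_nbhs.
by exists (Aff a r y); split => //; rewrite /piexc /= y0.
Qed.

Lemma P2_chart_cover (q : P2 C) : exists k, hcoord q 0 k != 0.
Proof. by have /rV0Pn := valP (repr q). Qed.

Lemma hcoord_cinv k w : exists2 c, c != 0 &
  forall j, hcoord (cinv (P2_chart C k) w) 0 j = c * affine_row k w 0 j.
Proof. exact: hcoord_class. Qed.

Lemma picexc_analytic : analytic_subset picexc.
Proof.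
move=> q; have [k qk] := P2_chart_cover q.
pose g w : C := affine_row k w 0 0 * affine_row k w 0 i2.
exists 1%N, (fun _ q => g (affine_coord k (hcoord q))).
near=> q'.
have q'k : cdom (P2_chart C k) q' by near: q'; exact: (near_cdom (P2_chart_atlas C k)).
split.
  move=> _; apply: (holomorphic_fun_at_chart (P2_chart_atlas C k)) => //.
  have dg w : differentiable g w by apply: diff_mulf; exact: diff_affine_row.
  apply: near_differentiable (dg _); near=> w => /=.
  by rewrite (P2_chart_class _ _).2 affine_coordK.
have qE j : hcoord q' 0 j = hcoord q' 0 k * affine_row k (affine_coord k (hcoord q')) 0 j.
  by rewrite {1}(hcoord_affine q'k) mxE.
have -> : picexc q' = (g (affine_coord k (hcoord q')) = 0).
  apply/propext; rewrite /picexc /= (qE 0) (qE i2) mulrACA -/(g _).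
  split=> [/eqP|->]; last by rewrite mulr0.
  by rewrite mulf_eq0 mulf_eq0 orbb (negPf q'k) => /eqP.
by split=> // /(_ ord0).
Unshelve. all: by end_near. Qed.

Lemma picexc_dense : dense (~` picexc).
Proof.
move=> O [q Oq] oO; have [k qk] := P2_chart_cover q.
have cc := chart_inv_cvg (P2_chart_atlas C k) qk.
have [w [Ow w1 w2]] := torus_dense (cc O (open_nbhs_nbhs (conj oO Oq))).
exists (cinv (P2_chart C k) w); split => //.
have [c c0 cE] := hcoord_cinv k w.
by rewrite /picexc /= !cE; apply/eqP; rewrite !mulf_neq0 ?affine_row_torus.
Qed.

Lemma affine_row0 (w : C * C) : [/\ affine_row 0 w 0 0 = 1,
  affine_row 0 w 0 i1 = w.1 & affine_row 0 w 0 i2 = w.2].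
Proof. by split; rewrite mxE ?unlift_none // liftK. Qed.

Lemma P2_affine0 (w : C * C) : let q := P2_class (affine_vec 0 w) in
  hcoord q 0 0 != 0 /\ affine_coord 0 (hcoord q) = w.
Proof.
have [e1 e2] := P2_chart_class 0 (affine_vec 0 w); rewrite /= e1 e2.
by rewrite /= affine_coordK; split => //; rewrite mxE unlift_none oner_neq0.
Qed.

Lemma pi_mapP z : ~ piexc z ->
  [/\ ~ picexc (pimap z), piinv (pimap z) = z & holomorphic_at pimap z].
Proof.
move=> /negP; rewrite negbK; case: z => //= r y y0.
have [h0 h1] := P2_affine0 (1 + r * y, y).
split.
- rewrite /picexc /= => /eqP; rewrite mulf_eq0 (negPf h0) /= => /eqP h2.
  have : (affine_coord 0 (hcoord (P2_class (affine_vec 0 (1 + r * y, y))))).2 = 0.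
    by rewrite /affine_coord /= -/i2 h2 mul0r.
  by rewrite h1 => /eqP; rewrite /= (negPf y0).
- by rewrite /piinv h1 /=; congr Aff; field.
apply: (@holomorphic_at_local _ _ _ Z (P2 C) pimap (gchart (false, c0)) (P2_chart C 0)
   (Aff a r y) (fun p => (1 + p.1 * p.2, p.2))).
- exact: gchart_atlas.
- exact: P2_chart_atlas.
- by exists (r, y).
- exact: h0.
- by diffs.
- by rewrite /= h1.
have n := near_cdom (gchart_atlas (false, c0)) (gchart_hub (Aff a r y)).
near=> z; have [p _ <-] : cdom (gchart (false, c0)) z by near: z.
by [].
Unshelve. all: by end_near. Qed.

Lemma picexcN q : ~ picexc q -> hcoord q 0 0 != 0 /\ (affine_coord 0 (hcoord q)).2 != 0.
Proof.
move=> /eqP; rewrite mulf_eq0 negb_or => /andP[h0 h2]; split => //.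
by rewrite /affine_coord /= -/i2 mulf_neq0 ?invr_neq0.
Qed.

Lemma pi_invP q : ~ picexc q ->
  [/\ ~ piexc (piinv q), pimap (piinv q) = q & holomorphic_at piinv q].
Proof.
move=> /picexcN[q0 q2]; set w := affine_coord 0 (hcoord q) in q2.
split.
- by rewrite /piexc /piinv /= -/w q2.
- rewrite /piinv /= -/w /pimap (_ : (1 + _, _) = w).
    exact: affine_rowK.
  by rewrite [RHS]surjective_pairing mulfVK // addrC subrK.
apply: (@holomorphic_at_local _ _ _ (P2 C) Z piinv (P2_chart C 0) (gchart (false, c0))
   q (fun p => ((p.1 - 1) / p.2, p.2))).
- exact: P2_chart_atlas.
- exact: gchart_atlas.
- exact: q0.
- by exists ((w.1 - 1) / w.2, w.2).
- by diffs.
- by [].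
by near=> q'.
Unshelve. all: by end_near. Qed.

End Pi.

(** * Analyticity of the closure of the graph *)

Section Graph.
Variables (C : numClosedFieldType) (a b : C).
Hypothesis a0 : a != 0.

Notation cpar := (@cpar C a).
Notation par := (@par C a b).
Notation dom := (@dom C a).
Notation Z := (Zsurf b a0).
Notation ftor := (fpol a b).
Notation gchart i := (glue_chart (L := Zglue b a0) i).
Notation pimap := (@pimap C a b a0).
Notation piexc := (@piexc C a b a0).

Definition tri (x y z : C) (j : 'I_3) : C :=
  match unlift 0 j with None => x | Some l => if l == 0 then y else z end.

Lemma tri0 x y z : tri x y z 0 = x.
Proof. by rewrite /tri unlift_none. Qed.

Lemma tri1 x y z : tri x y z i1 = y.
Proof. by rewrite /tri liftK. Qed.

Lemma tri2 x y z : tri x y z i2 = z.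
Proof. by rewrite /tri liftK. Qed.

Definition triE := (tri0, tri1, tri2).

(* Homogeneous coordinates of the map (r, y) |-> [1 : 1 + r y : y] in the charts. *)
Definition piv (i : bool * cix) (p : C * C) : 'I_3 -> C :=
  let u := p.1 in let v := p.2 in
  match i with
  | (false, c0) => tri 1 (1 + u * v) v
  | (false, cB) => tri u (u + v) (u * v)
  | (false, c4) => tri (u * v ^+ 3) (u * v ^+ 3 + 1) (u * v ^+ 2)
  | (false, c43) => tri (u ^+ 2 * v ^+ 3) (u ^+ 2 * v ^+ 3 + 1) (u * v ^+ 2)
  | (false, c32) => tri (u ^+ 2 * v) (u ^+ 2 * v + 1) u
  | (false, c21) => tri (u * v) (u * v + u) 1
  | (false, c1) => tri (u * v) (u ^+ 2 * v) 1
  | (false, cS) => tri v (u * v ^+ 2) 1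
  | (true, k) => let e := etak k p in tri (e ^+ 3) (e ^+ 3 + gk a b k p) (e ^+ 2)
  end.

(** The condition holds for all hubs. In the charts [c0], [cB] and [c4] of the family [true],
    [zetak] takes its default value and [piv] need not represent the map. *)
Definition valid (i : bool * cix) : bool := ~~ i.1 || arm i.2.

Lemma hub_valid (z : pts a) : valid (hub z).
Proof. by case: z => // -[]. Qed.

Lemma piv_Aff i p r y : valid i -> par i p = Aff a r y -> y != 0 ->
  [/\ piv i p 0 != 0, piv i p i1 = piv i p 0 * (1 + r * y) &
      piv i p i2 = piv i p 0 * y].
Proof.
case: i => -[] k vi E y0; have [cp yE rE] := par_AffE E.
  have cE : cpar k p = Aff a (ftor y - r) y.
    by rewrite (cpar_Aff a cp) -yE rE opprB addrC subrK.
  have zE := zetakE cE vi y0.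
  have [ye e0] : y = (etak k p)^-1 /\ etak k p != 0 by apply: etakE cE _ _; case: (k) vi.
  case: p ye e0 zE {cp yE rE cE E} => u v ye e0 zE; rewrite /piv.
  rewrite !triE.
  rewrite /gk zE ye /fpol expf_neq0 //; split => //; field; rewrite e0 //.
case: p cp yE rE {E} => u v; case: k vi => //= _; rewrite /piv;
 try (case/andP => h1 h2); try (move=> h1);
 move=> yE rE; rewrite !triE; rewrite yE in y0; rewrite rE yE;
 try (by split; rewrite ?mulf_neq0 ?expf_neq0 ?oner_neq0 //; field; rewrite ?h1 ?h2).
Qed.

Lemma gk_neq0 k p : arm k -> cdomain a k p -> etak k p = 0 -> gk a b k p != 0.
Proof.
rewrite /gk => ak Dp e0; rewrite e0 expr0n /= !mulr0 !addr0.
case: p e0 Dp => u v; case: k ak => //= _ /eqP.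
- rewrite mulf_eq0 => /orP[/eqP->|/eqP-> Dp]; first by rewrite subr0.
  by rewrite subr_eq0; apply/eqP => au; apply: Dp; rewrite au.
- by rewrite mulf_eq0 => /orP[]/eqP->; rewrite ?expr0n ?(mul0r, mulr0) ?subr0.
- by rewrite mulf_eq0 => /orP[]/eqP->; rewrite ?expr0n ?(mul0r, mulr0) ?subr0.
- by move=> /eqP ->; rewrite ?expr0n ?(mul0r, mulr0) ?subr0.
- by move=> /eqP ->; rewrite ?expr0n ?(mul0r, mulr0) ?subr0.
Qed.

(** The origin of [cB], where the curves r = oo and y = 0 meet, is the only point where the
    coordinates vanish together. *)
Lemma piv_neq0 i p : valid i -> dom i p -> i <> (false, cB) \/ p <> (0, 0) ->
  exists j, piv i p j != 0.
Proof.
case: i p => -[] k [u v] vi Dp h.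
  have [e0|e0] := eqVneq (etak k (u, v)) 0; last first.
    by exists 0; rewrite /piv triE expf_neq0.
  by exists i1; rewrite /piv triE e0 expr0n add0r gk_neq0.
have ex x (y : C) : exists j, tri x (x + 1) y j != 0.
  have [x0|x0] := eqVneq x 0; [exists i1|exists 0]; rewrite triE //.
  by rewrite x0 add0r oner_neq0.
case: k vi Dp h => //= _ _ h.
- by exists 0; rewrite triE oner_neq0.
- case: h => // h; have [u0|u0] := eqVneq u 0; last by exists 0; rewrite triE.
  exists i1; rewrite triE u0 add0r; apply/eqP => v0; apply: h; by rewrite u0 v0.
- by exists i2; rewrite triE oner_neq0.
- by exists i2; rewrite triE oner_neq0.
- by exists i2; rewrite triE oner_neq0.
Qed.

Lemma diff_tri (V : normedModType C) (x y z : V -> C) j p : differentiable x p ->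
  differentiable y p -> differentiable z p -> differentiable (fun p => tri (x p) (y p) (z p) j) p.
Proof. by move=> dx dy dz; rewrite /tri; case: unlift => // l; case: (l == 0). Qed.

Lemma diff_piv i j p : differentiable (fun p => piv i p j) p.
Proof.
case: i => -[] k.
  have de := diff_etak k p; have dg := diff_gk a b k p.
  by rewrite /piv; apply: diff_tri; diffs.
by case: k; rewrite /piv /=; apply: diff_tri; diffs.
Qed.

(* Equations of the closure of the graph: proportionality to [piv], except that the
   indeterminacy point of chart cB, where [piv] vanishes, has to be blown up. *)
Definition grapheq i (p : C * C) (u : 'I_3 -> C) : 'I_3 -> C :=
  if i is (false, cB) then
    tri (u 0 * p.2 - (u i1 - u 0) * p.1) (u i2 - u 0 * p.2) 0
  else tri (piv i p 0 * u i1 - piv i p i1 * u 0)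
           (piv i p 0 * u i2 - piv i p i2 * u 0)
           (piv i p i1 * u i2 - piv i p i2 * u i1).

Lemma diff_grapheq i k j (x : (C * C) * (C * C)) :
  differentiable (fun x : (C * C) * (C * C) =>
    grapheq i x.1 (fun j => affine_row k x.2 0 j) j) x.
Proof.
have d1 l : differentiable (fun x : (C * C) * (C * C) => affine_row k x.2 0 l) x.
  apply: (@differentiable_comp _ _ _ _ snd (fun w => affine_row k w 0 l)).
    exact: differentiable_snd.
  exact: diff_affine_row.
have d2 l : differentiable (fun x : (C * C) * (C * C) => piv i x.1 l) x.
  apply: (@differentiable_comp _ _ _ _ fst (fun w => piv i w l)).
    exact: differentiable_fst.
  exact: diff_piv.
have d3 : differentiable (fun x : (C * C) * (C * C) => x.1.1) x.
  by apply: (@differentiable_comp _ _ _ _ fst fst); exact: differentiable_fst.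
have d4 : differentiable (fun x : (C * C) * (C * C) => x.1.2) x.
  by apply: (@differentiable_comp _ _ _ _ fst snd);
    [exact: differentiable_fst|exact: differentiable_snd].
by case: i d2 => -[] [] d2; rewrite /grapheq; apply: diff_tri; diffs.
Qed.

Lemma grapheq_Aff i p r y u : valid i -> par i p = Aff a r y -> y != 0 ->
  u i1 = u 0 * (1 + r * y) -> u i2 = u 0 * y -> forall j, grapheq i p u j = 0.
Proof.
move=> vi E y0 u1 u2; have [h0 h1 h2] := piv_Aff vi E y0.
case: i vi E h0 h1 h2 => e k vi E h0 h1 h2.
have H j : tri (piv (e, k) p 0 * u i1 - piv (e, k) p i1 * u 0)
           (piv (e, k) p 0 * u i2 - piv (e, k) p i2 * u 0)
           (piv (e, k) p i1 * u i2 - piv (e, k) p i2 * u i1) j = 0.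
  by move: j; apply: row3P; rewrite triE ?h1 ?h2 ?u1 ?u2; ring.
case: e vi E h0 h1 h2 H => [|] vi E h0 h1 h2 H; first exact: H.
case: k vi E h0 h1 h2 H => //= vi E h0 h1 h2 H.
have [cp yE rE] := par_AffE E; rewrite /= in cp yE rE.
apply: row3P; rewrite triE ?u1 ?u2 ?yE ?rE //; first by field.
by rewrite subrr.
Qed.

Definition pigraph : set (Z * P2 C) := [set x | ~ piexc x.1 /\ x.2 = pimap x.1].

Lemma affine_row_div k (v : 'I_3 -> C) j : v k != 0 ->
  affine_row k (v (lift k 0) / v k, v (lift k 1) / v k) 0 j = v j / v k.
Proof.
move=> vk; rewrite mxE; case: unliftP => [l ->|->] /=; last by rewrite divff.
by case: l => [[|[|//]] lk] /=; congr (v (lift k _) / _); exact/val_inj.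
Qed.

(** The limit argument is stated for an arbitrary filter because it serves twice: for the points of
    a chart off its axes, and for a punctured curve through the indeterminacy point. *)
Lemma closure_curve (T : Type) (F : set_system T) {FF : ProperFilter F}
    (d : T -> C * C) (V : T -> 'I_3 -> C) i p (k : 'I_3) (v : 'I_3 -> C) :
  dom i p -> d @ F --> p -> (forall j, (fun t => V t j) @ F --> v j) -> v k != 0 ->
  (\forall t \near F, exists r y, [/\ par i (d t) = Aff a r y, y != 0, V t 0 != 0,
     V t i1 = V t 0 * (1 + r * y) & V t i2 = V t 0 * y]) ->
  closure pigraph (par i p : Z,
    cinv (P2_chart C k) (v (lift k 0) / v k, v (lift k 1) / v k)).
Proof.
move=> Dp dp Vv vk H B [[B1 B2] /= [B1p B2q] BB].
have n1 : \forall t \near F, B1 (par i (d t)) by exact: (dp _ (par_cts Dp B1p)).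
have n2 : \forall t \near F, V t k != 0.
  have N : \forall c \near v k, c != 0.
    exact: (@near_diff_neq0 C C (fun c => c) (v k) (@diff_idf _ _ _) vk).
  exact: (Vv k _ N).
have cw : (fun t => (V t (lift k 0) / V t k, V t (lift k 1) / V t k)) @ F -->
    (v (lift k 0) / v k, v (lift k 1) / v k).
  have c1 j : (fun t => V t j / V t k) @ F --> v j / v k.
    by apply: cvgM; [exact: Vv|apply: cvgV => //; exact: Vv].
  exact: (cvg_pair (c1 _) (c1 _)).
have n3 : \forall t \near F, B2 (cinv (P2_chart C k)
    (V t (lift k 0) / V t k, V t (lift k 1) / V t k)).
  suff N : nbhs (v (lift k 0) / v k, v (lift k 1) / v k) (cinv (P2_chart C k) @^-1` B2).
    exact: (cw _ N).
  set w := (v (lift k 0) / v k, v (lift k 1) / v k) in B2q *.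
  have wk : cdom (P2_chart C k) (cinv (P2_chart C k) w).
    by rewrite /= (P2_chart_class _ _).1 /= mxE unlift_none oner_neq0.
  have := chart_inv_cont (P2_chart_atlas C k) wk.
  by rewrite [cmap _ _](_ : _ = w); [apply|rewrite /= (P2_chart_class _ _).2 affine_coordK].
have [t [[r [y [E y0 V0 V1 V2]]] b1 Vk b2]] : exists t, [/\
   exists r y, [/\ par i (d t) = Aff a r y, y != 0, V t 0 != 0,
     V t i1 = V t 0 * (1 + r * y) & V t i2 = V t 0 * y],
   B1 (par i (d t)), V t k != 0 & B2 (cinv (P2_chart C k)
    (V t (lift k 0) / V t k, V t (lift k 1) / V t k))].
  by apply: (@filter_ex _ F); near=> t; split; near: t.
exists (par i (d t) : Z, cinv (P2_chart C k)
    (V t (lift k 0) / V t k, V t (lift k 1) / V t k)); split; last by apply: BB; split.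
rewrite /pigraph /piexc /= E /= y0; split => //.
apply: (@P2_class_eq _ _ _ (V t 0 / V t k)); first by rewrite mulf_neq0 ?invr_neq0.
apply/rowP; apply: row3P; rewrite /= affine_row_div // [RHS]mxE.
- by rewrite mxE unlift_none mulr1.
- by rewrite mxE liftK /= V1; ring.
- by rewrite mxE liftK /= V2; ring.
Unshelve. all: by end_near. Qed.

Definition torusF (p : C * C) : set_system (C * C) :=
  within [set q | q.1 != 0 /\ q.2 != 0] (nbhs p).

Lemma torusF_proper p : ProperFilter (torusF p).
Proof.
apply: Build_ProperFilter_ex => P FP.
by have [q [Pq q1 q2]] := torus_dense FP; exists q; exact: Pq.
Qed.

(** Where [piv] does not vanish, the equations determine the image point, a limit of the graph over
    points off the axes. At the origin of [cB] they leave the whole line y = 0 of the plane, and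
    each of its points is reached along a curve of suitable direction. *)
Lemma grapheq_closure i k p w : valid i -> dom i p ->
  (forall j, grapheq i p (fun j => affine_row k w 0 j) j = 0) ->
  closure pigraph (par i p : Z, cinv (P2_chart C k) w).
Proof.
move=> vi Dp; set u := (fun j => affine_row k w 0 j) => H.
have uk : u k = 1 by rewrite /u mxE unlift_none.
have wE (v : 'I_3 -> C) : v k != 0 -> (forall j, v j = v k * u j) ->
    (v (lift k 0) / v k, v (lift k 1) / v k) = w.
  move=> vk vu; rewrite (vu (lift k 0)) (vu (lift k 1)).
  by rewrite ![v k * _]mulrC !mulfK // /u !mxE !liftK [RHS]surjective_pairing.
have [ip|ip] := pselect (i <> (false, cB) \/ p <> (0, 0)).
  have M x y : piv i p x * u y = piv i p y * u x.
    have M' : [/\ piv i p 0 * u i1 = piv i p i1 * u 0,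
      piv i p 0 * u i2 = piv i p i2 * u 0 & piv i p i1 * u i2 = piv i p i2 * u i1].
      have := (H 0, H i1, H i2); case: (i) => -[] [];
       rewrite /grapheq !triE => -[[/eqP + /eqP +] /eqP];
       rewrite !subr_eq0 => /eqP e0 /eqP e1 /eqP e2 //.
      rewrite /piv !triE; have e2' : u i2 = u 0 * p.2 by [].
      rewrite e2'; split; [|by ring|].
        by rewrite mulrDl -[p.2 * u 0]mulrC e0; ring.
      have -> : (p.1 + p.2) * (u 0 * p.2) = p.2 * (u 0 * p.2) + p.1 * p.2 * u 0 by ring.
      by rewrite e0; ring.
    by move: x y; apply: row3P => //; apply: row3P => //; case: M'.
  have pk : piv i p k != 0.
    have [j pj] := piv_neq0 vi Dp ip; apply: contraNneq pj => pk0.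
    by have := M j k; rewrite uk mulr1 pk0 mul0r => ->.
  rewrite -(wE (piv i p)) //; last by move=> j; rewrite M uk mulr1.
  have FF := torusF_proper p.
  apply: (@closure_curve _ (torusF p) _ id (fun q j => piv i q j)) => //.
  - exact: cvg_within.
  - move=> j; apply: cvg_trans (differentiable_continuous (diff_piv i j p)).
    by apply: cvg_app; exact: cvg_within.
  - have N : \forall q \near torusF p, q.1 != 0 /\ q.2 != 0 by exact: withinT.
    near=> q; have [q1 q2] : q.1 != 0 /\ q.2 != 0 by near: q.
    have [r [y [y0 E]]] := par_torus a b i q1 q2.
    by exists r, y; have [? ? ?] := piv_Aff vi E y0; split.
have {ip} [iE pE] : i = (false, cB) /\ p = (0, 0).
  by split; apply: contrapT => h; apply: ip; [left|right].
rewrite iE pE in H *.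
have [u2 _] : u i2 = 0 /\ True.
  by have := H i1; rewrite /grapheq triE mulr0 subr0.
(* The curve is (1 / r, y) = (e A, e D), on which r y = D / A tends to (u_1 - u_0) / u_0 in P^1. The
   shift by e keeps A and D nonzero for small e != 0. *)
pose A (e : C) : C := u 0 + e; pose D (e : C) : C := u i1 - u 0 + e.
have uk0 : u k != 0 by rewrite uk oner_neq0.
rewrite -(wE u uk0); last by move=> j; rewrite uk mul1r.
apply: (@closure_curve _ ((0 : C)^') _ (fun e => (e * A e, e * D e))
  (fun e => tri (A e) (A e + D e) (e * A e * D e))) => //.
- have c : {for 0, continuous (fun e : C => (e * A e, e * D e))}.
    by apply: differentiable_continuous; rewrite /A /D; diffs; exact: diff_idf.
  rewrite -[X in _ --> X](_ : (0 * A 0, 0 * D 0) = _); last by rewrite !mul0r.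
  by apply: cvg_trans c; apply: cvg_app; exact: nbhs_dnbhs.
- move=> j; rewrite -[X in _ --> X](_ : tri (A 0) (A 0 + D 0) (0 * A 0 * D 0) j = _); last first.
    move: j; apply: row3P; rewrite triE /A /D ?addr0 //; first by rewrite addrC subrK.
    by rewrite !mul0r u2.
  have c : {for 0, continuous (fun e : C => tri (A e) (A e + D e) (e * A e * D e) j)}.
    apply: differentiable_continuous; rewrite /A /D; apply: diff_tri; diffs; exact: diff_idf.
  by apply: cvg_trans c; apply: cvg_app; exact: nbhs_dnbhs.
have nz c : \forall e \near (0 : C)^', c + e != 0 by exact: dnbhs_add_neq0.
near=> e; have e0 : e != 0 by near: e; exact: nbhs_dnbhs_neq.
have Ae : A e != 0 by near: e; exact: nz.
have De : D e != 0 by near: e; exact: nz.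
exists (e * A e)^-1, (e * D e); rewrite !triE /par /= mulf_eq0 (negPf e0) (negPf Ae).
by split => //; rewrite ?mulf_neq0 //; field; rewrite ?e0 ?Ae.
Unshelve. all: by end_near. Qed.

Lemma pigraph_grapheq i k z q : valid i -> cdom (gchart i) z ->
  cdom (P2_chart C k) q -> pigraph (z, q) ->
  forall j, grapheq i (zcoord b i z) (fun j => affine_row k (affine_coord k (hcoord q)) 0 j) j = 0.
Proof.
move=> vi [p Dp <-] qk [/= /negP/negPn g qE].
rewrite zcoordK //; case E : (par i p) g qE => [r y||||||||] //= y0 qE.
have uE j : affine_row k (affine_coord k (hcoord q)) 0 j = hcoord q 0 j / hcoord q 0 k.
  have h : hcoord q 0 j = hcoord q 0 k * affine_row k (affine_coord k (hcoord q)) 0 j.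
    by rewrite {1}(hcoord_affine (k := k) qk) mxE.
  by apply: (mulfI qk); rewrite -h [RHS]mulrC divfK.
have [c c0 cE] := hcoord_class (affine_vec 0 (1 + r * y, y)).
have [r0 r1 r2] := affine_row0 (1 + r * y, y).
have {}cE j : hcoord q 0 j = c * affine_row 0 (1 + r * y, y) 0 j by rewrite qE; exact: cE.
by apply: (grapheq_Aff vi E y0); rewrite !uE !cE r0 ?r1 ?r2 /=; ring.
Qed.

Lemma pigraph_analytic : @analytic_subset _ _ (prod_manifold Z (P2 C)) (closure pigraph).
Proof.
move=> [z q]; set i := hub z; have [k qk] := P2_chart_cover q.
have vi : valid i := hub_valid z.
pose c := prod_chart (gchart i) (P2_chart C k).
have ac : @atlas _ _ (prod_manifold Z (P2 C)) c.
  by exists (gchart i), (P2_chart C k); split => //; [exact: gchart_atlas|exact: P2_chart_atlas].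
have cz : cdom c (z, q) by split => //; exact: gchart_hub.
pose f (j : 'I_3) (x : (C * C) * (C * C)) := grapheq i x.1 (fun j => affine_row k x.2 0 j) j.
have df j x : differentiable (f j) x by exact: diff_grapheq.
exists 3%N, (fun j x => f j (cmap c x)).
near=> x; have cx : cdom c x by near: x; exact: (near_cdom ac cz).
have hc := atlas_chart ac.
split.
  move=> j; apply: (holomorphic_fun_at_chart ac cx).
  apply: near_differentiable (df j _).
  have n : \forall y \near cmap c x, (cmap c @` cdom c) y.
    by apply: open_nbhs_nbhs; split; [exact: chart_cod_open hc|exists x].
  near=> y; have [x' cx' <-] : (cmap c @` cdom c) y by near: y.
  rewrite -[RHS]/(f j (cmap c (cinv c (cmap c x')))).
  by rewrite (chart_mapK hc cx').
split=> [clx j|H].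
  apply/eqP/negPn/negP => fx.
  have ch : {for x, continuous (fun x => f j (cmap c x))}.
    apply: (@continuous_comp _ _ _ (cmap c) (f j)); first exact: (chart_map_cts hc).
    exact: differentiable_continuous.
  have n1 : \forall y \near x, f j (cmap c y) != 0 by exact: (near_neq0 ch fx).
  have [[z' q'] [gx' [f' [cz' cq']]]] := clx _ (filterI n1 (near_cdom ac cx)).
  move/eqP: f'; apply; exact: pigraph_grapheq.
suff K z' q' : cdom c (z', q') -> (forall j, f j (cmap c (z', q')) = 0) ->
    closure pigraph (z', q').
  by rewrite [x]surjective_pairing; apply: K; rewrite -surjective_pairing.
move=> [/= [p Dp pz] cq'] {}H; rewrite -pz in H *.
rewrite /= /f /= zcoordK // in H.
rewrite -[q'](chart_mapK (atlas_chart (P2_chart_atlas C k))) //.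
exact: grapheq_closure.
Unshelve. all: by end_near. Qed.

End Graph.

(** Any triple representing the map, even with common factors, satisfies two identities free of
    denominators; unlike equalities of fractions, these can be evaluated at a point. *)
Lemma kmap_forms_field (L : fieldType) (A B x y g0 g1 g2 : L) :
  y != 0 -> x - 1 != 0 -> g0 != 0 ->
  g2 / g0 = yF ((x - 1) / y) y ->
  g1 / g0 = 1 + rF A B ((x - 1) / y) (g2 / g0) * (g2 / g0) ->
  g2 * (x - 1) = (- (y + 1) * (x - 1) - y) * g0 /\
  (g1 - g0) * y * g0 ^+ 2 =
    (- (x - 1) * g0 ^+ 2 + A * y * g2 * (g2 + g0) + B * y * g0 ^+ 2) * g2.
Proof.
move=> y0 x1 g00 e2 e1; split.
  rewrite -[g2](divfK g00) e2 /yF.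
  by field; rewrite x1 y0.
rewrite -[g1](divfK g00) e1 /rF.
by field; rewrite g00 y0.
Qed.

Lemma kmap_forms (R : idomainType) (A B x y g0 g1 g2 : R) :
  let tf := @FracField.tofrac R in
  y != 0 -> x - 1 != 0 -> g0 != 0 ->
  tf g2 / tf g0 = yF ((tf x - 1) / tf y) (tf y) ->
  tf g1 / tf g0 = 1 + rF (tf A) (tf B) ((tf x - 1) / tf y) (tf g2 / tf g0) * (tf g2 / tf g0) ->
  g2 * (x - 1) = (- (y + 1) * (x - 1) - y) * g0 /\
  (g1 - g0) * y * g0 ^+ 2 =
    (- (x - 1) * g0 ^+ 2 + A * y * g2 * (g2 + g0) + B * y * g0 ^+ 2) * g2.
Proof.
move=> tf y0 x1 g00 e2 e1.
have [|||h1 h2] := kmap_forms_field _ _ _ e2 e1; rewrite ?tofrac_eq0 //.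
  by rewrite -tofrac1 -tofracB tofrac_eq0.
by split; apply/eqP; rewrite -tofrac_eq !(tofracM, tofracD, tofracN, tofracXn, tofrac1); apply/eqP.
Qed.

(** Evaluated at a point, the first identity with r = 0 would give y' = 0 or a vanishing g0. So the
    points of r = 0, which iota sends to infinity, do not occur, and the remaining values follow by
    division. *)
Lemma rmorph_forms (R : nzRingType) (S : fieldType) (phi : {rmorphism R -> S})
    (A B x y g0 g1 g2 : R) (A' B' r y' : S) :
  phi A = A' -> phi B = B' -> phi x = 1 + r * y' -> phi y = y' ->
  y' != 0 -> phi g0 != 0 -> phi g2 / phi g0 != 0 ->
  g2 * (x - 1) = (- (y + 1) * (x - 1) - y) * g0 ->
  (g1 - g0) * y * g0 ^+ 2 =
    (- (x - 1) * g0 ^+ 2 + A * y * g2 * (g2 + g0) + B * y * g0 ^+ 2) * g2 ->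
  [/\ r != 0, phi g2 / phi g0 = yF r y' &
    phi g1 / phi g0 = 1 + rF A' B' r (yF r y') * yF r y'].
Proof.
move=> hA hB hx hy y0 g00 g20 /(congr1 phi) e1 /(congr1 phi) e2.
move: e1 e2; rewrite !(rmorphM, rmorphB, rmorphD, rmorphN, rmorphXn, rmorph1).
rewrite hA hB hx hy; move: (phi g0) (phi g1) (phi g2) g00 g20 => u v w u0 w0.
have -> : 1 + r * y' - 1 = r * y' by ring.
move=> e1 e2.
have r0 : r != 0.
  apply: contraTneq y0 => r0; move/eqP: e1; rewrite r0 mul0r !mulr0 sub0r mulNr.
  by rewrite eq_sym oppr_eq0 mulf_eq0 (negPf u0) orbF => /eqP ->; rewrite eqxx.
have wE : w / u = yF r y'.
  apply: (mulIf (mulf_neq0 r0 y0)); rewrite mulrAC e1 mulfK // /yF.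
  by field.
split=> //; rewrite -wE.
have -> : v / u = 1 + (v - u) * y' * u ^+ 2 / (u ^+ 3 * y') by field; rewrite u0 y0.
by rewrite e2 /rF; field; rewrite u0 y0.
Qed.

(** * Conjugacy *)

Section Evaluation.
Variable K : fieldType.

Lemma meval_homog n d (p : mpoly.mpoly n K) (c : K) v v' :
  p \is mpoly.ishomog1 d mpoly.mdeg -> (forall i, v' i = c * v i) ->
  mpoly.meval v' p = c ^+ d * mpoly.meval v p.
Proof.
move=> hp v'E; rewrite !mpoly.mevalE mulr_sumr.
apply: eq_big_seq => m mp; rewrite mulrCA; congr (_ * _).
have <- : mpoly.mdeg m = d := mpoly.dhomog_mf hp mp.
rewrite mpoly.mdegE -prodrXr -big_split /=; apply: eq_bigr => i _.
by rewrite v'E exprMn.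
Qed.

Lemma meval_dehomogenize (p : mpoly.mpoly 3 K) (w : K * K) v :
  v 0 = 1 -> v i1 = w.1 -> v i2 = w.2 ->
  mpoly.meval (fun i => if i == 0 then w.1 else w.2) (dehomogenize p) = mpoly.meval v p.
Proof.
move=> v0 v1 v2; rewrite /dehomogenize mpoly.comp_mpoly_meval.
apply: mpoly.meval_eq; apply: row3P.
- by rewrite (tnth_nth 0) /= mpoly.meval1.
- by rewrite (tnth_nth 0) /= /aff_var mpoly.mevalXU /=.
- by rewrite (tnth_nth 0) /= /aff_var mpoly.mevalXU /=.
Qed.

End Evaluation.

Lemma affine_coord0E (C : numClosedFieldType) (v : 'rV[C]_3) :
  affine_coord 0 v = (v 0 i1 / v 0 0, v 0 i2 / v 0 0).
Proof. by []. Qed.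

Lemma frac_scale (F : fieldType) (k x y : F) : k != 0 -> (k * x) / (k * y) = x / y.
Proof. by move=> k0; rewrite -mulf_div divff // mul1r. Qed.

Section Conjugacy.
Variables (R : realType) (a b : R[i]) (a0 : a != 0).
Local Notation C := R[i].
Local Notation Z := (Zsurf b a0).
Local Notation cst := (@rat_cst C).
Local Notation M := (mpoly.mpoly 2 C).

Definition pibim : bimeromorphic Z (P2 C) :=
  Bimeromorphic (@piexc_analytic C a b a0) (@picexc_analytic C)
    (@piexc_dense C a b a0) (@picexc_dense C) (@pi_mapP C a b a0)
    (@pi_invP C a b a0) (@pigraph_analytic C a b a0).

Definition kpt : Z -> Z := jpt b \o @ipt C a.

Lemma kpt_biholomorphic : biholomorphic kpt.
Proof.
exists (@ipt C a \o jpt b : Z -> Z); split.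
- by move=> z; rewrite /kpt /= jptK iptK.
- by move=> z; rewrite /kpt /= iptK jptK.
- move=> z; exact: (@holomorphic_at_comp _ _ _ _ Z Z Z (@ipt C a) (@jpt C a b) z
    (@ipt_holomorphic C a b a0 z) (@jpt_holomorphic C a b a0 _)).
- move=> z; exact: (@holomorphic_at_comp _ _ _ _ Z Z Z (@jpt C a b) (@ipt C a) z
    (@jpt_holomorphic C a b a0 z) (@ipt_holomorphic C a b a0 _)).
Qed.

Lemma Zsurf_compact_surface : compact_surface Z.
Proof.
split; first exact: (@Zsurf_hausdorff C a b a0).
  exact: (@Zsurf_compact C a b a0 (@complex_disc_compact R)).
exact: (@Zsurf_connected C a b a0 (@complex2_connected R)).
Qed.

Lemma affine_var1 : aff_var C 0 - 1 != 0.
Proof.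
have := rat_x_neq_cst (1 : C); apply: contra_neq => h.
by rewrite /rat_x /rat_cst -tofracB mpoly.mpolyC1 h tofrac0.
Qed.

(** [ratmap_value] permits any representing triple and fixes homogeneous coordinates only up to a
    factor; homogeneity turns these choices into the scalars c and k, which cancel in affine
    coordinates. *)
Lemma kmap_value (r y : C) (q : P2 C) : y != 0 -> ~ picexc q ->
  ratmap_value (kmap (cubic a b)) (P2_class (affine_vec 0 (1 + r * y, y))) q ->
  let w := affine_coord 0 (hcoord q) in
  [/\ r != 0, w.2 = yF r y & w.1 = 1 + rF a b r (yF r y) * yF r y].
Proof.
move=> y0 /picexcN[q0 q2] [d [g [[gh g00 k1 k2] [w0 qw]]]] w.
set G := fun i => dehomogenize (g i).
have ev_x : mpoly.meval (fun i : 'I_2 => if i == 0 then (1 + r * y) else y) (aff_var C 0) = 1 + r * y.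
  by rewrite mpoly.mevalXU.
have ev_y : mpoly.meval (fun i : 'I_2 => if i == 0 then (1 + r * y) else y) (aff_var C 1) = y.
  by rewrite mpoly.mevalXU.
set ev := mpoly.meval _ in ev_x ev_y.
have [c c0 cE] := hcoord_class (affine_vec 0 (1 + r * y, y)).
have [v0 v1 v2] := affine_row0 (1 + r * y, y).
have wE i : mpoly.meval (fun j => hcoord (P2_class (affine_vec 0 (1 + r * y, y))) 0 j) (g i) =
    c ^+ d * ev (G i).
  rewrite (meval_homog (gh i) cE); congr (_ * _).
  exact: esym (@meval_dehomogenize C (g i) (1 + r * y, y) _ v0 v1 v2).
have [k k0 qE] : exists2 k, k != 0 & forall j, hcoord q 0 j = k * ev (G j).
  case/andP: qw => /sub_rVP[k qk] _; exists (k * c ^+ d).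
    rewrite mulf_neq0 ?expf_neq0 //; apply: contraNneq q0 => k0.
    by rewrite qk k0 scale0r mxE.
  by move=> j; rewrite qk !mxE wE mulrA.
have G00 : ev (G 0) != 0 by apply: contraNneq q0 => h; rewrite qE h mulr0.
have i1E : i1 = 1 by exact/val_inj. have i2E : i2 = 2 by exact/val_inj.
have wG : w = (ev (G 1) / ev (G 0), ev (G 2) / ev (G 0)).
  rewrite /w affine_coord0E (qE 0) (qE i1) (qE i2) i1E i2E.
  exact: (congr2 pair (frac_scale _ _ k0) (frac_scale _ _ k0)).
have [e2 e1] := kmapE a b; rewrite -e2 k1 k2 in e1; rewrite k2 in e2.
have Y0 : aff_var C 1 != 0 by have := rat_y_neq0 C; rewrite /rat_y tofrac_eq0.
have [p1 p2] := kmap_forms Y0 affine_var1 g00 e2 e1.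
rewrite -/w wG /= in q2; rewrite wG /=.
exact: (@rmorph_forms M C (mpoly.meval (fun i : 'I_2 => if i == 0 then 1 + r * y else y))
  _ _ _ _ _ _ _ _ _ _ _ (mpoly.mevalC _ a) (mpoly.mevalC _ b) ev_x ev_y y0 G00 q2 p1 p2).
Qed.

Lemma kmap_conjugate : conjugate_to_automorphism (kmap (cubic a b)).
Proof.
exists Z, pibim, kpt; split.
- exact: Zsurf_compact_surface.
- exact: kpt_biholomorphic.
move=> z q zN qN; have /negP := zN; rewrite negbK; case: z zN => //= r y _ y0 kq.
have [r0 w2 w1] := kmap_value y0 qN kq.
have [_ y'0] := picexcN qN.
rewrite /piinv w1 w2 addrC addKr mulfK; last by rewrite -w2.
rewrite /kpt /= (negPf r0) /=; congr Aff.
by rewrite /rF /fpol /yF; ring.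
Qed.

End Conjugacy.

Theorem theorem2 (R : realType) (a b : R[i]) (ha : a != 0) :
  let F : {poly R[i]} := a *: 'X^3 + a *: 'X^2 + b *: 'X + 2%:P in
  [/\ conjugate_to_automorphism (kmap F),
      quadratic_degree_growth (kmap F)
    & integrable (kmap F)].
Proof.
move=> F; split.
- exact: kmap_conjugate ha.
- exact: kmap_quadratic_growth ha.
- exact: kmap_integrable.
Qed.
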